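(* Let $\{S_t\}_{t\ge 0}$ be the weighted translation semigroup on $L^2(\mathbb{R}_+)$ with symbol $\varphi$. Assume that for every $t\in\mathbb{R}_+$ one has $\inf_{x\in\mathbb{R}_+}\frac{\varphi(x+t)}{\varphi(x)}>0$. Fix $t>0$. Let $S_t'$ be the Cauchy dual of $S_t$, let $L_t=(S_t')^*$, let $E=\ker S_t^*$, and let $D_r=\{z\in\mathbb{C}: |z|<r(L_t)^{-1}\}$, where $r(L_t)$ is the spectral radius of $L_t$. Then there exist a reproducing kernel Hilbert space $\mathcal{H}$ of $E$-valued analytic functions on $D_r$ and a unitary operator $U:L^2(\mathbb{R}_+)\to\mathcal{H}$ such that $\mathcal{M}_zU=US_t$, where $\mathcal{M}_z$ denotes the operator of multiplication by $z$ on $\mathcal{H}$. Further, $U$ maps $E$ onto the subspace $\mathcal{E}$ of $E$-valued constant functions in $\mathcal{H}$, with $(Ue)(z)=e$ for all $z\in D_r$ and every $e\in E$. Moreover, the following hold. (i) The reproducing kernel $k_{\mathcal{H}}:D_r\times D_r\to B(E)$ associated with $\mathcal{H}$ satisfies, for every $e\in E$ and $\lambda\in D_r$, $k_{\mathcal{H}}(\cdot,\lambda)e\in\mathcal{H}$, and for every $f\in L^2(\mathbb{R}_+)$, $$\langle (Uf)(\lambda),e\rangle_E=\langle Uf,k_{\mathcal{H}}(\cdot,\lambda)e\rangle_{\mathcal{H}}.$$ (ii) The reproducing kernel is a diagonal operator on $E$ in the sense that, for $z,\lambda\in D_r$, $e\in E$ and $x\in\mathbb{R}_+$, $$(k_{\mathcal{H}}(z,\lambda)e)(x)=\left(\sum_{n=0}^\infty\frac{\varphi(x)}{\varphi(x+nt)}z^n\overline{\lambda}^n\right)e(x).$$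 (iii) The $E$-valued polynomials in $z$ are dense in $\mathcal{H}$. (iv) The Hilbert space $\mathcal{H}$ admits an orthonormal basis consisting of $E$-valued polynomials in $z$.
   Context: $\mathbb{R}_+=[0,\infty)$, and $L^2(\mathbb{R}_+)$ is the Hilbert space of complex-valued square integrable Lebesgue measurable functions on $\mathbb{R}_+$. The symbol $\varphi:\mathbb{R}_+\to(0,\infty)$ is a positive continuous function such that for every $t\in\mathbb{R}_+$ the function $\varphi_t$, given by $\varphi_t(x)=\sqrt{\varphi(x)/\varphi(x-t)}$ for $x\ge t$ and $\varphi_t(x)=0$ for $x<t$, is essentially bounded. The weighted translation semigroup with symbol $\varphi$ is the family of bounded operators $\{S_t\}_{t\ge0}$ on $L^2(\mathbb{R}_+)$ given by $(S_tf)(x)=\sqrt{\varphi(x)/\varphi(x-t)}\,f(x-t)$ for $x\ge t$ and $(S_tf)(x)=0$ for $x<t$. The condition $\inf_x\varphi(x+t)/\varphi(x)>0$ for every $t$ ensures that each $S_t$ is left invertible. The Cauchy dual of a left invertible operator $T$ on a Hilbert space is $T'=T(T^*T)^{-1}$. $B(E)$ denotes the bounded linear operators on $E$; elements of $E\subseteq L^2(\mathbb{R}_+)$ are functions (up to a.e. equality), so pointwise identities in $x$ are understood almost everywhere. A reproducing kernel Hilbert space of $E$-valued functions on $D_r$ is a Hilbert space of such functions on which all point evaluations are bounded; its reproducing kernel $k_{\mathcal{H}}$ is the $B(E)$-valued function determined by $\langle g(\lambda),e\rangle_E=\langle g,k_{\mathcal{H}}(\cdot,\lambda)e\rangle_{\mathcal{H}}$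 for $g\in\mathcal{H}$, $e\in E$, $\lambda\in D_r$. An $E$-valued polynomial in $z$ is a function $z\mapsto\sum_{n=0}^N e_nz^n$ with $e_n\in E$. *)

(* Defs.v *)
From HB Require Import structures.
From mathcomp Require Import all_boot all_order all_algebra.
From mathcomp Require Import complex ring lra.
From mathcomp Require Import all_classical all_reals all_analysis.
From mathcomp Require Import measurable_realfun.

Set Implicit Arguments.
Unset Strict Implicit.
Unset Printing Implicit Defensive.
Import Order.TTheory GRing.Theory Num.Theory.
Import numFieldNormedType.Exports.
Local Open Scope classical_set_scope.
Local Open Scope complex_scope.
Local Open Scope ring_scope.

HB.instance Definition _ (R : realType) := NormedModule.copy R[i] R[i]^o.

(* The inner product is linear in its first argument. *)
HB.mixin Record NormedModule_isPreHilbert (R : realType) H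
    & NormedModule R[i] H := {
  inner : H -> H -> R[i] ;
  inner_linear : forall (a : R[i]) (x y z : H),
    inner (a *: x + y) z = a * inner x z + inner y z ;
  inner_conj : forall x y : H, inner y x = (inner x y)^* ;
  inner_norm : forall x : H, inner x x = `|x| ^+ 2
}.

#[short(type="preHilbertType")]
HB.structure Definition PreHilbert (R : realType) :=
  {H of NormedModule R[i] H & NormedModule_isPreHilbert R H}.

#[short(type="hilbertType")]
HB.structure Definition Hilbert (R : realType) :=
  {H of PreHilbert R H & Complete H}.

HB.factory Record Lmodule_isPreHilbert (R : realType) H
    & GRing.Lmodule R[i] H := {
  dot : H -> H -> R[i] ;
  dot_linear : forall (a : R[i]) (x y z : H),
    dot (a *: x + y) z = a * dot x z + dot y z ;
  dot_conj : forall x y : H, dot y x = (dot x y)^* ;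
  dot_ge0 : forall x : H, 0 <= dot x x ;
  dot_eq0 : forall x : H, dot x x = 0 -> x = 0
}.

HB.builders Context R H & Lmodule_isPreHilbert R H.

Let norm (x : H) : R[i] := sqrtC (dot x x).

Let dotDl x y z : dot (x + y) z = dot x z + dot y z.
Proof. by have := dot_linear 1 x y z; rewrite scale1r mul1r. Qed.

Let dot0l z : dot 0 z = 0.
Proof. by apply: (addrI (dot 0 z)); rewrite -dotDl !addr0. Qed.

Let dotZl a x z : dot (a *: x) z = a * dot x z.
Proof. by have := dot_linear a x 0 z; rewrite addr0 dot0l addr0. Qed.

Let dotDr x y z : dot x (y + z) = dot x y + dot x z.
Proof. by rewrite (dot_conj (y + z)) dotDl rmorphD /= -!dot_conj. Qed.

Let dotZr a x y : dot x (a *: y) = a^* * dot x y.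
Proof. by rewrite (dot_conj (a *: y)) dotZl rmorphM /= -dot_conj. Qed.

Let normK x : norm x ^+ 2 = dot x x. Proof. exact: sqrtCK. Qed.

Let norm_ge0 x : 0 <= norm x. Proof. by rewrite sqrtC_ge0 dot_ge0. Qed.

Let cauchy_schwarz x y : `|dot x y| <= norm x * norm y.
Proof.
rewrite -(@ler_pXn2r _ 2) ?nnegrE ?mulr_ge0//= exprMn !normK.
have [y0|yn0] := eqVneq (dot y y) 0.
  by rewrite (dot_eq0 y0) (dot_conj 0) !dot0l rmorph0 normr0 expr0n mulr0.
have ypos : 0 < dot y y by rewrite lt_def yn0 dot_ge0.
have yr : (dot y y)^* = dot y y by rewrite -dot_conj.
have := dot_ge0 (x + (- (dot x y / dot y y)) *: y).
rewrite dotDl !dotDr !dotZl !dotZr (dot_conj x y).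
rewrite !rmorphN !rmorphM /= fmorphV /= yr.
set u := dot x y; set v := dot y y; set w := dot x x => h.
have e : w + - (u^* / v) * u + (- (u / v) * u^* + - (u / v) * (- (u^* / v) * v))
    = w - u * u^* / v.
  by rewrite mulrA; field.
move: h; rewrite e subr_ge0 ler_pdivrMr// => h.
by rewrite normCK.
Qed.

Let ler_normD x y : norm (x + y) <= norm x + norm y.
Proof.
rewrite -(@ler_pXn2r _ 2) ?nnegrE ?addr_ge0//= sqrrD !normK dotDl !dotDr.
rewrite (dot_conj x y).
have -> : dot x x + dot x y + ((dot x y)^* + dot y y) =
    dot x x + (dot x y + (dot x y)^*) + dot y y by rewrite !addrA.
rewrite lerD2r lerD2l.
apply: (@le_trans _ _ (`|dot x y| *+ 2)); last by rewrite ler_wMn2r ?cauchy_schwarz.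
apply: (@le_trans _ _ `|dot x y + (dot x y)^*|).
  apply: real_ler_norm; apply/CrealP.
  by rewrite rmorphD /= conjCK addrC.
by rewrite (le_trans (ler_normD _ _))// norm_conjC mulr2n.
Qed.

Let normrZ (l : R[i]) (x : H) : norm (l *: x) = `|l| * norm x.
Proof.
apply/eqP; rewrite -(@eqrXn2 _ 2) ?mulr_ge0// exprMn !normK.
by rewrite dotZl dotZr normCK mulrA.
Qed.

Let normr0_eq0 (x : H) : norm x = 0 -> x = 0.
Proof. by move=> x0; apply: dot_eq0; rewrite -normK x0 expr0n. Qed.

HB.instance Definition _ :=
  Lmodule_isNormed.Build R[i] H ler_normD normrZ normr0_eq0.

Let dot_norm (x : H) : dot x x = `|x| ^+ 2.
Proof. by rewrite -normK. Qed.

HB.instance Definition _ := NormedModule_isPreHilbert.Build R H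
  dot_linear dot_conj dot_norm.

HB.end.

Record boundedOp (R : realType) (H K : preHilbertType R) := BoundedOp {
  bop_fun :> {linear H -> K} ;
  bop_bounded : exists M : R, forall x, `|bop_fun x| <= M%:C * `|x|
}.
Notation "''B' ( H , K )" := (boundedOp H K) (at level 8, format "''B' ( H ,  K )").
Notation "''B' ( H )" := (boundedOp H H) (at level 8, format "''B' ( H )").

Section BoundedOp.
Variables (R : realType).

Lemma bop0_bounded (H K : preHilbertType R) : exists M : R,
  forall x, `|(\0 : {linear H -> K}) x| <= M%:C * `|x|.
Proof. by exists 0 => x; rewrite /= normr0 mul0r. Qed.

HB.instance Definition _ (H K : preHilbertType R) := gen_eqMixin 'B(H, K).
HB.instance Definition _ (H K : preHilbertType R) := gen_choiceMixin 'B(H, K).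
HB.instance Definition _ (H K : preHilbertType R) :=
  isPointed.Build 'B(H, K) (BoundedOp (@bop0_bounded H K)).

Lemma bop_comp_bounded (H K L : preHilbertType R) (A : 'B(K, L)) (B : 'B(H, K)) :
  exists M : R, forall x, `|(A \o B : {linear H -> L}) x| <= M%:C * `|x|.
Proof.
have [M hM] := bop_bounded A; have [N hN] := bop_bounded B.
exists (Num.max M 0 * N) => x; rewrite /= (le_trans (hM _))//.
have M0 : M%:C <= (Num.max M 0)%:C by rewrite lecR le_max lexx.
apply: (le_trans (ler_wpM2r _ M0)) => //.
rewrite rmorphM /= -mulrA ler_wpM2l//.
by rewrite ler0c le_max lexx orbT.
Qed.

Definition bop_comp (H K L : preHilbertType R) (A : 'B(K, L)) (B : 'B(H, K)) :
  'B(H, L) := BoundedOp (bop_comp_bounded A B).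

(* [get P] is an element satisfying [P] when there is one, and the zero operator
   otherwise. The adjoint exists (uniquely) as soon as [H] is complete. *)
Definition adjoint (H K : preHilbertType R) (T : 'B(H, K)) : 'B(K, H) :=
  get [set T' : 'B(K, H) | forall x y, inner (T x) y = inner x (T' y)].

Definition bop_inv (H : preHilbertType R) (T : 'B(H)) : 'B(H) :=
  get [set S : 'B(H) | cancel T S /\ cancel S T].

Definition cauchy_dual (H : preHilbertType R) (T : 'B(H)) : 'B(H) :=
  bop_comp T (bop_inv (bop_comp (adjoint T) T)).

Definition spectrum (H : preHilbertType R) (T : 'B(H)) : set R[i] :=
  [set z | ~ exists S : 'B(H),
     (forall x, S (z *: x - T x) = x) /\ (forall x, z *: S x - T (S x) = x)].

Definition spectral_radius (H : preHilbertType R) (T : 'B(H)) : R :=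
  sup [set Normc.normc z | z in spectrum T].

Definition unitary (H K : preHilbertType R) (U : {linear H -> K}) :=
  (forall x y, inner (U x) (U y) = inner x y) /\ (forall y, exists x, U x = y).

Definition linear_span (H : preHilbertType R) (B : set H) : set H :=
  [set x | exists n (c : 'I_n -> R[i]) (b : 'I_n -> H),
     (forall i, B (b i)) /\ x = \sum_(i < n) c i *: b i].

Definition orthonormal_basis (H : preHilbertType R) (B : set H) :=
  (forall b c, B b -> B c -> inner b c = (b == c)%:R) /\ dense (linear_span B).

End BoundedOp.

Section Kernel.
Variables (R : realType) (H K : preHilbertType R) (T : 'B(H, K)).

Definition ker_pred : {pred H} := fun x => T x == 0.

Lemma ker_submod_closed : submod_closed ker_pred.
Proof.
split=> [|a x y /eqP x0 /eqP y0]; first by rewrite unfold_in linear0.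
by rewrite unfold_in linearP x0 y0 scaler0 addr0.
Qed.

HB.instance Definition _ :=
  GRing.isSubmodClosed.Build R[i] H ker_pred ker_submod_closed.

Record ker_space := KerSpace { ker_val :> H ; _ : ker_val \in ker_pred }.

HB.instance Definition _ := [isSub for ker_val].
HB.instance Definition _ := [Choice of ker_space by <:].
HB.instance Definition _ := [SubChoice_isSubLmodule of ker_space by <:].

Let kdot (x y : ker_space) : R[i] := inner (val x) (val y).

Let kdot_linear a x y z : kdot (a *: x + y) z = a * kdot x z + kdot y z.
Proof. by rewrite /kdot linearP inner_linear. Qed.

Let kdot_conj x y : kdot y x = (kdot x y)^*.
Proof. exact: inner_conj. Qed.

Let kdot_ge0 x : 0 <= kdot x x.
Proof. by rewrite /kdot inner_norm exprn_ge0. Qed.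

Let kdot_eq0 x : kdot x x = 0 -> x = 0.
Proof.
rewrite /kdot inner_norm => /eqP; rewrite sqrf_eq0 normr_eq0 => /eqP x0.
by apply: val_inj; rewrite x0 linear0.
Qed.

HB.instance Definition _ := Lmodule_isPreHilbert.Build R ker_space
  kdot_linear kdot_conj kdot_ge0 kdot_eq0.

End Kernel.

Section L2.
Variable R : realType.

Local Notation mu := (@lebesgue_measure R).
Local Notation halfline := ([set` `[0%R, +oo[%R] : set R).

Lemma measurable_halfline : measurable (halfline : set (measurableTypeR R)).
Proof. exact: measurable_itv. Qed.

Definition sqint_real (u : R -> R) := measurable_fun halfline u /\
  mu.-integrable halfline (EFin \o (fun x => u x ^+ 2)).

Lemma sqint_realM u v : sqint_real u -> sqint_real v ->
  mu.-integrable halfline (EFin \o (fun x => u x * v x)).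
Proof.
move=> [mu_ iu] [mv iv].
apply: (@le_integrable _ _ _ _ _ measurable_halfline _
  (EFin \o (fun x => u x ^+ 2 + v x ^+ 2))).
- by apply/measurable_EFinP; exact: measurable_funM.
- move=> x _ /=; rewrite lee_fin [leRHS]ger0_norm ?addr_ge0 ?sqr_ge0// ler_norml.
  apply/andP; split.
    have := sqr_ge0 (u x + v x); have := sqr_ge0 (u x).
    by have := sqr_ge0 (v x); nra.
  have := sqr_ge0 (u x - v x); have := sqr_ge0 (u x).
  by have := sqr_ge0 (v x); nra.
- by apply: eq_integrable (integrableD measurable_halfline iu iv).
Qed.

Lemma sqint_realZ a u : sqint_real u -> sqint_real (fun x => a * u x).
Proof.
move=> [mu_ iu]; split; first exact: measurable_funM.
apply: eq_integrable (integrableZl measurable_halfline (a ^+ 2) iu) => // x _.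
by rewrite /= -EFinM exprMn.
Qed.

Lemma sqint_realD u v : sqint_real u -> sqint_real v ->
  sqint_real (fun x => u x + v x).
Proof.
move=> su sv; split; first by apply: measurable_funD; [case: su|case: sv].
have iuv := sqint_realM su sv.
apply: eq_integrable (integrableD measurable_halfline (integrableD measurable_halfline su.2 sv.2)
  (integrableZl measurable_halfline 2 iuv)) => // x _.
by rewrite /= -EFinM -!EFinD; congr EFin; ring.
Qed.

(* The functions are defined on [R] but only their values on [0, +oo[ matter.
   Measurability is Borel measurability: every Lebesgue measurable function
   agrees a.e. with a Borel one, so the quotient [L2] below is the same. *)
Definition square_integrable : {pred R -> R[i]} := mem [set f : R -> R[i] |
  [/\ measurable_fun halfline (fun x => complex.Re (f x)),
      measurable_fun halfline (fun x => complex.Im (f x)) &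
      (\int[mu]_(x in halfline) ((Normc.normc (f x)) ^+ 2)%:E < +oo)%E]].

Lemma normc2 (z : R[i]) :
  Normc.normc z ^+ 2 = complex.Re z ^+ 2 + complex.Im z ^+ 2.
Proof. by case: z => a b /=; rewrite sqr_sqrtr// addr_ge0 ?sqr_ge0. Qed.

Lemma square_integrableP f : f \in square_integrable <->
  sqint_real (fun x => complex.Re (f x)) /\ sqint_real (fun x => complex.Im (f x)).
Proof.
rewrite unfold_in /= inE; split=> [[mre mim fin]|[[mre ire] [mim iim]]].
  have i2 : mu.-integrable halfline
      (EFin \o (fun x => complex.Re (f x) ^+ 2 + complex.Im (f x) ^+ 2)).
    apply/integrableP; split.
      by apply/measurable_EFinP; apply: measurable_funD; exact: measurable_funX.
    rewrite (le_lt_trans _ fin)// le_eqVlt; apply/orP; left; apply/eqP.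
    apply: eq_integral => x _ /=.
    by rewrite normc2 ger0_norm ?addr_ge0 ?sqr_ge0.
  split; split=> //; apply: le_integrable i2 => //.
  - by apply/measurable_EFinP; exact: measurable_funX.
  - by move=> x _ /=; rewrite lee_fin !ger0_norm ?addr_ge0 ?sqr_ge0// lerDl sqr_ge0.
  - by apply/measurable_EFinP; exact: measurable_funX.
  - by move=> x _ /=; rewrite lee_fin !ger0_norm ?addr_ge0 ?sqr_ge0// lerDr sqr_ge0.
split=> //; have /integrableP[_] := integrableD measurable_halfline ire iim.
apply: le_lt_trans; rewrite le_eqVlt; apply/orP; left; apply/eqP.
apply: eq_integral => x _ /=.
by rewrite normc2 ger0_norm ?addr_ge0 ?sqr_ge0.
Qed.

Lemma square_integrable_submod_closed : submod_closed square_integrable.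
Proof.
split=> [|a f g /square_integrableP[fr fi] /square_integrableP[gr gi]].
  have s0 : sqint_real (fun=> 0).
    split; first exact: measurable_cst.
    by apply: eq_integrable (integrable0 mu halfline) => // x _; rewrite /= expr0n.
  by apply/square_integrableP.
apply/square_integrableP; split.
  have := sqint_realD (sqint_realD (sqint_realZ (complex.Re a) fr)
    (sqint_realZ (- complex.Im a) fi)) gr.
  congr sqint_real; apply/funext => x.
  have -> : (a *: f + g) x = a * f x + g x by [].
  by case: a (f x) (g x) => [a1 a2] [f1 f2] [g1 g2] /=; ring.
have := sqint_realD (sqint_realD (sqint_realZ (complex.Re a) fi)
  (sqint_realZ (complex.Im a) fr)) gi.
congr sqint_real; apply/funext => x.
have -> : (a *: f + g) x = a * f x + g x by [].
by case: a (f x) (g x) => [a1 a2] [f1 f2] [g1 g2] /=; ring.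
Qed.

HB.instance Definition _ := GRing.isSubmodClosed.Build R[i] (R -> R[i])
  square_integrable square_integrable_submod_closed.

Record L2_fun := L2Fun
  { L2_fun_val :> R -> R[i] ; _ : L2_fun_val \in square_integrable }.

HB.instance Definition _ := [isSub for L2_fun_val].
HB.instance Definition _ := [Choice of L2_fun by <:].
HB.instance Definition _ := [SubChoice_isSubLmodule of L2_fun by <:].

Definition L2_null : {pred L2_fun} :=
  mem [set f : L2_fun | {ae mu, forall x, 0 <= x -> f x = 0}].

Lemma L2_null_submod_closed : submod_closed L2_null.
Proof.
split=> [|a f g]; rewrite !unfold_in /= !inE.
  by apply: nearW => x _.
have F := ae_filter_ringOfSetsType mu.
apply: filterS2 => x f0 g0 x0.
have -> : (a *: f + g) x = a * f x + g x by [].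
by rewrite f0// g0// mulr0 addr0.
Qed.

HB.instance Definition _ :=
  GRing.isSubmodClosed.Build R[i] L2_fun L2_null L2_null_submod_closed.

Definition L2 : Type := {ideal_quot L2_null}.

HB.instance Definition _ := GRing.Zmodule.on L2.
HB.instance Definition _ := Quotient.on L2.

Local Open Scope quotient_scope.

(* A representative of the class; meaningful up to null sets, on [0, +oo[. *)
Definition L2_to_fun (f : L2) : R -> R[i] := (repr f : L2_fun).
Coercion L2_to_fun : L2 >-> Funclass.

Lemma L2_eqP (f g : L2_fun) : (\pi_L2 f = \pi_L2 g) <->
  {ae mu, forall x, 0 <= x -> f x = g x}.
Proof.
have F := ae_filter_ringOfSetsType mu.
have E x : (f - g) x = f x - g x by [].
rewrite (rwP eqP) -Quotient.idealrBE unfold_in /= inE /=; split.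
  apply: filterS => x fg x0; apply/eqP; rewrite -subr_eq0 -E.
  by apply/eqP; exact: fg.
by apply: filterS => x fg x0; apply: (etrans (E x)); rewrite fg// subrr.
Qed.

Lemma L2_reprP (f : L2_fun) : {ae mu, forall x, 0 <= x -> repr (\pi_L2 f) x = f x}.
Proof. by apply/L2_eqP; rewrite reprK. Qed.

Definition L2_scale (a : R[i]) (f : L2) : L2 := \pi_L2 (a *: (repr f : L2_fun)).

Lemma L2_scaleE a f : L2_scale a (\pi_L2 f) = \pi_L2 (a *: f).
Proof.
have F := ae_filter_ringOfSetsType mu.
apply/L2_eqP; apply: filterS (L2_reprP f) => x fx x0.
have E (g : L2_fun) : (a *: g) x = a * g x by [].
by rewrite !E fx.
Qed.

Lemma L2_addE (f g : L2_fun) : \pi_L2 f + \pi_L2 g = \pi_L2 (f + g).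
Proof. exact: esym (Quotient.pi_add _ f g). Qed.

Lemma L2_scaleA a b v : L2_scale a (L2_scale b v) = L2_scale (a * b) v.
Proof. by elim/quotW: v => f; rewrite (L2_scaleE b) !L2_scaleE scalerA. Qed.

Lemma L2_scale1 v : L2_scale 1 v = v.
Proof. by elim/quotW: v => f; rewrite L2_scaleE scale1r. Qed.

Lemma L2_scaleDr a : {morph L2_scale a : u v / u + v}.
Proof.
by elim/quotW=> f; elim/quotW=> g; rewrite L2_addE !L2_scaleE L2_addE scalerDr.
Qed.

Lemma L2_scaleDl v : {morph L2_scale^~ v : a b / a + b}.
Proof. by elim/quotW: v => f a b; rewrite !L2_scaleE L2_addE scalerDl. Qed.

HB.instance Definition _ := GRing.Zmodule_isLmodule.Build R[i] L2
  L2_scaleA L2_scale1 L2_scaleDr L2_scaleDl.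

Definition complex_integral (f : R -> R[i]) : R[i] :=
  Complex (\int[mu]_(x in halfline) complex.Re (f x))
          (\int[mu]_(x in halfline) complex.Im (f x)).

Definition L2_inner (f g : L2) : R[i] :=
  complex_integral (fun x => f x * (g x)^*).

Definition cintegrable (f : R -> R[i]) :=
  mu.-integrable halfline (EFin \o (fun x => complex.Re (f x))) /\
  mu.-integrable halfline (EFin \o (fun x => complex.Im (f x))).

Lemma cintegrable_mul (f g : L2_fun) : cintegrable (fun x => f x * (g x)^*).
Proof.
case: f g => [f /square_integrableP[fr fi]] [g /square_integrableP[gr gi]] /=.
split.
  apply: eq_integrable (integrableD measurable_halfline (sqint_realM fr gr) (sqint_realM fi gi)) => //.
  by move=> x _ /=; case: (f x) (g x) => [a b] [c d] /=; congr EFin; ring.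
apply: eq_integrable (integrableB measurable_halfline (sqint_realM fi gr) (sqint_realM fr gi)) => //.
by move=> x _ /=; case: (f x) (g x) => [a b] [c d] /=; congr EFin; ring.
Qed.

Lemma complex_integralP (a : R[i]) (f g : R -> R[i]) :
  cintegrable f -> cintegrable g ->
  complex_integral (fun x => a * f x + g x) =
    a * complex_integral f + complex_integral g.
Proof.
move=> [fr fi] [gr gi]; rewrite /complex_integral.
have Zint c (u : R -> R) : mu.-integrable halfline (EFin \o u) ->
    mu.-integrable halfline (EFin \o (fun x => c * u x)).
  by move=> iu; apply: eq_integrable (integrableZl measurable_halfline c iu).
have Dint (u v : R -> R) : mu.-integrable halfline (EFin \o u) ->
    mu.-integrable halfline (EFin \o v) ->
    mu.-integrable halfline (EFin \o (fun x => u x + v x)).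
  by move=> iu iv; apply: eq_integrable (integrableD measurable_halfline iu iv).
transitivity (Complex
  (\int[mu]_(x in halfline) (complex.Re a * complex.Re (f x)
     + - complex.Im a * complex.Im (f x) + complex.Re (g x)))
  (\int[mu]_(x in halfline) (complex.Re a * complex.Im (f x)
     + complex.Im a * complex.Re (f x) + complex.Im (g x)))).
  by congr Complex; apply: eq_Rintegral => x _; case: a (f x) (g x)
    => [a1 a2] [f1 f2] [g1 g2] /=; ring.
rewrite !RintegralD// ?RintegralZl//; do ?[exact: Zint|exact: Dint (Zint _ _ _) (Zint _ _ _)].
by case: a => [a1 a2] /=; apply/eqP; rewrite eq_complex /=; apply/andP; split;
  apply/eqP; ring.
Qed.

Lemma complex_integral_ae (f g : L2_fun) (f' g' : L2_fun) :
  {ae mu, forall x, 0 <= x -> f x = f' x} ->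
  {ae mu, forall x, 0 <= x -> g x = g' x} ->
  complex_integral (fun x => f x * (g x)^*) =
  complex_integral (fun x => f' x * (g' x)^*).
Proof.
have F := ae_filter_ringOfSetsType mu.
move=> ff gg.
have [[r1 i1] [r2 i2]] := (cintegrable_mul f g, cintegrable_mul f' g').
congr Complex; rewrite /Rintegral; congr fine; apply: ae_eq_integral => //.
- by case/integrableP: r1.
- by case/integrableP: r2.
- apply: filterS2 ff gg => x fx gx /=.
  by rewrite in_itv/= andbT => x0; rewrite fx// gx.
- by case/integrableP: i1.
- by case/integrableP: i2.
- apply: filterS2 ff gg => x fx gx /=.
  by rewrite in_itv/= andbT => x0; rewrite fx// gx.
Qed.

Lemma L2_innerE (f g : L2_fun) :
  L2_inner (\pi_L2 f) (\pi_L2 g) = complex_integral (fun x => f x * (g x)^*).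
Proof. by apply: complex_integral_ae; exact: L2_reprP. Qed.

Lemma L2_inner_linear a (f g h : L2) :
  L2_inner (a *: f + g) h = a * L2_inner f h + L2_inner g h.
Proof.
elim/quotW: f => f; elim/quotW: g => g; elim/quotW: h => h.
have -> : a *: \pi_L2 f = \pi_L2 (a *: f) by exact: L2_scaleE.
rewrite L2_addE !L2_innerE -complex_integralP; [|exact: cintegrable_mul..].
congr complex_integral; apply/funext => x.
have -> : (a *: f + g) x = a * f x + g x by [].
by rewrite mulrDl mulrA.
Qed.

Lemma complex_integral_conj (f : R -> R[i]) : cintegrable f ->
  complex_integral (fun x => (f x)^*) = (complex_integral f)^*.
Proof.
move=> [fr fi]; rewrite /complex_integral.
transitivity (Complex (\int[mu]_(x in halfline) complex.Re (f x))
  (\int[mu]_(x in halfline) ((-1) * complex.Im (f x)))).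
  by congr Complex; apply: eq_Rintegral => x _; case: (f x) => a b //=; rewrite mulN1r.
by rewrite RintegralZl// mulN1r.
Qed.

Lemma L2_inner_conj (f g : L2) : L2_inner g f = (L2_inner f g)^*.
Proof.
rewrite /L2_inner -complex_integral_conj; last exact: cintegrable_mul.
by congr complex_integral; apply/funext => x; rewrite rmorphM /= conjCK mulrC.
Qed.

Lemma L2_inner_diag (f : L2_fun) : L2_inner (\pi_L2 f) (\pi_L2 f) =
  (\int[mu]_(x in halfline) (Normc.normc (f x) ^+ 2))%:C.
Proof.
rewrite L2_innerE /complex_integral; congr Complex.
  by apply: eq_Rintegral => x _; rewrite normc2; case: (f x) => a b /=; ring.
rewrite (_ : (fun x => _) = fun=> 0); last first.
  by apply/funext => x; case: (f x) => a b /=; ring.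
by rewrite Rintegral_cst//= mul0r.
Qed.

Lemma L2_inner_ge0 (f : L2) : 0 <= L2_inner f f.
Proof.
elim/quotW: f => f; rewrite L2_inner_diag ler0c Rintegral_ge0// => x _.
exact: sqr_ge0.
Qed.

Lemma L2_inner_eq0 (f : L2) : L2_inner f f = 0 -> f = 0.
Proof.
elim/quotW: f => f; rewrite L2_inner_diag => /complexI f0.
have F := ae_filter_ringOfSetsType mu.
have ge0 x : 0 <= Normc.normc (f x) ^+ 2 := sqr_ge0 _.
have fin : (\int[mu]_(x in halfline) (Normc.normc (f x) ^+ 2)%:E < +oo)%E.
  by case: (f) => g /=; rewrite unfold_in /= inE => -[].
have int0 : (\int[mu]_(x in halfline) `|(Normc.normc (f x) ^+ 2)%:E| = 0)%E.
  under eq_integral do rewrite gee0_abs ?lee_fin//.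
  rewrite -[LHS]fineK; first by congr EFin; exact: f0.
  by rewrite ge0_fin_numE// integral_ge0// => x _; rewrite lee_fin.
have mf : measurable_fun halfline (fun x => (Normc.normc (f x) ^+ 2)%:E).
  have [[mr _] [mi _]] : sqint_real (fun x => complex.Re (f x)) /\
     sqint_real (fun x => complex.Im (f x)).
    by case: (f) => g gP; exact/square_integrableP.
  rewrite (_ : (fun x => _) =
    EFin \o (fun x => complex.Re (f x) ^+ 2 + complex.Im (f x) ^+ 2)); last first.
    by apply/funext => x; rewrite /= normc2.
  apply/measurable_EFinP.
  by apply: measurable_funD; exact: measurable_funX.
have /(ae_eq_integral_abs _ measurable_halfline mf) ae0 := int0.
have -> : (0 : L2) = \pi_L2 0.
  by apply: (addrI (\pi_L2 0)); rewrite L2_addE !addr0.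
apply/L2_eqP; apply: filterS ae0 => x /= fx x0.
have : halfline x by rewrite /= in_itv/= x0.
by move/fx => -[] /eqP; rewrite sqrf_eq0 => /eqP /Normc.eq0_normc.
Qed.

HB.instance Definition _ := Lmodule_isPreHilbert.Build R L2
  L2_inner_linear L2_inner_conj L2_inner_ge0 L2_inner_eq0.

End L2.

Section FunctionSpaces.
Variable R : realType.

(* [f] has a norm convergent power series expansion around every point of [D];
   [D] is meant to be open. *)
Definition analytic (E : preHilbertType R) (D : set R[i]) (f : D -> E) :=
  forall z0 : D, exists (rho : R) (a : nat -> E), 0 < rho /\
    forall z : D, `|val z - val z0| < rho%:C ->
      series (fun n => (val z - val z0) ^+ n *: a n) @ \oo --> f z.

Definition is_polynomial (E : preHilbertType R) (D : set R[i]) (f : D -> E) :=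
  exists (N : nat) (e : nat -> E),
    forall z : D, f z = \sum_(n < N.+1) val z ^+ n *: e n.

(* [rk_eval] identifies the Hilbert space [rk_space] with a space of functions
   from [D] to [E]. *)
Record rkhs (E : preHilbertType R) (D : set R[i]) := RKHS {
  rk_space :> hilbertType R ;
  rk_eval : {linear rk_space -> (D -> E)} ;
  rk_eval_inj : injective rk_eval ;
  rk_eval_bounded : forall z : D, exists M : R,
    forall g : rk_space, `|rk_eval g z| <= M%:C * `|g|
}.
Arguments rk_eval {E D} _.

Definition reproducing_kernel (E : preHilbertType R) (D : set R[i])
    (H : rkhs E D) (k : D -> D -> 'B(E)) :=
  forall (lambda : D) (e : E), exists h : H,
    rk_eval H h = (fun z => k z lambda e) /\
    forall g : H, inner (rk_eval H g lambda) e = inner g h.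

Definition multiplication_by_z (E : preHilbertType R) (D : set R[i])
    (H : rkhs E D) (M : 'B(H)) :=
  forall (g : H) (z : D), rk_eval H (M g) z = val z *: rk_eval H g z.

End FunctionSpaces.
Arguments rk_eval {R E D} _.

Section WeightedTranslation.
Variables (R : realType) (phi : R -> R).
Local Notation mu := (@lebesgue_measure R).

(* For [0 <= t] this vanishes on the negative half line. *)
Definition phi_ (t x : R) : R :=
  if t <= x then Num.sqrt (phi x / phi (x - t)) else 0.

Definition weighted_translation_semigroup (S : R -> 'B(L2 R)) :=
  forall t, 0 <= t -> forall f : L2 R,
    {ae mu, forall x, 0 <= x -> (S t f : L2 R) x =
      if t <= x then (Num.sqrt (phi x / phi (x - t)))%:C * f (x - t) else 0}.

End WeightedTranslation.

(* Main.v *)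
(* Realize the space on L^2 itself, sending f to the function
   z |-> P (1 - z L)^-1 f, where P = 1 - S L is the projection onto E = ker S^*
   (S = S_t, L = L_t). For z in D_r the inverse exists by the very definition of the spectrum,
   and the algebraic identities L S = 1, P S = 0 and L = 0 on E give the
   intertwining relation, the values on E and, by expanding resolvents around
   any point, analyticity.

   The kernel is found from h = sum_n conj(lambda)^n L'^n e with L' = L^*. On
   blocks [nt, (n+1)t[ the operators act as weighted shifts, so that
   P L^j L'^n e = 0 for j < n while L^n L'^n e = phi(x)/phi(x+nt) e(x). Hence
   P (1 - z L)^-1 L'^n e = z^n L^n L'^n e, which both gives the diagonal form of
   the kernel and bounds |L'^n e| by C rho^n |e| for every rho > r(L), without
   Gelfand's formula; testing on indicator functions turns this bound into
   phi(x)/phi(x+nt) <= C rho^(2n) almost everywhere.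

   Finally S^N L^N is multiplication by the indicator function of [Nt, oo[, so
   f is the limit of sum_(n<N) S^n P L^n f, a polynomial, and Zorn's lemma
   inside the orthogonal blocks S^n E provides the orthonormal basis. *)
From HB Require Import structures.
Require Import Defs.
From mathcomp Require Import all_boot all_order all_algebra.
From mathcomp Require Import complex ring lra.
From mathcomp Require Import all_classical all_reals all_analysis.
From mathcomp Require Import ess_sup_inf measurable_realfun.

Set Implicit Arguments.
Unset Strict Implicit.
Unset Printing Implicit Defensive.
Import Order.TTheory GRing.Theory Num.Theory.
Import numFieldNormedType.Exports.
Local Open Scope classical_set_scope.
Local Open Scope complex_scope.
Local Open Scope ring_scope.

(** * Real-valued norms and geometric sequences *)

(** The vector [h] is the Riesz representer of evaluation at [lambda]: since S^* e = 0, one has <P B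
    f, e> = <B f, e> with B the inverse of 1 - lambda L, so h has to be (1 - conj(lambda) L')^-1 e.
    The norm of L' is too crude to sum the Neumann series, because [lambda] may be anywhere in the
    disc given by the spectral radius. Only the growth of L'^n e for e in E matters, and it bounds
    itself: |L'^n e|^2 = <L^n L'^n e, e>, while the resolvent bounds L^n L'^n e by a multiple of
    L'^n e. The obstacle in (ii) is that norm bounds say nothing at a single point, and that
    convergence is claimed at almost every x >= 0, not only on [0, t[ where elements of E live.
    Hence null sets are collected over all n, and the constants depend on x beyond the first block.
    The realization is injective because a function vanishing near 0 has P L^n f = 0 for all n, so
    that f = S^n L^n f, which tends to 0. *)

Section RealNorm.
Context {R : realType}.

(** The norm of a module over [R[i]] takes values in [R[i]], where the order is only partial; its
    real part carries the same information and lets estimates take place in [R]. *)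
Definition rnorm (V : normedModType R[i]) (x : V) : R := complex.Re `|x|.

Section Normed.
Variable V : normedModType R[i].
Implicit Types (x y : V) (u : nat -> V).

Lemma rnormE x : `|x| = (rnorm x)%:C.
Proof. by rewrite /rnorm RRe_real// ger0_real. Qed.

Lemma rnorm_ge0 x : 0 <= rnorm x.
Proof. by rewrite -ler0c -rnormE. Qed.

Lemma rnorm0 : rnorm (0 : V) = 0.
Proof. by apply: complexI; rewrite -rnormE normr0. Qed.

Lemma rnorm0_eq0 x : rnorm x = 0 -> x = 0.
Proof. by move=> x0; apply/normr0_eq0; rewrite rnormE x0. Qed.

Lemma rnormN x : rnorm (- x) = rnorm x.
Proof. by rewrite /rnorm normrN. Qed.

Lemma rdistC x y : rnorm (x - y) = rnorm (y - x).
Proof. by rewrite -rnormN opprB. Qed.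

Lemma ler_rnormD x y : rnorm (x + y) <= rnorm x + rnorm y.
Proof. by rewrite -lecR rmorphD /= -!rnormE ler_normD. Qed.

Lemma ler_rdistD z x y : rnorm (x - y) <= rnorm (x - z) + rnorm (z - y).
Proof. by rewrite (le_trans _ (ler_rnormD _ _))// addrA subrK. Qed.

Lemma rnormZ (a : R[i]) x : rnorm (a *: x) = Normc.normc a * rnorm x.
Proof. by apply: complexI; rewrite rmorphM /= -!rnormE normrZ. Qed.

Lemma cvg_rnormP u (l : V) :
  u @ \oo --> l <-> (fun n => rnorm (l - u n)) @ \oo --> (0 : R).
Proof.
split=> [/cvgrPdist_lt|/cvgr0Pnorm_lt] h.
  apply/cvgr0Pnorm_lt => e e0; have := h e%:C.
  rewrite ltcR => /(_ e0); apply: filterS => n.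
  by rewrite rnormE ltcR ger0_norm// rnorm_ge0.
(* A positive element of [R[i]] has zero imaginary part, so the tolerance is the image of its real
   part. *)
apply/cvgrPdist_lt => e; rewrite ltcE /= => /andP[/eqP ie e0].
have := h _ e0; apply: filterS => n.
by rewrite rnormE ltcE /= ie eqxx ger0_norm// rnorm_ge0.
Qed.

Lemma rnorm_squeeze u (l : V) (v : nat -> R) :
  (forall n, rnorm (l - u n) <= v n) -> v @ \oo --> 0 -> u @ \oo --> l.
Proof.
move=> uv v0; apply/cvg_rnormP; apply: squeeze_cvgr (cvg_cst 0) v0.
by apply: nearW => n; rewrite rnorm_ge0 uv.
Qed.

Lemma cvg_rnorm u (l : V) : u @ \oo --> l -> rnorm (u n) @[n --> \oo] --> rnorm l.
Proof.
move=> /cvg_rnormP h; apply/cvgrPdist_le => e e0.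
have /cvgr0Pnorm_le/(_ e e0) := h; apply: filterS => n.
rewrite ger0_norm ?rnorm_ge0// => hn; rewrite ler_norml; apply/andP; split.
  rewrite lerBrDr addrC lerBlDl; apply: le_trans (lerD hn (lexx (rnorm l))).
  by rewrite rdistC; have := ler_rnormD (u n - l) l; rewrite subrK.
rewrite lerBlDr; apply: le_trans (lerD hn (lexx (rnorm (u n)))).
by have := ler_rnormD (l - u n) (u n); rewrite subrK.
Qed.

(* Only sequences with geometrically decreasing increments are ever needed. *)
Definition geometric_complete := forall (u : nat -> V) (C q : R), 0 <= q < 1 ->
  (forall n, rnorm (u n.+1 - u n) <= C * q ^+ n) ->
  exists l : V, u @ \oo --> l.

Lemma geometric_tail (u : nat -> V) (C q : R) : 0 <= q < 1 ->
  (forall n, rnorm (u n.+1 - u n) <= C * q ^+ n) ->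
  forall m n, rnorm (u (n + m)%N - u n) <= C * q ^+ n / (1 - q).
Proof.
move=> /andP[q0 q1] h m n.
have C0 : 0 <= C by have := h 0%N; rewrite expr0 mulr1; apply/le_trans/rnorm_ge0.
have q1' : 0 < 1 - q by rewrite subr_gt0.
(* The induction carries the exact sum of the geometric series; the stated bound, which forgets [m],
   is not inductive. *)
suff H : rnorm (u (n + m)%N - u n) <= C * q ^+ n * (1 - q ^+ m) / (1 - q).
  rewrite (le_trans H)// ler_pM2r ?invr_gt0// ler_piMr ?mulr_ge0 ?exprn_ge0//.
  by rewrite gerBl exprn_ge0.
elim: m => [|m IH]; first by rewrite addn0 !subrr rnorm0 mulr0 mul0r.
rewrite addnS (le_trans (ler_rdistD (u (n + m)%N) _ _))//.
rewrite (le_trans (lerD (h _) IH))// le_eqVlt; apply/orP; left; apply/eqP.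
rewrite exprD exprS; field; exact: lt0r_neq0.
Qed.

Lemma geometric_limit (u : nat -> V) (l : V) (C q : R) : 0 <= q < 1 ->
  (forall n, rnorm (u n.+1 - u n) <= C * q ^+ n) -> u @ \oo --> l ->
  forall n, rnorm (l - u n) <= C * q ^+ n / (1 - q).
Proof.
move=> q01 h ul n.
have c : rnorm (u (m + n)%N - u n) @[m --> \oo] --> rnorm (l - u n).
  by apply: cvg_rnorm; apply: cvgB; [rewrite (cvg_shiftn n u)|exact: cvg_cst].
rewrite -(cvg_lim _ c)//; apply: limr_le; first by apply/cvg_ex; exists (rnorm (l - u n)).
by apply: nearW => m; rewrite addnC; exact: geometric_tail.
Qed.

End Normed.

Lemma cvg0_geometric (C q : R) : 0 <= q < 1 -> (fun n => C * q ^+ n) @ \oo --> 0.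
Proof.
move=> /andP[q0 q1]; rewrite -[X in _ --> X](mulr0 C).
by apply: cvgMr; apply: cvg_expr; rewrite ger0_norm.
Qed.

Lemma complete_geometric (V : normedModType R[i]) :
  (forall F : set_system V, ProperFilter F -> cauchy F -> cvg F) ->
  geometric_complete V.
Proof.
move=> cV u C q q01 h.
suff cu : cauchy (u @ \oo) by apply/cvg_ex; apply: cV.
apply: cauchy_exP => e; rewrite ltcE /= => /andP[/eqP ie e0].
have : (fun n => C / (1 - q) * q ^+ n) @ \oo --> (0 : R) by exact: cvg0_geometric.
move=> /cvgr0Pnorm_lt/(_ _ e0) [N _ hN].
exists (u N), N => // n /= Nn; rewrite -ball_normE /= rnormE ltcE /= ie eqxx /= rdistC.
have := geometric_tail q01 h (n - N) N; rewrite subnKC// => /le_lt_trans; apply.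
by rewrite mulrAC; apply: le_lt_trans (hN N _) => //=; exact: ler_norm.
Qed.

(** Points picked in members of the filter of diameter below 4^-n have geometric increments, and the
    limit of such a sequence is the limit of the whole filter. *)
Lemma geometric_cauchy_cvg (V : normedModType R[i]) :
  geometric_complete V ->
  forall F : set_system V, ProperFilter F -> cauchy F -> cvg F.
Proof.
move=> gV F PF /cauchy_ballP cF.
pose e n : R := 4^-1 ^+ n.
have e0 n : 0 < (e n)%:C by rewrite ltcR exprn_gt0.
have /choice[A hA] : forall n, exists A : set V, F A /\
    forall x y, A x -> A y -> rnorm (x - y) < e n.
  move=> n; have [/= [A B] [FA FB] AB] := cF _ (e0 n).
  exists (A `&` B); split; first exact: filterI.
  move=> x y [Ax _] [_ By]; have := AB (x, y) (conj Ax By).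
  by rewrite /= -ball_normE /= rnormE ltcR.
(* Choosing [u n] in all of the first sets at once puts every later point in [A m], so that
   consecutive points are close. *)
pose A' n := [set x | forall i, (i <= n)%N -> A i x].
have FA' n : F (A' n).
  elim: n => [|n IH].
    by have [FA _] := hA 0%N; apply: filterS FA => x Ax i; rewrite leqn0 => /eqP ->.
  have [FA _] := hA n.+1; apply: filterS2 IH FA => x An Ax i.
  by rewrite leq_eqVlt => /predU1P[->//|]; exact: An.
have /choice[u hu] : forall n, exists x, A' n x by move=> n; exact: filter_ex (FA' n).
have uA m n : (m <= n)%N -> A m (u n) by move=> mn; apply: hu => /=.
have [|n|l ul] := gV u 1 4^-1.
- by rewrite invr_ge0 ler0n /= invf_lt1// ltr1n.
- by rewrite mul1r ltW//; have [_] := hA n; apply; exact: uA.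
apply/cvg_ex; exists l; apply/cvg_ballP => d; rewrite ltcE /= => /andP[/eqP id d0].
have q01 : 0 <= (4^-1 : R) < 1 by rewrite invr_ge0 ler0n /= invf_lt1// ltr1n.
have d20 : 0 < complex.Re d / 2 by rewrite divr_gt0.
have /cvgr0Pnorm_lt/(_ _ d20)[N1 _ h1] := cvg0_geometric 1 q01.
have /cvg_rnormP/cvgr0Pnorm_lt/(_ _ d20)[N2 _ h2] := ul.
pose N := maxn N1 N2.
have [FN aN] := hA N; apply: filterS FN => x Ax.
rewrite -ball_normE /= rnormE ltcE /= id eqxx /= (le_lt_trans (ler_rdistD (u N) _ _))//.
rewrite [ltRHS]splitr ltrD//.
  by have := h2 N (leq_maxr _ _); rewrite ger0_norm// rnorm_ge0.
have := h1 N (leq_maxl _ _); rewrite /= mul1r; apply: le_lt_trans.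
by rewrite (le_trans _ (ler_norm _))// ltW// aN//; exact: uA.
Qed.

End RealNorm.

(** * Inner products, bounded operators and projections *)

Section InnerProduct.
Context {R : realType} {H : preHilbertType R}.
Implicit Types (x y z : H) (u : nat -> H).

Lemma innerDl x y z : inner (x + y) z = inner x z + inner y z.
Proof. by have := inner_linear 1 x y z; rewrite scale1r mul1r. Qed.

Lemma inner0l z : inner (0 : H) z = 0.
Proof. by apply: (addrI (inner 0 z)); rewrite -innerDl !addr0. Qed.

Lemma innerZl a x z : inner (a *: x) z = a * inner x z.
Proof. by have := inner_linear a x 0 z; rewrite addr0 inner0l addr0. Qed.

Lemma innerNl x z : inner (- x) z = - inner x z.
Proof. by rewrite -scaleN1r innerZl mulN1r. Qed.

Lemma innerBl x y z : inner (x - y) z = inner x z - inner y z.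
Proof. by rewrite innerDl innerNl. Qed.

Lemma innerDr x y z : inner x (y + z) = inner x y + inner x z.
Proof. by rewrite inner_conj innerDl rmorphD /= -!inner_conj. Qed.

Lemma innerZr a x y : inner x (a *: y) = a^* * inner x y.
Proof. by rewrite inner_conj innerZl rmorphM /= -inner_conj. Qed.

Lemma innerNr x z : inner x (- z) = - inner x z.
Proof. by rewrite inner_conj innerNl rmorphN /= -inner_conj. Qed.

Lemma innerBr x y z : inner x (y - z) = inner x y - inner x z.
Proof. by rewrite innerDr innerNr. Qed.

Lemma inner0r z : inner z (0 : H) = 0.
Proof. by rewrite inner_conj inner0l rmorph0. Qed.

Lemma inner_rnorm x : inner x x = (rnorm x ^+ 2)%:C.
Proof. by rewrite inner_norm rnormE rmorphXn. Qed.

Lemma inner_eq0_sym x y : inner x y = 0 -> inner y x = 0.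
Proof. by move=> xy; rewrite inner_conj xy rmorph0. Qed.

Lemma inner_eq0 x : (forall y, inner x y = 0) -> x = 0.
Proof.
move=> /(_ x); rewrite inner_rnorm => /complexI/eqP; rewrite sqrf_eq0 => /eqP.
exact: rnorm0_eq0.
Qed.

Lemma conj_real (a : R) : (a%:C : R[i])^* = a%:C.
Proof. exact: conjc_real. Qed.

Lemma normc_conj (z : R[i]) : Normc.normc z^* = Normc.normc z.
Proof. by case: z => a b /=; rewrite sqrrN. Qed.

Lemma rnormD2 x y : rnorm (x + y) ^+ 2 =
  rnorm x ^+ 2 + 2 * complex.Re (inner x y) + rnorm y ^+ 2.
Proof.
apply: complexI; rewrite -inner_rnorm innerDl !innerDr !inner_rnorm (inner_conj x y).
case: (inner x y) => a b; apply/eqP; rewrite eq_complex /=.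
by apply/andP; split; apply/eqP; ring.
Qed.

Lemma normcX (z : R[i]) n : Normc.normc (z ^+ n) = Normc.normc z ^+ n.
Proof.
by elim: n => [|n IH]; rewrite ?expr0 ?Normc.normc1// !exprS Normc.normcM IH.
Qed.

Lemma parallelogram x y :
  rnorm (x + y) ^+ 2 + rnorm (x - y) ^+ 2 = 2 * rnorm x ^+ 2 + 2 * rnorm y ^+ 2.
Proof. by rewrite !rnormD2 innerNr raddfN rnormN /=; ring. Qed.

Lemma normc_ge0 (z : R[i]) : 0 <= Normc.normc z.
Proof. by case: z => a b; exact: sqrtr_ge0. Qed.

Lemma normc_real (a : R) : Normc.normc a%:C = `|a|.
Proof. by rewrite /= expr0n addr0 sqrtr_sqr. Qed.

Lemma rnorm_gt0 x : x != 0 -> 0 < rnorm x.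
Proof.
by move=> x0; rewrite lt_def rnorm_ge0 andbT; apply: contra_neq x0; exact: rnorm0_eq0.
Qed.

(** Pythagoras for the projection of [x] on the line of [y]. That the right-hand side is nonnegative
    is the Cauchy-Schwarz inequality; if [x] is already the shortest vector of x + C y, the
    subtracted term must vanish. *)
Lemma rnorm_residual x y : y != 0 ->
  rnorm (x - (inner x y / (rnorm y ^+ 2)%:C) *: y) ^+ 2 =
  rnorm x ^+ 2 - Normc.normc (inner x y) ^+ 2 / rnorm y ^+ 2.
Proof.
move=> y0; have Y0 : 0 < rnorm y ^+ 2 by rewrite exprn_gt0// rnorm_gt0.
rewrite rnormD2 rnormN innerNr innerZr rnormZ exprMn.
set a := inner x y; set b := rnorm y ^+ 2.
have -> : a / b%:C = (b^-1)%:C * a by rewrite mulrC fmorphV.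
rewrite Normc.normcM exprMn normc_real normrV ?unitfE ?lt0r_neq0// (gtr0_norm Y0) normc2.
have : b^-1 * b = 1 by rewrite mulVf// lt0r_neq0.
move: (b^-1) => d db.
have -> : d ^+ 2 * (complex.Re a ^+ 2 + complex.Im a ^+ 2) * b =
    (d * b) * d * (complex.Re a ^+ 2 + complex.Im a ^+ 2) by ring.
by rewrite db; case: a => u v /=; ring.
Qed.

Lemma inner_minimal x y :
  (forall c : R[i], rnorm x <= rnorm (x - c *: y)) -> inner x y = 0.
Proof.
move=> min; have [->|y0] := eqVneq y 0; first by rewrite inner0r.
have Y0 : 0 < rnorm y ^+ 2 by rewrite exprn_gt0// rnorm_gt0.
have := min (inner x y / (rnorm y ^+ 2)%:C).
rewrite -(@ler_pXn2r _ 2) ?nnegrE ?rnorm_ge0// rnorm_residual//.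
rewrite lerBrDl gerDr pmulr_lle0 ?invr_gt0// => h.
have /eqP : Normc.normc (inner x y) ^+ 2 = 0 by apply/eqP; rewrite eq_le h sqr_ge0.
by rewrite sqrf_eq0 => /eqP/Normc.eq0_normc.
Qed.

Lemma cauchy_schwarz x y : Normc.normc (inner x y) <= rnorm x * rnorm y.
Proof.
have [->|y0] := eqVneq y 0; first by rewrite inner0r Normc.normc0 rnorm0 mulr0.
have Y0 : 0 < rnorm y ^+ 2 by rewrite exprn_gt0// rnorm_gt0.
rewrite -(@ler_pXn2r _ 2) ?nnegrE ?mulr_ge0 ?rnorm_ge0 ?normc_ge0// exprMn.
by rewrite -ler_pdivrMr// -subr_ge0 -rnorm_residual// sqr_ge0.
Qed.

Lemma le_cvg0 (a : R) (v : nat -> R) :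
  v @ \oo --> 0 -> (forall n, a <= v n) -> a <= 0.
Proof.
move=> v0 av; rewrite -(cvg_lim _ v0)//; apply: limr_ge; first by apply/cvg_ex; exists 0.
exact: nearW.
Qed.

Lemma cvg_inner u (l : H) z c : u @ \oo --> l ->
  (fun n => Normc.normc (inner z (u n) - c)) @ \oo --> (0 : R) -> inner z l = c.
Proof.
move=> /cvg_rnormP ul uz; apply/eqP; rewrite -subr_eq0; apply/eqP/Normc.eq0_normc/eqP.
rewrite eq_le normc_ge0 andbT.
have h : (fun n => rnorm z * rnorm (l - u n) + Normc.normc (inner z (u n) - c)) @ \oo -->
    (0 : R).
  by rewrite -[X in _ --> X]addr0 -{1}(mulr0 (rnorm z)); apply: cvgD => //; exact: cvgMr.
apply: le_cvg0 h _ => n.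
apply: le_trans (lerD (cauchy_schwarz _ _) (lexx _)).
by rewrite innerBr (le_trans _ (le_normcD _ _))// addrA subrK.
Qed.

End InnerProduct.

Section BoundedOperators.
Context {R : realType}.
Implicit Types H K : preHilbertType R.

Lemma bop_rbounded H K (A : 'B(H, K)) :
  exists M : R, 0 < M /\ forall x, rnorm (A x) <= M * rnorm x.
Proof.
have [M hM] := bop_bounded A; exists (`|M| + 1); split.
  by rewrite (@lt_le_trans _ _ 1)// lerDr.
move=> x; apply: (@le_trans _ _ (M * rnorm x)).
  by rewrite -lecR rmorphM /= -!rnormE.
by rewrite ler_wpM2r ?rnorm_ge0// (le_trans (ler_norm _))// lerDl.
Qed.

Lemma bop_cvg H K (A : 'B(H, K)) (u : nat -> H) l :
  u @ \oo --> l -> (fun n => A (u n)) @ \oo --> A l.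
Proof.
have [M [M0 hM]] := bop_rbounded A => /cvg_rnormP ul.
apply: (@rnorm_squeeze _ _ _ _ (fun n => M * rnorm (l - u n))) => [n|].
  by rewrite -linearB.
by rewrite -[X in _ --> X](mulr0 M); exact: cvgMr.
Qed.

Lemma bop_of_fun H K (f : H -> K) (M : R) :
  (forall a x y, f (a *: x + y) = a *: f x + f y) ->
  (forall x, rnorm (f x) <= M * rnorm x) ->
  exists A : 'B(H, K), forall x, A x = f x.
Proof.
move=> flin fM.
pose m := GRing.isLinear.Build R[i] H K _ f flin.
pose F : {linear H -> K} := HB.pack f m.
have FM : exists M : R, forall x, `|F x| <= M%:C * `|x|.
  by exists M => x; rewrite !rnormE -rmorphM lecR /=; exact: fM.
by exists (BoundedOp FM).
Qed.

(** The lower bound gives injectivity, and read backwards it bounds the inverse by 1/c. *)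
Lemma bop_inverse H (A : 'B(H)) (c : R) : 0 < c ->
  (forall x, c * rnorm x <= rnorm (A x)) -> (forall y, exists x, A x = y) ->
  exists B : 'B(H), cancel A B /\ cancel B A.
Proof.
move=> c0 Ac /choice[f fA].
have inj x y : A x = A y -> x = y.
  move=> xy; apply/eqP; rewrite -subr_eq0; apply/eqP/rnorm0_eq0.
  have := Ac (x - y); rewrite linearB xy subrr rnorm0 pmulr_rle0// => h.
  by apply/eqP; rewrite eq_le h rnorm_ge0.
have [a x y|x|B hB] := @bop_of_fun H H f c^-1.
- by apply: inj; rewrite linearP !fA.
- by rewrite mulrC ler_pdivlMr// mulrC; have := Ac (f x); rewrite fA.
by exists B; split=> x; rewrite hB ?fA//; apply: inj; rewrite fA.
Qed.

Lemma neumann (H : hilbertType R) (A : 'B(H)) (q : R) : 0 <= q < 1 ->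
  (forall x, rnorm (A x) <= q * rnorm x) -> forall y, exists x, x - A x = y.
Proof.
move=> /andP[q0 q1] Aq y; pose u n := \sum_(k < n) iter k A y.
have itA n : rnorm (iter n A y) <= rnorm y * q ^+ n.
  elim: n => [|n IH]; first by rewrite expr0 mulr1.
  by rewrite iterS (le_trans (Aq _))// exprS mulrCA ler_wpM2l.
(* Passing to the limit on both sides of this recursion gives x = y + A x. *)
have uS n : u n.+1 = y + A (u n).
  rewrite /u big_ord_recl /= linear_sum; congr (_ + _).
have [||x ux] := @complete_geometric _ H (@cauchy_cvg H) u (rnorm y) q.
- by rewrite q0 q1.
- by move=> n; rewrite /u big_ord_recr /= addrAC subrr add0r itA.
exists x; apply/eqP; rewrite subr_eq; apply/eqP.
have u1 : (fun n => y + A (u n)) @ \oo --> x.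
  have -> : (fun n => y + A (u n)) = [sequence u n.+1]_n by apply/funext => n /=.
  by rewrite (cvg_shiftS u).
have u2 : (fun n => y + A (u n)) @ \oo --> y + A x.
  by apply: cvgD; [exact: cvg_cst|exact: bop_cvg].
have := cvg_unique (@norm_hausdorff _ _) u1 u2. by move=> <-.
Qed.

End BoundedOperators.

Section Projection.
Context {R : realType} {H : hilbertType R}.

(** If [M] were not dense, some [f] would be at distance d > 0 from it. A minimizing sequence in [M]
    converges to a point x of its closure, and f - x is orthogonal to [M], hence zero, against d >
    0. *)
Lemma dense_orthogonal (M : set H) : M 0 ->
  (forall (a : R[i]) x y, M x -> M y -> M (a *: x + y)) ->
  (forall g, (forall m, M m -> inner g m = 0) -> g = 0) -> dense M.
Proof.
move=> M0 Mlin Mperp.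
have M2 x y : M x -> M y -> M (2^-1 *: (x + y)).
  move=> Mx My; rewrite -[_ *: _]addr0; refine (Mlin _ _ _ _ M0).
  by rewrite -[x]scale1r; exact: Mlin.
apply: contrapT => nd.
have [Q /not_implyP[[f Qf] /not_implyP[oQ QM]]] := (existsNP _).2 nd.
have [e0 e0_gt0 hf] : exists2 e : R, 0 < e & forall m, M m -> e <= rnorm (f - m).
  have /nbhs_ballP[e] := open_nbhs_nbhs (conj oQ Qf).
  rewrite /= ltcE /= => /andP[/eqP ie e_gt0] ball_Q.
  exists (complex.Re e) => // m Mm; rewrite leNgt; apply/negP => fm.
  apply: QM; exists m; split=> //; apply: ball_Q.
  by rewrite -ball_normE /= rnormE ltcE /= ie eqxx.
pose D := [set rnorm (f - m) | m in M].
have Dlb : lbound D 0 by move=> _ [m _ <-]; exact: rnorm_ge0.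
have Dne : D !=set0 by exists (rnorm (f - 0)); exists 0.
have hD : has_inf D by split=> //; exists 0.
pose d := inf D.
have dM m : M m -> d <= rnorm (f - m).
  by move=> Mm; apply: ge_inf; [exists 0|exists m].
have d0 : 0 < d.
  by apply: lt_le_trans e0_gt0 _; apply: lb_le_inf => // _ [m Mm <-]; exact: hf.
(* The tolerance applies to squared distances; its square root 2^-n will be the ratio of the
   increments. *)
pose eps n : R := 4^-1 ^+ n.
have eps0 n : 0 < eps n by rewrite exprn_gt0.
have /choice[m hm] : forall n, exists m, M m /\ rnorm (f - m) ^+ 2 < d ^+ 2 + eps n.
  move=> n; have s0 : 0 < d ^+ 2 + eps n by rewrite addr_gt0// exprn_gt0.
  have : d < Num.sqrt (d ^+ 2 + eps n).
    rewrite -[ltLHS](gtr0_norm d0) -sqrtr_sqr ltr_sqrt//.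
    by rewrite ltrDl.
  move=> /(inf_lt Dne)[_ [m Mm <-]] hm; exists m; split=> //.
  rewrite -[ltRHS]sqr_sqrtr ?ltW//.
  by rewrite ltr_pXn2r ?nnegrE ?sqrtr_ge0 ?rnorm_ge0.
have mM n : M (m n) by case: (hm n).
have mdist n : rnorm (m n.+1 - m n) <= 2 * 2^-1 ^+ n.
  rewrite -(@ler_pXn2r _ 2) ?nnegrE ?mulr_ge0 ?exprn_ge0 ?invr_ge0 ?rnorm_ge0//.
  have := parallelogram (f - m n) (f - m n.+1).
  have -> : f - m n - (f - m n.+1) = m n.+1 - m n.
    by rewrite opprB addrC addrA subrK.
  (* The midpoint lies in [M], so its distance to [f] is at least [d]; the parallelogram law then
     leaves at most 2 eps_n + 2 eps_(n+1) <= 4 eps_n for the squared increment. *)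
  have -> : f - m n + (f - m n.+1) = 2 *: (f - 2^-1 *: (m n + m n.+1)).
    rewrite scalerBr scalerA mulfV ?pnatr_eq0// scale1r opprD addrACA -mulr2n.
    by rewrite scaler_nat.
  rewrite rnormZ exprMn.
  have -> : Normc.normc (2 : R[i]) ^+ 2 = 4.
    by rewrite normc2 -(rmorph_nat (real_complex R)) /= expr0n addr0 -natrX.
  have [_ h1] := hm n; have [_ h2] := hm n.+1.
  have h3 : d ^+ 2 <= rnorm (f - 2^-1 *: (m n + m n.+1)) ^+ 2.
    by rewrite ler_pXn2r ?nnegrE ?rnorm_ge0 ?(ltW d0)//; apply: dM; exact: M2.
  have h4 : eps n.+1 <= eps n.
    by rewrite /eps exprS ler_piMl ?exprn_ge0 ?invr_ge0// invf_le1// ler1n.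
  have -> : (2 * 2^-1 ^+ n) ^+ 2 = 4 * eps n.
    by rewrite exprMn -exprM mulnC exprM /eps; congr (_ * _ ^+ _); field.
  by move: h1 h2 h3 h4; nra.
have [||x mx] := @complete_geometric _ H (@cauchy_cvg H) m 2 2^-1.
- by rewrite invr_ge0 ler0n /= invf_lt1// ltr1n.
- exact: mdist.
have fx : rnorm (f - m n) @[n --> \oo] --> rnorm (f - x).
  by apply: cvg_rnorm; apply: cvgB => //; exact: cvg_cst.
have xd : rnorm (f - x) ^+ 2 <= d ^+ 2.
  rewrite -subr_le0.
  have q1 : 0 <= (4^-1 : R) < 1 by rewrite invr_ge0 ler0n /= invf_lt1// ltr1n.
  have h : (fun n => (rnorm (f - x) ^+ 2 - rnorm (f - m n) ^+ 2) + eps n) @ \oo --> (0 : R).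
    rewrite -[X in _ --> X]addr0 -{1}(subrr (rnorm (f - x) ^+ 2)); apply: cvgD.
      by apply: cvgB; [exact: cvg_cst|exact: (cvgM fx fx)].
    by have := @cvg0_geometric _ 1 _ q1; under eq_fun do rewrite mul1r.
  apply: (le_cvg0 h) => n.
  have [_ ] := hm n; lra.
have perp : forall y, M y -> inner (f - x) y = 0.
  move=> y My; apply: inner_minimal => c.
  have {}xd : rnorm (f - x) <= d.
    by move: xd; rewrite ler_pXn2r ?nnegrE ?rnorm_ge0 ?(ltW d0).
  apply: le_trans xd _.
  (* The point [x] is only in the closure of [M], so minimality is tested on [c *: y + m n], which
     is in [M], before passing to the limit. *)
  have h : rnorm (f - (c *: y + m n)) @[n --> \oo] --> rnorm (f - x - c *: y).
    have -> : f - x - c *: y = f - (c *: y + x) by rewrite opprD addrA addrAC.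
    by apply: cvg_rnorm; apply: cvgB; [|apply: cvgD => //]; exact: cvg_cst.
  rewrite -(cvg_lim _ h)//; apply: limr_ge; first by apply/cvg_ex; exists (rnorm (f - x - c *: y)).
  by apply: nearW => n; apply: dM; exact: Mlin.
have := Mperp _ perp => fx0.
have : d <= rnorm (f - x).
  rewrite -(cvg_lim _ fx)//; apply: limr_ge; first by apply/cvg_ex; exists (rnorm (f - x)).
  by apply: nearW => n; exact: dM.
by rewrite fx0 rnorm0 leNgt d0.
Qed.

End Projection.

(** * Translation invariance *)

Section Translation.
Context {R : realType}.
Local Notation mu := (@lebesgue_measure R).

Lemma measurable_shift (s : R) :
  measurable_fun [set: R] ((fun x => x + s) : measurableTypeR R -> measurableTypeR R).
Proof. exact: measurable_funD. Qed.

(** The image measure agrees with Lebesgue measure on half-open intervals, and these determine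
    it. *)
Lemma lebesgue_measure_shift (s : R) (A : set (measurableTypeR R)) :
  measurable A ->
  pushforward mu ((fun x => x + s) : measurableTypeR R -> measurableTypeR R) A = mu A.
Proof.
move=> mA; pose sh : measurableTypeR R -> measurableTypeR R := fun x => x + s.
have msh : measurable_fun setT sh := measurable_shift s.
pose msh_mixin := isMeasurableFun.Build _ _ _ _ _ msh.
pose F : {mfun _ >-> _} := HB.pack sh msh_mixin.
apply/esym.
apply: (@lebesgue_measure_unique R (pushforward mu F)) => //= _ [[a b]] _ <-.
rewrite /pushforward.
have -> : F @^-1` [set` `]a, b]] = [set` `]a - s, b - s]].
  by apply/seteqP; split=> x /=; rewrite !in_itv /= /sh ltrBlDr lerBrDr.
by rewrite !lebesgue_measure_itv/= !lte_fin ltrD2r -!EFinB opprB addrA subrK.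
Qed.

(** This is what allows formulas known almost everywhere to be composed with translations; it is
    applied with [s] of both signs. *)
Lemma ae_shift (s : R) (P : R -> Prop) :
  {ae mu, forall x, P x} -> {ae mu, forall x, P (x + s)}.
Proof.
move=> [N [mN N0 PN]]; exists ((fun x => x + s) @^-1` N); split.
- rewrite -[X in measurable X]setTI.
  exact: (measurable_shift s).
- by have := lebesgue_measure_shift s mN; rewrite /pushforward N0.
- by move=> x /= nP; apply: PN.
Qed.

Lemma ge0_integral_shift (s : R) (f : R -> \bar R) :
  measurable_fun [set` `[s, +oo[] f -> (forall x, s <= x -> (0 <= f x)%E) ->
  (\int[mu]_(x in [set` `[s, +oo[]) f x =
   \int[mu]_(x in [set` `[0%R, +oo[%R]) f (x + s)%R)%E.
Proof.
move=> mf f0; pose sh : measurableTypeR R -> measurableTypeR R := fun x => x + s.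
have msh : measurable_fun setT sh := measurable_shift s.
pose msh_mixin := isMeasurableFun.Build _ _ _ _ _ msh.
pose F : {mfun _ >-> _} := HB.pack sh msh_mixin.
transitivity (\int[pushforward mu F]_(x in [set` `[s, +oo[]) f x)%E.
  by apply: eq_measure_integral => A mA _; apply/esym; exact: lebesgue_measure_shift.
rewrite ge0_integral_pushforward//=; last first.
  by move=> y; rewrite inE /= in_itv /= andbT; exact: f0.
congr (integral _ _ _); apply/seteqP; split=> x /=;
  by rewrite !in_itv /= !andbT /sh lerDr.
Qed.

Lemma integral_shift (s : R) (f : R -> \bar R) :
  measurable_fun [set` `[s, +oo[] f ->
  (\int[mu]_(x in [set` `[s, +oo[]) f x =
   \int[mu]_(x in [set` `[0%R, +oo[%R]) f (x + s)%R)%E.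
Proof.
move=> mf; rewrite integralE [RHS]integralE; congr (_ - _)%E.
  by rewrite (@ge0_integral_shift s (f^\+)%E)//; [by rewrite unlock|exact: measurable_funepos].
by rewrite (@ge0_integral_shift s (f^\-)%E)//; [by rewrite unlock|exact: measurable_funeneg].
Qed.

End Translation.

(** * Functions and operators on the half line *)

Section L2Functions.
Context {R : realType}.
Local Notation mu := (@lebesgue_measure R).
Local Notation halfline := ([set` `[0%R, +oo[%R] : set R).
Implicit Types (f g : R -> R[i]) (u v : L2 R).
Local Open Scope quotient_scope.

Definition cmeasurable (D : set (measurableTypeR R)) f :=
  measurable_fun D (fun x => complex.Re (f x)) /\
  measurable_fun D (fun x => complex.Im (f x)).

Definition hl_eq f g := {ae mu, forall x, 0 <= x -> f x = g x}.

Lemma hl_eq_sym f g : hl_eq f g -> hl_eq g f.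
Proof.
have F := ae_filter_ringOfSetsType mu.
by apply: filterS => x fg x0; rewrite fg.
Qed.

Lemma hl_eq_trans f g h : hl_eq f g -> hl_eq g h -> hl_eq f h.
Proof.
have F := ae_filter_ringOfSetsType mu.
by apply: filterS2 => x fg gh x0; rewrite fg// gh.
Qed.

Lemma cmeasurable_normc2 D f : cmeasurable D f ->
  measurable_fun D (fun x => (Normc.normc (f x) ^+ 2)%:E).
Proof.
move=> [mr mi].
rewrite (_ : (fun x => _) =
  EFin \o (fun x => complex.Re (f x) ^+ 2 + complex.Im (f x) ^+ 2)); last first.
  by apply/funext => x; rewrite /= normc2.
by apply/measurable_EFinP; apply: measurable_funD; exact: measurable_funX.
Qed.

Lemma cmeasurableM D f g : cmeasurable D f -> cmeasurable D g ->
  cmeasurable D (fun x => f x * g x).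
Proof.
move=> [fr fi] [gr gi]; split.
  rewrite (_ : (fun x => _) = (fun x => complex.Re (f x) * complex.Re (g x) -
    complex.Im (f x) * complex.Im (g x))); last first.
    by apply/funext => x; case: (f x) (g x) => [? ?] [? ?].
  by apply: measurable_funB; exact: measurable_funM.
rewrite (_ : (fun x => _) = (fun x => complex.Re (f x) * complex.Im (g x) +
  complex.Im (f x) * complex.Re (g x))); last first.
  by apply/funext => x; case: (f x) (g x) => [? ?] [? ?].
by apply: measurable_funD; exact: measurable_funM.
Qed.

Lemma cmeasurableD D f g : cmeasurable D f -> cmeasurable D g ->
  cmeasurable D (fun x => f x + g x).
Proof.
move=> [fr fi] [gr gi]; split.
  rewrite (_ : (fun x => _) = (fun x => complex.Re (f x) + complex.Re (g x))).
    exact: measurable_funD.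
  by apply/funext => x; case: (f x) (g x) => [? ?] [? ?].
rewrite (_ : (fun x => _) = (fun x => complex.Im (f x) + complex.Im (g x))).
  exact: measurable_funD.
by apply/funext => x; case: (f x) (g x) => [? ?] [? ?].
Qed.

Lemma cmeasurable_conj D f : cmeasurable D f -> cmeasurable D (fun x => (f x)^*).
Proof.
move=> [fr fi]; split.
  by rewrite (_ : (fun x => _) = (fun x => complex.Re (f x)))//;
    apply/funext => x; case: (f x).
rewrite (_ : (fun x => _) = (fun x => - complex.Im (f x))).
  exact: measurableT_comp.
by apply/funext => x; case: (f x).
Qed.

Lemma cmeasurable_real D (w : R -> R) : measurable_fun D w ->
  cmeasurable D (fun x => (w x)%:C).
Proof. by move=> mw; split=> //; exact: measurable_cst. Qed.

Lemma cmeasurable_cst D (c : R[i]) : cmeasurable D (fun=> c).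
Proof. by split; exact: measurable_cst. Qed.

Lemma cmeasurable_if D f g (b : R -> bool) : measurable D ->
  measurable_fun D (b : measurableTypeR R -> bool) ->
  cmeasurable (D `&` [set x | b x]) f -> cmeasurable (D `&` [set x | ~~ b x]) g ->
  cmeasurable D (fun x => if b x then f x else g x).
Proof.
move=> mD mb [fr fi] [gr gi].
have E1 : D `&` b @^-1` [set true] = D `&` [set x | b x] by [].
have E2 : D `&` b @^-1` [set false] = D `&` [set x | ~~ b x].
  by apply/seteqP; split=> x [Dx] /=; [move=> -> //|case: (b x)].
split.
  rewrite (_ : (fun x => _) =
      (fun x => if b x then complex.Re (f x) else complex.Re (g x))).
    by apply: measurable_fun_if; rewrite ?E1 ?E2.
  by apply/funext => x; case: (b x).
rewrite (_ : (fun x => _) =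
    (fun x => if b x then complex.Im (f x) else complex.Im (g x))).
  by apply: measurable_fun_if; rewrite ?E1 ?E2.
by apply/funext => x; case: (b x).
Qed.

Lemma cmeasurableS (D D' : set (measurableTypeR R)) f : measurable D -> D' `<=` D ->
  cmeasurable D f -> cmeasurable D' f.
Proof. by move=> mD sD [fr fi]; split; apply: measurable_funS mD sD _. Qed.

(** Taken in the extended reals so that it makes sense before square integrability is
    established. *)
Definition sqnorm f : \bar R := (\int[mu]_(x in halfline) (Normc.normc (f x) ^+ 2)%:E)%E.

Lemma sqnorm_ge0 f : (0 <= sqnorm f)%E.
Proof. by apply: integral_ge0 => x _; rewrite lee_fin sqr_ge0. Qed.

Lemma L2_fun_cmeasurable (f : L2_fun R) : cmeasurable halfline f.
Proof. by case: f => f fP; have := fP; rewrite unfold_in /= inE => -[]. Qed.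

Lemma L2_cmeasurable u : cmeasurable halfline u.
Proof. exact: L2_fun_cmeasurable. Qed.

Lemma L2_sqnorm_fin u : (sqnorm u < +oo)%E.
Proof.
by rewrite /L2_to_fun; case: (repr u) => f fP; have := fP; rewrite unfold_in /= inE => -[].
Qed.

Lemma sqnorm_ae_le f g (c : R) : 0 <= c ->
  cmeasurable halfline f -> cmeasurable halfline g ->
  {ae mu, forall x, 0 <= x -> Normc.normc (f x) <= c * Normc.normc (g x)} ->
  (sqnorm f <= (c ^+ 2)%:E * sqnorm g)%E.
Proof.
move=> c0 mf mg fg; have F := ae_filter_ringOfSetsType mu.
have mcg : measurable_fun halfline (fun x => (Normc.normc (g x) ^+ 2)%:E) :=
  cmeasurable_normc2 mg.
rewrite /sqnorm -ge0_integralZl//; last 2 first.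
- by move=> x _; rewrite lee_fin sqr_ge0.
- by rewrite lee_fin sqr_ge0.
apply: ae_ge0_le_integral => //.
- by move=> x _; rewrite lee_fin sqr_ge0.
- exact: cmeasurable_normc2.
- by move=> x _; rewrite -EFinM lee_fin mulr_ge0 ?sqr_ge0.
- exact: measurable_funeM.
apply: filterS fg => x fg; rewrite /= in_itv /= andbT => x0.
by rewrite -EFinM lee_fin -exprMn ler_pXn2r ?nnegrE ?mulr_ge0 ?normc_ge0 ?fg.
Qed.

Lemma sqnorm_ae_eq f g : cmeasurable halfline f -> cmeasurable halfline g ->
  hl_eq f g -> sqnorm f = sqnorm g.
Proof.
have F := ae_filter_ringOfSetsType mu.
move=> mf mg fg; apply/eqP; rewrite eq_le; apply/andP; split.
  have := @sqnorm_ae_le f g 1 ler01 mf mg; rewrite expr1n mul1e; apply.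
  by apply: filterS fg => x fg x0; rewrite mul1r fg.
have := @sqnorm_ae_le g f 1 ler01 mg mf; rewrite expr1n mul1e; apply.
by apply: filterS fg => x fg x0; rewrite mul1r fg.
Qed.

Lemma L2_sqnorm u : (rnorm u ^+ 2)%:E = sqnorm u.
Proof.
have := @inner_rnorm _ _ u; rewrite /inner /=.
rewrite -[u in L2_inner u _]reprK -[u in L2_inner _ u]reprK L2_inner_diag.
move=> /complexI <-; rewrite /Rintegral fineK// ge0_fin_numE ?L2_sqnorm_fin//.
exact: sqnorm_ge0.
Qed.

Lemma L2_ext u v : hl_eq u v -> u = v.
Proof. by move=> uv; rewrite -[u]reprK -[v]reprK; apply/L2_eqP. Qed.

Lemma L2_of_fun f : cmeasurable halfline f -> (sqnorm f < +oo)%E ->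
  exists u, hl_eq u f.
Proof.
move=> [fr fi] fin.
have fP : f \in @square_integrable R by rewrite unfold_in /= inE; split.
exists (\pi_(L2 R) (L2Fun fP)); exact: (L2_reprP (L2Fun fP)).
Qed.

Lemma L2_lin (a : R[i]) u v : hl_eq (a *: u + v : L2 R) (fun x => a * u x + v x).
Proof.
rewrite -{1}[u]reprK -{1}[v]reprK.
have -> : a *: \pi_(L2 R) (repr u) = \pi_(L2 R) (a *: repr u) by exact: L2_scaleE.
by rewrite L2_addE; exact: L2_reprP.
Qed.

Lemma L2_add u v : hl_eq (u + v : L2 R) (fun x => u x + v x).
Proof.
by have := L2_lin 1 u v; rewrite scale1r; under eq_fun do rewrite mul1r.
Qed.

Lemma L2_zero : hl_eq (0 : L2 R) (fun=> 0).
Proof.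
have -> : (0 : L2 R) = \pi_(L2 R) 0.
  by apply: (addrI (\pi_(L2 R) 0)); rewrite L2_addE !addr0.
exact: L2_reprP.
Qed.

Lemma L2_scl (a : R[i]) u : hl_eq (a *: u : L2 R) (fun x => a * u x).
Proof.
have F := ae_filter_ringOfSetsType mu.
have := L2_lin a u 0; rewrite addr0 => h.
by apply: filterS2 h L2_zero => x h1 h2 x0; rewrite h1// h2// addr0.
Qed.

Lemma L2_sub u v : hl_eq (u - v : L2 R) (fun x => u x - v x).
Proof.
have F := ae_filter_ringOfSetsType mu.
have := L2_lin (-1) v u; rewrite scaleN1r addrC.
by apply: filterS => x h x0; rewrite h// mulN1r addrC.
Qed.

Lemma L2_sum n (u : 'I_n -> L2 R) :
  hl_eq (\sum_i u i : L2 R) (fun x => \sum_i u i x).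
Proof.
have F := ae_filter_ringOfSetsType mu.
elim: n u => [|n IH] u.
  rewrite big_ord0; under [X in hl_eq _ X]eq_fun do rewrite big_ord0; exact: L2_zero.
rewrite big_ord_recr /=.
apply: filterS2 (L2_add (\sum_(i < n) u (widen_ord (leqnSn n) i)) (u ord_max))
  (IH (fun i => u (widen_ord (leqnSn n) i))) => x h1 h2 x0.
by rewrite big_ord_recr /= h1// h2.
Qed.

Lemma L2_rnorm_le u (f : R -> R[i]) v (c : R) : 0 <= c -> hl_eq u f ->
  {ae mu, forall x, 0 <= x -> Normc.normc (f x) <= c * Normc.normc (v x)} ->
  rnorm u <= c * rnorm v.
Proof.
have F := ae_filter_ringOfSetsType mu.
move=> c0 uf fv.
rewrite -(@ler_pXn2r _ 2) ?nnegrE ?mulr_ge0 ?rnorm_ge0// exprMn -lee_fin (EFinM (c ^+ 2)) !L2_sqnorm.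
apply: sqnorm_ae_le => //; [exact: L2_cmeasurable..|].
by apply: filterS2 uf fv => x e1 e2 x0; rewrite e1// e2.
Qed.

End L2Functions.

Section L2Operators.
Context {R : realType}.
Local Notation mu := (@lebesgue_measure R).
Local Notation halfline := ([set` `[0%R, +oo[%R] : set R).

(** Operators are described on genuine functions, where shifts and products are pointwise.
    Compatibility with almost everywhere equality brings [F] down to classes, and the bound on
    [sqnorm] keeps the image in [L2]. *)
Lemma L2_operator (F : (R -> R[i]) -> R -> R[i]) (M : R) :
  (forall a f g x, F (fun y => a * f y + g y) x = a * F f x + F g x) ->
  (forall f g, hl_eq f g -> hl_eq (F f) (F g)) ->
  (forall f, cmeasurable halfline f -> cmeasurable halfline (F f)) ->
  0 <= M ->
  (forall f, cmeasurable halfline f -> (sqnorm (F f) <= (M ^+ 2)%:E * sqnorm f)%E) ->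
  exists A : 'B(L2 R), forall f : L2 R, hl_eq (A f : L2 R) (F f).
Proof.
move=> Flin Fae Fm M0 FM.
have Ffin (f : L2 R) : (sqnorm (F f) < +oo)%E.
  rewrite (le_lt_trans (FM _ (L2_cmeasurable f)))// lte_mul_pinfty ?lee_fin ?sqr_ge0//.
  exact: L2_sqnorm_fin.
have /choice[A hA] : forall f : L2 R, exists u : L2 R, hl_eq u (F f).
  by move=> f; apply: L2_of_fun => //; apply: Fm; exact: L2_cmeasurable.
have [a f g|f|B hB] := @bop_of_fun _ _ _ A M.
- apply: L2_ext; apply: hl_eq_trans (hA _) _.
  apply: hl_eq_trans (Fae _ _ (L2_lin a f g)) _.
  rewrite (_ : F _ = fun x => a * F (f : L2 R) x + F (g : L2 R) x); last exact/funext.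
  have FF := ae_filter_ringOfSetsType mu.
  apply: filterS3 (L2_lin a (A f) (A g)) (hA f) (hA g) => x h1 h2 h3 x0.
  by rewrite h1// h2// h3.
- rewrite -(@ler_pXn2r _ 2) ?nnegrE ?mulr_ge0 ?rnorm_ge0// exprMn -lee_fin (EFinM (M ^+ 2)) !L2_sqnorm.
  rewrite (sqnorm_ae_eq _ _ (hA f)); [|exact: L2_cmeasurable|].
    by apply: FM; exact: L2_cmeasurable.
  by apply: Fm; exact: L2_cmeasurable.
by exists B => f; rewrite hB.
Qed.

Lemma multiplication_operator (w : R -> R[i]) (M : R) :
  cmeasurable halfline w -> 0 <= M ->
  {ae mu, forall x, 0 <= x -> Normc.normc (w x) <= M} ->
  exists A : 'B(L2 R), forall f : L2 R, hl_eq (A f : L2 R) (fun x => w x * f x).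
Proof.
move=> mw M0 wM; have FF := ae_filter_ringOfSetsType mu.
apply: (@L2_operator (fun f x => w x * f x) M) => //.
- by move=> a f g x; ring.
- by move=> f g; apply: filterS => x fg x0; rewrite fg.
- by move=> f mf; exact: cmeasurableM.
move=> f mf; apply: sqnorm_ae_le => //; first exact: cmeasurableM.
apply: filterS wM => x wM x0; rewrite Normc.normcM ler_wpM2r ?normc_ge0//.
exact: wM.
Qed.

Lemma cmeasurable_shift (s : R) f : 0 <= s ->
  cmeasurable [set` `[s, +oo[] f -> cmeasurable halfline (fun x => f (x + s)).
Proof.
move=> s0 [fr fi].
have sub : [set x + s | x in halfline] `<=` [set` `[s, +oo[].
  by move=> _ [x /= + <-]; rewrite !in_itv /= !andbT lerDr.
have ms : measurable_fun halfline ((fun x => x + s) : measurableTypeR R -> measurableTypeR R).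
  exact: (measurable_funS _ (@subsetT _ _) (measurable_shift s)).
split.
  exact: (measurable_comp (measurable_itv _) sub fr ms).
exact: (measurable_comp (measurable_itv _) sub fi ms).
Qed.

Lemma cmeasurable_unshift (s : R) f :
  cmeasurable halfline f -> cmeasurable [set` `[s, +oo[] (fun x => f (x - s)).
Proof.
move=> [fr fi].
have sub : [set x - s | x in [set` `[s, +oo[]] `<=` halfline.
  by move=> _ [x /= + <-]; rewrite !in_itv /= !andbT subr_ge0.
have ms : measurable_fun [set` `[s, +oo[] ((fun x => x - s) : measurableTypeR R -> measurableTypeR R).
  exact: (measurable_funS _ (@subsetT _ _) (measurable_shift (- s))).
split.
  exact: (measurable_comp (measurable_itv _) sub fr ms).
exact: (measurable_comp (measurable_itv _) sub fi ms).
Qed.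

Lemma halflineS (s : R) : 0 <= s -> [set` `[s, +oo[] `<=` halfline.
Proof. by move=> s0 x /=; rewrite !in_itv /= !andbT; exact: le_trans. Qed.

Lemma backward_shift (s : R) : 0 <= s ->
  exists A : 'B(L2 R), forall f : L2 R, hl_eq (A f : L2 R) (fun x => f (x + s)).
Proof.
move=> s0; have FF := ae_filter_ringOfSetsType mu.
have sm f : cmeasurable halfline f -> cmeasurable [set` `[s, +oo[] f.
  by apply: cmeasurableS; [exact: measurable_itv|exact: halflineS].
apply: (@L2_operator (fun f x => f (x + s)) 1) => //.
- move=> f g /(ae_shift s); apply: filterS => x fg x0; apply: fg.
  exact: addr_ge0.
- by move=> f mf; apply: cmeasurable_shift => //; exact: sm.
move=> f mf; rewrite expr1n mul1e /sqnorm.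
rewrite -(@ge0_integral_shift _ s (fun x => (Normc.normc (f x) ^+ 2)%:E)).
- apply: ge0_subset_integral.
  + exact: measurable_itv.
  + exact: measurable_itv.
  + exact: cmeasurable_normc2.
  + by move=> x _; rewrite lee_fin sqr_ge0.
  + exact: halflineS.
- by apply: cmeasurable_normc2; exact: sm.
- by move=> x _; rewrite lee_fin sqr_ge0.
Qed.

End L2Operators.

(** * Completeness of [L2] *)

Section Completeness.
Context {R : realType}.
Local Notation mu := (@lebesgue_measure R).
Local Notation halfline := ([set` `[0%R, +oo[%R] : set R).

Lemma rnorm_normc (z : R[i]) : rnorm z = Normc.normc z.
Proof. by []. Qed.

Lemma ler_Re_normc (z : R[i]) : `|complex.Re z| <= Normc.normc z.
Proof. by rewrite -lecR; exact: normc_ge_Re. Qed.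

Lemma ler_Im_normc (z : R[i]) : `|complex.Im z| <= Normc.normc z.
Proof.
have := ler_Re_normc (z * 'i); rewrite ReiNIm normrN Normc.normcM.
by rewrite /= expr0n /= add0r expr1n sqrtr1 mulr1.
Qed.

Lemma ler_normc_ReIm (z : R[i]) :
  Normc.normc z <= `|complex.Re z| + `|complex.Im z|.
Proof.
rewrite -(@ler_pXn2r _ 2) ?nnegrE ?addr_ge0 ?normc_ge0// normc2 sqrrD.
by rewrite !real_normK ?num_real// addrAC lerDl mulrn_wge0 ?mulr_ge0.
Qed.

Lemma cvg_complex (u : nat -> R[i]) (l : R[i]) :
  (fun n => complex.Re (u n)) @ \oo --> complex.Re l ->
  (fun n => complex.Im (u n)) @ \oo --> complex.Im l -> u @ \oo --> l.
Proof.
move=> ua ub; apply: (@rnorm_squeeze _ _ _ _ (fun n =>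
    `|complex.Re l - complex.Re (u n)| + `|complex.Im l - complex.Im (u n)|)) => [n|].
  by rewrite rnorm_normc (le_trans (ler_normc_ReIm _))// !raddfB.
rewrite -[X in _ --> X]addr0; apply: cvgD.
  rewrite -[X in _ --> X](@normr0 _ R); apply: cvg_norm.
  by rewrite -(subrr (complex.Re l)); apply: cvgB => //; exact: cvg_cst.
rewrite -[X in _ --> X](@normr0 _ R); apply: cvg_norm.
by rewrite -(subrr (complex.Im l)); apply: cvgB => //; exact: cvg_cst.
Qed.

Lemma cvg_Re (u : nat -> R[i]) (l : R[i]) :
  u @ \oo --> l -> (fun n => complex.Re (u n)) @ \oo --> complex.Re l.
Proof.
move=> /cvg_rnormP/cvgr0Pnorm_le ul; apply/cvgrPdist_le => e e0.
apply: filterS (ul e e0) => n; rewrite ger0_norm ?rnorm_ge0//; apply: le_trans.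
by have := ler_Re_normc (l - u n); rewrite raddfB.
Qed.

Lemma cvg_Im (u : nat -> R[i]) (l : R[i]) :
  u @ \oo --> l -> (fun n => complex.Im (u n)) @ \oo --> complex.Im l.
Proof.
move=> /cvg_rnormP/cvgr0Pnorm_le ul; apply/cvgrPdist_le => e e0.
apply: filterS (ul e e0) => n; rewrite ger0_norm ?rnorm_ge0//; apply: le_trans.
by have := ler_Im_normc (l - u n); rewrite raddfB.
Qed.

Lemma complex_geometric_complete : geometric_complete (R[i] : normedModType R[i]).
Proof.
move=> u C q q01 h; have tail := geometric_tail q01 h.
have key (p : R[i] -> R) : (forall z, `|p z| <= Normc.normc z) ->
    {morph p : x y / x - y} -> exists l : R, (fun n => p (u n)) @ \oo --> l.
  move=> pn pB; apply/cvg_ex; apply: cauchy_cvg; apply: cauchy_exP => e e0.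
  have : (fun n => C / (1 - q) * q ^+ n) @ \oo --> (0 : R) by exact: cvg0_geometric.
  move=> /cvgr0Pnorm_lt/(_ _ e0) [N _ hN].
  exists (p (u N)), N => // n /= Nn; rewrite -ball_normE /= -pB (le_lt_trans (pn _))//.
  have := tail (n - N)%N N; rewrite subnKC// -rnorm_normc rdistC => /le_lt_trans; apply.
  by rewrite mulrAC; apply: le_lt_trans (hN N _) => //=; exact: ler_norm.
have [a ua] := key (@complex.Re R) ler_Re_normc (@raddfB _ _ _).
have [b ub] := key (@complex.Im R) ler_Im_normc (@raddfB _ _ _).
by exists (Complex a b); exact: cvg_complex.
Qed.

Lemma cmeasurable_cvg (D : set (measurableTypeR R)) (f_ : nat -> R -> R[i]) f :
  (forall n, cmeasurable D (f_ n)) ->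
  (forall x, D x -> (fun n => f_ n x) @ \oo --> f x) -> cmeasurable D f.
Proof.
move=> mf ff; split.
  apply: (measurable_fun_cvg (h := fun n x => complex.Re (f_ n x))) => [n|x Dx].
    by case: (mf n).
  exact: cvg_Re (ff x Dx).
apply: (measurable_fun_cvg (h := fun n x => complex.Im (f_ n x))) => [n|x Dx].
  by case: (mf n).
exact: cvg_Im (ff x Dx).
Qed.

Lemma nneseries_geometric_le (c b : R) : 0 <= c -> 0 <= b < 1 ->
  (\big[+%E/0]_(0 <= n <oo) (c * b ^+ n)%:E <= (c / (1 - b))%:E)%E.
Proof.
move=> c0 /andP[b0 b1]; apply: lime_le.
  by apply: is_cvg_nneseries => n _ _; rewrite lee_fin mulr_ge0 ?exprn_ge0.
apply: nearW => n; rewrite sumEFin lee_fin.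
have -> : \sum_(0 <= k < n) c * b ^+ k = c * (1 - b ^+ n) / (1 - b).
  have b1' : 1 - b != 0 by rewrite gt_eqF// subr_gt0.
  elim: n => [|n IH]; first by rewrite big_nil expr0 subrr mulr0 mul0r.
  by rewrite big_nat_recr //= IH exprS; field.
by rewrite ler_pM2r ?invr_gt0 ?subr_gt0// ler_piMr// gerBl exprn_ge0.
Qed.

Lemma L2_geometric_complete : geometric_complete (L2 R).
Proof.
move=> u C q q01 h; have /andP[q0 q1] := q01.
have C0 : 0 <= C by have := h 0%N; rewrite expr0 mulr1; apply/le_trans/rnorm_ge0.
(* A ratio strictly between q and 1: the increments decrease like q^n in norm, but only like p^n
   pointwise. The loss makes the weights p^(-2n) affordable, the sum of the weighted integrals being
   geometric of ratio b = (q/p)^2 < 1. *)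
pose p : R := (1 + q) / 2.
have p0 : 0 < p by rewrite /p; lra.
have p1 : p < 1 by rewrite /p; lra.
have qp : q < p by rewrite /p; lra.
pose b : R := (q / p) ^+ 2.
have b0 : 0 <= b by rewrite sqr_ge0.
have b1 : b < 1.
  by rewrite /b expr_lt1//; [rewrite ltr_pdivrMr// mul1r|rewrite divr_ge0// ltW].
pose f n : R -> R[i] := u n : L2 R.
have mf n : cmeasurable halfline (f n) by exact: L2_cmeasurable.
have mfB n m : cmeasurable halfline (fun x => f n x - f m x).
  apply: cmeasurableD => //.
  have := cmeasurableM (cmeasurable_cst halfline (-1)) (mf m).
  by under [X in cmeasurable _ X -> _]eq_fun do rewrite mulN1r.
have sqB n m : sqnorm (fun x => f n x - f m x) = (rnorm (u n - u m) ^+ 2)%:E.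
  rewrite L2_sqnorm; apply: sqnorm_ae_eq => //; first exact: L2_cmeasurable.
  by apply: hl_eq_sym; exact: L2_sub.
pose D n x : \bar R := ((p^-1 ^+ n) ^+ 2 * Normc.normc (f n.+1 x - f n x) ^+ 2)%:E.
have D0 n x : (0 <= D n x)%E by rewrite lee_fin mulr_ge0 ?sqr_ge0.
have mD n : measurable_fun halfline (D n).
  rewrite (_ : D n = fun x => (((p^-1 ^+ n) ^+ 2)%:E * (Normc.normc (f n.+1 x - f n x) ^+ 2)%:E)%E)//.
  by apply: measurable_funeM; exact: cmeasurable_normc2.
(* The increments are at most [p^n sqrt (G x)]: the pointwise limit exists
   wherever [G] is finite, and the error is dominated by the integrable [G]. *)
pose G x : \bar R := (\big[+%E/0]_(0 <= n <oo) D n x)%E.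
have G0 x : (0 <= G x)%E by apply: nneseries_ge0.
have mG : measurable_fun halfline G.
  by apply: (ge0_emeasurable_sum (h := D) (P := xpredT)).
have intG : (\int[mu]_(x in halfline) G x <= (C ^+ 2 / (1 - b))%:E)%E.
  rewrite integral_nneseries//.
  apply: le_trans (nneseries_geometric_le (sqr_ge0 C) _); last by rewrite b0.
  apply: lee_nneseries => n _; first by move=> _; apply: integral_ge0 => x _.
  rewrite (_ : D n = fun x => (((p^-1 ^+ n) ^+ 2)%:E * (Normc.normc (f n.+1 x - f n x) ^+ 2)%:E)%E)//.
  rewrite ge0_integralZl//; [|exact: cmeasurable_normc2|by move=> x _; rewrite lee_fin sqr_ge0
    |by rewrite lee_fin sqr_ge0].
  rewrite -/(sqnorm (fun x => f n.+1 x - f n x)) sqB -EFinM lee_fin.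
  apply: (@le_trans _ _ ((p^-1 ^+ n) ^+ 2 * (C * q ^+ n) ^+ 2)).
    by rewrite ler_wpM2l ?sqr_ge0// ler_pXn2r ?nnegrE ?rnorm_ge0 ?mulr_ge0 ?exprn_ge0.
  rewrite /b exprAC !exprMn; move: (q ^+ n) (p^-1 ^+ n) => x y.
  by rewrite le_eqVlt; apply/orP; left; apply/eqP; ring.
have step x n : (G x < +oo)%E ->
    Normc.normc (f n.+1 x - f n x) <= Num.sqrt (fine (G x)) * p ^+ n.
  move=> Gx; have Gfin : G x \is a fin_num by rewrite ge0_fin_numE.
  have : (D n x <= G x)%E.
    apply: le_trans (nneseries_lim_ge n.+1 _) => //.
    by rewrite big_nat_recr//= leeDr// sume_ge0.
  rewrite -[X in (_ <= X)%E](fineK Gfin) lee_fin => hD.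
  rewrite -(@ler_pXn2r _ 2) ?nnegrE ?mulr_ge0 ?sqrtr_ge0 ?exprn_ge0 ?(ltW p0) ?normc_ge0//.
  rewrite exprMn sqr_sqrtr ?fine_ge0// -ler_pdivrMr ?exprn_gt0//.
  by rewrite mulrC -!exprVn.
(* The cut-off makes the sequence converge at every point, so that the limit is measurable. *)
pose g n x := if (G x < +oo)%E then f n x else 0.
have p01 : 0 <= p < 1 by rewrite p1 ltW.
have /choice[l hl] : forall x, exists l : R[i], (fun n => g n x) @ \oo --> l.
  move=> x; rewrite /g; case: (boolP (G x < +oo)%E) => Gx; last by exists 0; exact: cvg_cst.
  by have := @complex_geometric_complete (f^~ x) _ _ p01 (fun n => step x n Gx).
have mg n : cmeasurable halfline (g n).
  have mb : measurable_fun halfline (fun x => (G x < +oo)%E).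
    by apply: measurable_fun_lte => //; exact: measurable_cst.
  apply: (@cmeasurable_if _ halfline (f n) (fun=> 0)) => //.
  by apply: cmeasurableS (mf n) => //; exact: subIsetl.
have ml : cmeasurable halfline l by apply: cmeasurable_cvg (fun x _ => hl x).
have mlf n : cmeasurable halfline (fun x => l x - f n x).
  apply: cmeasurableD => //.
  have := cmeasurableM (cmeasurable_cst halfline (-1)) (mf n).
  by under [X in cmeasurable _ X -> _]eq_fun do rewrite mulN1r.
pose K n : R := (p ^+ n / (1 - p)) ^+ 2.
have K0 n : 0 < K n by rewrite exprn_gt0// divr_gt0 ?exprn_gt0// subr_gt0.
(* At points where [G x] is infinite the bound is trivial since [K n] is positive, so the estimate
   holds everywhere and can be integrated as it is. *)
have tail n x : ((Normc.normc (l x - f n x) ^+ 2)%:E <= (K n)%:E * G x)%E.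
  have [Gx|] := boolP (G x < +oo)%E; last first.
    by rewrite -leNgt leye_eq => /eqP ->; rewrite gt0_muley ?lte_fin// leey.
  have Gfin : G x \is a fin_num by rewrite ge0_fin_numE.
  have hlx := hl x; rewrite /g Gx in hlx.
  have := @geometric_limit _ _ (f^~ x) (l x) _ _ p01 (fun n => step x n Gx) hlx n.
  rewrite rnorm_normc => hh; rewrite -[X in (_ <= _ * X)%E](fineK Gfin) -EFinM lee_fin.
  rewrite -[X in _ <= _ * X]sqr_sqrtr ?fine_ge0// -exprMn ler_pXn2r ?nnegrE ?normc_ge0//.
    by rewrite (le_trans hh)// -mulrA mulrC.
  by rewrite mulr_ge0 ?sqrtr_ge0// divr_ge0 ?exprn_ge0 ?(ltW p0)// subr_ge0 ltW.
have sql n : (sqnorm (fun x => l x - f n x)%R <= (K n * (C ^+ 2 / (1 - b)))%:E)%E.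
  rewrite EFinM; apply: (@le_trans _ _ ((K n)%:E * \int[mu]_(x in halfline) G x)%E).
    rewrite -ge0_integralZl// ?lee_fin ?(ltW (K0 n))//.
    apply: ge0_le_integral => //.
    - by move=> x _; rewrite lee_fin sqr_ge0.
    - exact: cmeasurable_normc2.
    - exact: measurable_funeM.
  by rewrite lee_pmul2l ?lte_fin.
(* The estimates control [l] only through its differences with the [f n]; the limit is recovered by
   adding [u 0] back. *)
have [v hv] : exists v : L2 R, hl_eq v (fun x => l x - f 0%N x).
  by apply: L2_of_fun => //; apply: le_lt_trans (sql 0%N) _; rewrite ltry.
exists (v + u 0%N).
have vu n : hl_eq (v + u 0%N - u n : L2 R) (fun x => l x - f n x).
  have F := ae_filter_ringOfSetsType mu.
  apply: filterS3 (L2_sub (v + u 0%N) (u n)) (L2_add v (u 0%N)) hv => x h1 h2 h3 x0.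
  by rewrite h1// h2// h3// subrK.
apply: (@rnorm_squeeze _ _ _ _ (fun n => (C / (1 - p) * Num.sqrt (1 - b)^-1) * p ^+ n)) => [n|].
  have := sql n; rewrite -(sqnorm_ae_eq (L2_cmeasurable _) (mlf n) (vu n)) -L2_sqnorm lee_fin.
  have b1' : 0 < 1 - b by rewrite subr_gt0.
  move=> hh; rewrite -(@ler_pXn2r _ 2) ?nnegrE ?rnorm_ge0//; last first.
    by rewrite !mulr_ge0 ?sqrtr_ge0 ?exprn_ge0 ?(ltW p0)// invr_ge0 subr_ge0 ltW.
  apply: (le_trans hh); rewrite /K !exprMn sqr_sqrtr ?invr_ge0 ?(ltW b1')//.
  by rewrite le_eqVlt; apply/orP; left; apply/eqP; ring.
exact: cvg0_geometric.
Qed.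

End Completeness.

HB.instance Definition _ (R : realType) := Uniform_isComplete.Build (L2 R)
  (geometric_cauchy_cvg (@L2_geometric_complete R)).

(** * Resolvents and graded bases *)

Section Spectrum.
Context {R : realType} {H : hilbertType R}.
Implicit Types (L B : 'B(H)) (z w : R[i]).

(** The inverse of 1 - z L, rather than of z - L: it makes sense at z = 0, where it is the identity,
    and for other z it exists exactly when 1/z is off the spectrum. *)
Definition is_resolvent L z B :=
  (forall x, B (x - z *: L x) = x) /\ (forall x, B x - z *: L (B x) = x).

(** Boundedness of the spectrum is what makes the supremum in [spectral_radius] an actual upper
    bound. For large z, 1 - z^-1 L is bounded below and onto by the Neumann series. *)
Lemma not_spectrum_large L : exists2 M : R, 0 < M &
  forall z, M < Normc.normc z -> ~ spectrum L z.
Proof.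
have [M [M0 LM]] := bop_rbounded L; exists M => // z Mz; apply: contrapT => /= /contrapT; apply.
have nz0 : 0 < Normc.normc z by exact: lt_trans Mz.
have z0 : z != 0 by apply: contraTneq nz0 => ->; rewrite Normc.normc0 ltxx.
pose q := M / Normc.normc z.
have q01 : 0 <= q < 1 by rewrite divr_ge0 ?ltW //= ltr_pdivrMr// mul1r.
have [A hA] : exists A : 'B(H), forall x, A x = z^-1 *: L x.
  apply: (@bop_of_fun _ _ _ _ q) => [a x y|x].
    by rewrite linearP scalerDr !scalerA mulrC.
  rewrite rnormZ Normc.normcV (le_trans (ler_wpM2l _ (LM x))) ?invr_ge0 ?(ltW nz0)//.
  by rewrite /q mulrA (mulrC M).
have Aq x : rnorm (A x) <= q * rnorm x.
  rewrite hA rnormZ Normc.normcV (le_trans (ler_wpM2l _ (LM x))) ?invr_ge0 ?(ltW nz0)//.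
  by rewrite /q mulrA (mulrC M).
have below x : (1 - q) * rnorm x <= rnorm (x - A x).
  rewrite mulrBl mul1r lerBlDr.
  have := ler_rnormD (x - A x) (A x); rewrite subrK => /le_trans; apply.
  by rewrite lerD2l.
have [C hC] : exists C : 'B(H), forall x, C x = x - A x.
  apply: (@bop_of_fun _ _ _ _ (1 + q)) => [a x y|x].
    by rewrite linearP opprD addrACA scalerBr.
  by rewrite (le_trans (ler_rnormD _ _))// rnormN mulrDl mul1r lerD2l.
have [//|||B [CB BC]] := @bop_inverse _ _ C (1 - q).
- by rewrite subr_gt0; case/andP: q01.
- by move=> x; rewrite hC.
- by move=> y; have [x xy] := neumann q01 Aq y; exists x; rewrite hC.
have [b [b0 bB]] := bop_rbounded B.
have [D hD] : exists D : 'B(H), forall x, D x = z^-1 *: B x.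
  apply: (@bop_of_fun _ _ _ _ ((Normc.normc z)^-1 * b)) => [a x y|x].
    by rewrite linearP scalerDr !scalerA mulrC.
  by rewrite rnormZ Normc.normcV -mulrA ler_wpM2l// invr_ge0 ltW.
exists D; split=> x; rewrite hD.
  have -> : z *: x - L x = z *: C x by rewrite hC hA scalerBr scalerA mulfV// scale1r.
  by rewrite linearZ /= CB scalerA mulVf// scale1r.
by rewrite scalerA mulfV// scale1r linearZ /= -hA -hC BC.
Qed.

Lemma spectral_radius_ub L z : spectral_radius L < Normc.normc z -> ~ spectrum L z.
Proof.
move=> rz sz; suff : Normc.normc z <= spectral_radius L by rewrite leNgt rz.
apply: ub_le_sup; last by exists z.
have [M M0 hM] := not_spectrum_large L; exists M => _ [w sw <-].
by rewrite leNgt; apply/negP => /hM.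
Qed.

(** Stated without inverting the spectral radius, because it also serves to refute
    [spectral_radius L <= 0]. *)
Lemma resolvent_inv L z : spectral_radius L < Normc.normc z -> z != 0 ->
  exists B, is_resolvent L z^-1 B.
Proof.
move=> /spectral_radius_ub /contrapT [S [SL LS]] z0.
have [b [b0 bS]] := bop_rbounded S.
have [B hB] : exists B : 'B(H), forall x, B x = z *: S x.
  apply: (@bop_of_fun _ _ _ _ (Normc.normc z * b)) => [a x y|x].
    by rewrite linearP scalerDr !scalerA mulrC.
  by rewrite rnormZ -mulrA ler_wpM2l// normc_ge0.
exists B; split=> x; rewrite !hB.
  have -> : x - z^-1 *: L x = z^-1 *: (z *: x - L x).
    by rewrite scalerBr scalerA mulVf// scale1r.
  by rewrite linearZ /= SL scalerA mulfV// scale1r.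
have -> : L (z *: S x) = z *: L (S x) by exact: linearZ.
by rewrite scalerA mulVf// scale1r LS.
Qed.

Lemma resolvent_exists L z : Normc.normc z < (spectral_radius L)^-1 ->
  exists B, is_resolvent L z B.
Proof.
have [-> _|z0 zr] := eqVneq z 0.
  have [B hB] := @bop_of_fun _ H H id 1 (fun a x y => erefl) (fun x => ler_peMl (rnorm_ge0 _) (lexx _)).
  by exists B; split=> x; rewrite !hB scale0r subr0.
have nz0 : 0 < Normc.normc z.
  by rewrite lt_def normc_ge0 andbT; apply: contra_neq z0; exact: Normc.eq0_normc.
have r0 : 0 < spectral_radius L by rewrite -invr_gt0; exact: lt_trans zr.
rewrite -[z]invrK; apply: resolvent_inv; last by rewrite invr_eq0.
by rewrite Normc.normcV -[ltLHS]invrK ltf_pV2// posrE invr_gt0.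
Qed.

End Spectrum.

(** * Calculus of P (1 - z L)^-1 for a left inverse L of T *)

Section Resolvent.
Context {R : realType} {H : hilbertType R}.
Variables (L T P : 'B(H)).
Hypothesis PE : forall x, P x = x - T (L x).
Hypothesis TK : cancel T L.
Implicit Types (B : 'B(H)) (x e f : H) (z lambda : R[i]).

Lemma resolventE z B x : is_resolvent L z B -> B x = x + z *: L (B x).
Proof. by move=> [_ h]; rewrite -{2}(h x) subrK. Qed.

Lemma resolvent_comm z B x : is_resolvent L z B -> L (B x) = B (L x).
Proof.
move=> [h1 h2]; rewrite -{2}(h2 x) linearB linearZ /=.
by rewrite h1.
Qed.

Lemma proj_resolvent z B x : is_resolvent L z B ->
  P (B x) = P x + z *: P (B (L x)).
Proof.
by move=> hB; rewrite {1}(resolventE x hB) linearD linearZ /= (resolvent_comm x hB).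
Qed.

Lemma proj_resolvent_iter z B n x : is_resolvent L z B ->
  (forall j, (j < n)%N -> P (iter j L x) = 0) ->
  P (B x) = z ^+ n *: P (B (iter n L x)).
Proof.
move=> hB; elim: n => [|n IH] h; first by rewrite expr0 scale1r.
rewrite IH => [|j jn]; last by apply: h; exact: ltnW.
by rewrite (proj_resolvent _ hB) h// add0r scalerA exprSr.
Qed.

Lemma proj_shift x : P (T x) = 0.
Proof. by rewrite PE TK subrr. Qed.

Lemma proj_resolvent_shift z B f : is_resolvent L z B -> P (B (T f)) = z *: P (B f).
Proof. by move=> hB; rewrite (proj_resolvent _ hB) proj_shift add0r TK. Qed.

(** The resolvent identity B = B0 + (z - z0) L B0 B, iterated [n] times with its exact remainder. *)
Lemma resolvent_expansion z0 z B0 B f n :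
  is_resolvent L z0 B0 -> is_resolvent L z B ->
  B f = \sum_(k < n) (z - z0) ^+ k *: iter k (fun x => L (B0 x)) (B0 f)
        + (z - z0) ^+ n *: iter n (fun x => L (B0 x)) (B f).
Proof.
move=> h0 h; set A := fun x => L (B0 x).
have step : B f = B0 f + (z - z0) *: A (B f).
  have [_ hz] := h; have [h0' _] := h0.
  have : B f - z0 *: L (B f) = f + (z - z0) *: L (B f).
    by rewrite scalerBl addrA -(resolventE f h).
  move=> /(congr1 B0); rewrite h0' linearD linearZ /= => {1}->.
  by rewrite /A (resolvent_comm _ h0).
have Alin m a x y : iter m A (a *: x + y) = a *: iter m A x + iter m A y.
  by elim: m => [//|m IH]; rewrite !iterS IH /A !linearP.
elim: n => [|n IH]; first by rewrite big_ord0 add0r expr0 scale1r.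
rewrite {1}IH big_ord_recr /= -!addrA; congr (_ + _).
have e : iter n A (B f) = (z - z0) *: iter n A (A (B f)) + iter n A (B0 f).
  by rewrite -Alin addrC -step.
by rewrite {1}e scalerDr scalerA addrC -exprSr -(iterSr n A).
Qed.

Lemma resolvent_analytic z0 B0 f : is_resolvent L z0 B0 ->
  exists2 rho : R, 0 < rho & forall z B, is_resolvent L z B ->
    Normc.normc (z - z0) < rho ->
    series (fun n => (z - z0) ^+ n *: P (iter n (fun x => L (B0 x)) (B0 f))) @ \oo --> P (B f).
Proof.
move=> h0; have [l [l0 lL]] := bop_rbounded L.
have [b [b0 bB]] := bop_rbounded B0; have [p [p0 pP]] := bop_rbounded P.
pose m := l * b; have m0 : 0 < m by exact: mulr_gt0.
(* [m] bounds the norm of L B0, so the remainder of order n is at most a constant times (|z - z0|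
   m)^n. *)
exists m^-1; first by rewrite invr_gt0.
move=> z B h zz0; set w := z - z0; pose A x := L (B0 x).
have itA n x : rnorm (iter n A x) <= m ^+ n * rnorm x.
  elim: n => [|n IH]; first by rewrite expr0 mul1r.
  rewrite iterS /A (le_trans (lL _))// exprS -mulrA /m -!mulrA ler_wpM2l ?(ltW l0)//.
  by rewrite (le_trans (bB _))// ler_wpM2l ?(ltW b0)//.
pose q := Normc.normc w * m.
have q01 : 0 <= q < 1 by rewrite mulr_ge0 ?normc_ge0 ?(ltW m0)//= -ltr_pdivlMr// mul1r.
apply: (@rnorm_squeeze _ _ _ _ (fun n => (p * rnorm (B f)) * q ^+ n)) => [n|]; last exact: cvg0_geometric.
have -> : series (fun n => w ^+ n *: P (iter n (fun x => L (B0 x)) (B0 f))) n =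
    P (\sum_(k < n) w ^+ k *: iter k A (B0 f)).
  rewrite /series /= big_mkord linear_sum; apply: eq_bigr => k _.
  by rewrite linearZ.
rewrite -linearB {1}(resolvent_expansion f n h0 h) addrC addrA addNr add0r.
rewrite (le_trans (pP _))// -mulrA ler_wpM2l ?(ltW p0)// rnormZ.
by rewrite normcX [leRHS]mulrC /q exprMn -mulrA ler_wpM2l ?exprn_ge0 ?normc_ge0.
Qed.

Variable Ld : 'B(H).
Hypothesis LdE : forall x y, inner (L x) y = inner x (Ld y).

Lemma inner_iter n x y : inner (iter n L x) y = inner x (iter n Ld y).
Proof. by elim: n x => [//|n IH] x; rewrite iterSr IH LdE. Qed.

(* This replaces the spectral radius formula: [P B] sends [Ld^n e] to
   [z^n L^n Ld^n e], and its norm does not depend on [n]. *)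
Lemma iter_dual_bound z B : is_resolvent L z B -> z != 0 ->
  exists2 C : R, 0 < C & forall n e,
    (forall j, (j < n)%N -> P (iter j L (iter n Ld e)) = 0) ->
    P (iter n L (iter n Ld e)) = iter n L (iter n Ld e) ->
    L (iter n L (iter n Ld e)) = 0 ->
    rnorm (iter n Ld e) <= C * (Normc.normc z)^-1 ^+ n * rnorm e /\
    rnorm (iter n L (iter n Ld e)) <= (C * (Normc.normc z)^-1 ^+ n) ^+ 2 * rnorm e.
Proof.
move=> hB z0; have [p [p0 pP]] := bop_rbounded P.
have [b [b0 bB]] := bop_rbounded B.
exists (p * b); first exact: mulr_gt0.
move=> n e h1 h2 h3; set x := iter n Ld e; set y := iter n L x.
have nz0 : 0 < Normc.normc z.
  by rewrite lt_def normc_ge0 andbT; apply: contra_neq z0; exact: Normc.eq0_normc.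
have yE : P (B x) = z ^+ n *: y.
  by rewrite (proj_resolvent_iter hB h1) (proj_resolvent _ hB) h2 h3 !linear0 ?scaler0 addr0.
have yx : rnorm y <= p * b * (Normc.normc z)^-1 ^+ n * rnorm x.
  have : Normc.normc z ^+ n * rnorm y <= p * (b * rnorm x).
    by rewrite -normcX -rnormZ -yE (le_trans (pP _))// ler_wpM2l ?(ltW p0).
  rewrite mulrC -ler_pdivlMr ?exprn_gt0// => /le_trans; apply.
  by rewrite exprVn mulrA mulrAC.
(* Since |x|^2 = <y, e> <= |y| |e|, the bound of y by x becomes a bound of x by e once |x| is
   cancelled. Inserting it in [yx] produces the square in the second estimate. *)
suff xe : rnorm x <= p * b * (Normc.normc z)^-1 ^+ n * rnorm e.
  split=> //; rewrite (le_trans yx)// expr2 -[leRHS]mulrA ler_wpM2l//.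
  by rewrite !mulr_ge0 ?exprn_ge0 ?invr_ge0 ?normc_ge0 ?(ltW p0) ?(ltW b0).
have [->|x0] := eqVneq x 0.
  by rewrite rnorm0 !mulr_ge0 ?rnorm_ge0 ?exprn_ge0 ?invr_ge0 ?normc_ge0 ?(ltW p0) ?(ltW b0).
rewrite -(ler_pM2l (rnorm_gt0 x0)) -expr2.
have -> : rnorm x ^+ 2 = Normc.normc (inner y e).
  by rewrite inner_iter -/x inner_rnorm normc_real ger0_norm ?sqr_ge0.
rewrite (le_trans (cauchy_schwarz _ _))// mulrA ler_wpM2r ?rnorm_ge0//.
by rewrite mulrC.
Qed.

(** The limit [h] is (1 - conj(lambda) Ld)^-1 e; the growth of the single orbit Ld^n e is enough for
    its Neumann series to converge. *)
Lemma kernel_vector lambda C rho e : 0 <= rho -> Normc.normc lambda * rho < 1 ->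
  (forall n, rnorm (iter n Ld e) <= C * rho ^+ n) ->
  exists h, (fun n => \sum_(k < n) (lambda^* ^+ k) *: iter k Ld e) @ \oo --> h /\
    forall B g, is_resolvent L lambda B -> inner (B g) e = inner g h.
Proof.
move=> rho0 lr hC; set u := fun n => \sum_(k < n) _.
set q := Normc.normc lambda * rho in lr.
have q01 : 0 <= q < 1 by rewrite lr mulr_ge0 ?normc_ge0.
have C0 : 0 <= C by have := hC 0%N; rewrite expr0 mulr1; apply/le_trans/rnorm_ge0.
have term n : rnorm (lambda^* ^+ n *: iter n Ld e) <= C * q ^+ n.
  rewrite rnormZ normcX normc_conj /q exprMn mulrCA ler_wpM2l ?exprn_ge0 ?normc_ge0//.
have [n|h uh] := complete_geometric (@cauchy_cvg H) (u := u) q01 (C := C).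
  by rewrite /u big_ord_recr /= addrAC subrr add0r.
exists h; split=> // B g hB; apply/esym; apply: (cvg_inner uh).
(* Writing g = y - lambda L y and moving L across the inner product makes the partial sums
   telescope: only <y, e> and a vanishing last term remain. *)
set y := B g; have gE : g = y - lambda *: L y by have [_ ->] := hB.
have gu n : inner g (u n) = inner y e - inner y (lambda^* ^+ n *: iter n Ld e).
  rewrite gE; elim: n => [|n IH]; first by rewrite /u big_ord0 inner0r expr0 scale1r subrr.
  rewrite /u big_ord_recr /= innerDr -/(u n) IH innerBl innerZl.
  rewrite !innerZr LdE -iterS exprS rmorphM /= rmorphXn /= conjCK.
  by ring.
apply: squeeze_cvgr (cvg_cst 0) (cvg0_geometric (rnorm y * C) q01).
apply: nearW => n; rewrite normc_ge0 /= gu addrAC subrr add0r.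
by rewrite normcN (le_trans (cauchy_schwarz _ _))// -mulrA ler_wpM2l ?rnorm_ge0.
Qed.

(** From 0 = P B_z g = P g + z P B_z L g one gets P g = 0 at z = 0, and then the same hypothesis for
    L g. By induction P L^n f = 0, that is L^n f = T L^(n+1) f, so f = T^n L^n f for all n. *)
Lemma resolvent_injective (delta : R) (f : H) : 0 < delta ->
  (forall z, Normc.normc z < delta -> exists2 B, is_resolvent L z B & P (B f) = 0) ->
  (fun n => rnorm (iter n T (iter n L f))) @ \oo --> (0 : R) -> f = 0.
Proof.
move=> d0 hf tail.
have [l [l0 lL]] := bop_rbounded L; have [p [p0 pP]] := bop_rbounded P.
(* Near 0 all resolvents share the bound 2, because |B x| <= |x| + |z| l |B x|. *)
have small z B x : is_resolvent L z B -> Normc.normc z * l <= 2^-1 ->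
    rnorm (B x) <= 2 * rnorm x.
  move=> hB zl; have := ler_rnormD x (z *: L (B x)); rewrite -(resolventE x hB) rnormZ.
  have := lL (B x); have := normc_ge0 z; have := rnorm_ge0 (B x); have := rnorm_ge0 (L (B x)).
  by nra.
have step g : (forall z, Normc.normc z < delta -> exists2 B, is_resolvent L z B & P (B g) = 0) ->
    P g = 0 /\ forall z, Normc.normc z < delta -> exists2 B, is_resolvent L z B & P (B (L g)) = 0.
  move=> hg; have Pg : P g = 0.
    have [|B hB PB] := hg 0; first by rewrite Normc.normc0.
    by have := proj_resolvent g hB; rewrite PB scale0r addr0.
  have hLg z : z != 0 -> Normc.normc z < delta -> exists2 B, is_resolvent L z B & P (B (L g)) = 0.
    move=> z0 /hg[B hB PB]; exists B => //; have := proj_resolvent g hB.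
    by rewrite PB Pg add0r => /esym/eqP; rewrite scaler_eq0 (negPf z0) => /eqP.
  split=> // z zd; have [z0|z0] := eqVneq z 0; last exact: hLg.
  have [B hB _] := hg z zd; exists B => //; rewrite (proj_resolvent _ hB) z0 scale0r addr0.
  apply: rnorm0_eq0; apply/eqP; rewrite eq_le rnorm_ge0 andbT.
  (* Dividing by z loses the point z = 0, which is recovered by continuity: P L g = - w P B_w L L g
     for small nonzero w, and w tends to 0 along e 2^-n. This [e] keeps w inside the disc and in the
     range of [small]. *)
  pose e : R := Num.min (delta / 2) (2 * l)^-1.
  have e0 : 0 < e by rewrite lt_min divr_gt0// invr_gt0 mulr_gt0.
  have q01 : 0 <= (2^-1 : R) < 1 by rewrite invr_ge0 ler0n /= invf_lt1// ltr1n.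
  apply: (le_cvg0 (cvg0_geometric (e * (p * (2 * rnorm (L (L g))))) q01)) => n.
  pose w : R[i] := (e * 2^-1 ^+ n)%:C.
  have en : 0 < e * 2^-1 ^+ n by rewrite mulr_gt0 ?exprn_gt0.
  have wE : Normc.normc w = e * 2^-1 ^+ n by rewrite normc_real gtr0_norm.
  have we : Normc.normc w <= e by rewrite wE ler_piMr ?(ltW e0)// exprn_ile1// invf_le1// ler1n.
  have w0 : w != 0.
    by apply/negP => /eqP w0; move: en; rewrite -wE w0 Normc.normc0 ltxx.
  have [|C hC PC] := hLg w w0.
    rewrite (le_lt_trans we)// /e gt_min; apply/orP; left.
    by rewrite ltr_pdivrMr// ltr_pMr// ltr1n.
  have := proj_resolvent (L g) hC; rewrite PC => /esym/eqP; rewrite addr_eq0 => /eqP ->.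
  rewrite rnormN rnormZ wE -[leRHS]mulrA [X in _ <= _ * X]mulrC [leRHS]mulrA.
  rewrite ler_wpM2l ?(ltW en)// (le_trans (pP _))// ler_wpM2l ?(ltW p0)//.
  apply: (small _ _ _ hC); rewrite (le_trans (ler_wpM2r (ltW l0) we))//.
  rewrite (@le_trans _ _ ((2 * l)^-1 * l))// ?ler_wpM2r ?(ltW l0) ?ge_min ?lexx ?orbT//.
  by rewrite invfM mulrVK// unitfE gt_eqF.
have all n : forall z, Normc.normc z < delta ->
    exists2 B, is_resolvent L z B & P (B (iter n L f)) = 0.
  by elim: n => [//|n IH]; have [_] := step _ IH.
have fE n : iter n T (iter n L f) = f.
  elim: n => [//|n IH]; rewrite -[RHS]IH iterSr iterS; congr (iter n T _).
  have [Pn _] := step _ (all n).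
  by apply/esym/eqP; rewrite -subr_eq0 -PE Pn.
apply: rnorm0_eq0; apply/eqP; rewrite eq_le rnorm_ge0 andbT.
by apply: (le_cvg0 tail) => n; rewrite fE.
Qed.

End Resolvent.

(** * Orthonormal bases adapted to a family of orthogonal projections *)

Section GradedBasis.
Context {R : realType} {H : hilbertType R}.

Lemma linear_span_closed (B : set H) (a : R[i]) x y :
  linear_span B x -> linear_span B y -> linear_span B (a *: x + y).
Proof.
move=> [n [c [b [Bb ->]]]] [m [d [b' [Bb' ->]]]].
exists (n + m)%N, (fun i => match fintype.split i with inl i => a * c i | inr j => d j end),
  (fun i => match fintype.split i with inl i => b i | inr j => b' j end); split.
  by move=> i; case: (fintype.split i).
rewrite big_split_ord /= scaler_sumr; congr (_ + _); apply: eq_bigr => i _.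
  by rewrite -/(unsplit (inl i)) (unsplitK (inl i)) scalerA.
by rewrite -/(unsplit (inr i)) (unsplitK (inr i)).
Qed.

(** Zorn's lemma runs over orthonormal sets of homogeneous vectors, each fixed by some [Q n],
    because such vectors will be monomials. Maximality still gives density: if [f] is orthogonal to
    the span and [Q n f] is nonzero, its normalization is homogeneous and can be added. *)
Lemma graded_orthonormal_basis (Q : nat -> H -> H) :
  (forall n a x, Q n (a *: x) = a *: Q n x) ->
  (forall n x y, inner (Q n x) y = inner x (Q n y)) ->
  (forall n x, Q n (Q n x) = Q n x) ->
  (forall n m x, n != m -> Q n (Q m x) = 0) ->
  (forall x, (forall n, Q n x = 0) -> x = 0) ->
  exists B : set H, orthonormal_basis B /\ forall b, B b -> exists n, Q n b = b.
Proof.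
move=> QZ Qadj QQ Qort Qsep.
pose good (B : set H) :=
  (forall b c, B b -> B c -> inner b c = (b == c)%:R) /\
  forall b, B b -> exists n, Q n b = b.
have [F Fgood totF|B [[Bort Bhom] Bmax]] := @Zorn_bigcup H good.
  split=> [b c [X FX Xb] [Y FY Yc]|b [X FX Xb]]; last by have [_] := Fgood _ FX; apply.
  have [XY|YX] := totF _ _ FX FY.
    by have [h _] := Fgood _ FY; apply: h => //; exact: XY.
  by have [h _] := Fgood _ FX; apply: h => //; exact: YX.
exists B; split=> //; split=> //; apply: dense_orthogonal.
- by exists 0%N, (fun=> 0), (fun=> 0); split=> [[]//|]; rewrite big_ord0.
- exact: linear_span_closed.
move=> f fB; apply: Qsep => n; apply: contrapT => /eqP Qn0.
(* If [b] is in block [n], self-adjointness turns the product into <b, f> = 0; otherwise the two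
   blocks are orthogonal. *)
have ortB b : B b -> inner b (Q n f) = 0.
  move=> Bb; have [m mb] := Bhom b Bb.
  have [nm|nm] := eqVneq n m.
    rewrite -Qadj nm mb; apply: inner_eq0_sym; apply: fB.
    exists 1%N, (fun=> 1), (fun=> b); split=> //.
    by rewrite big_ord_recl big_ord0 addr0 scale1r.
  by rewrite -Qadj -mb Qort// inner0l.
pose g := ((rnorm (Q n f))^-1)%:C *: Q n f.
have g1 : inner g g = 1.
  rewrite inner_rnorm rnormZ normc_real ger0_norm ?invr_ge0 ?rnorm_ge0//.
  by rewrite mulVf ?expr1n// gt_eqF// rnorm_gt0.
have gB b : B b -> inner b g = 0 by move=> Bb; rewrite innerZr ortB// mulr0.
apply: (Bmax (B `|` [set g])).
  split; first by move=> x; left.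
  move=> /(_ g (or_intror erefl)) Bg.
  by have := gB g Bg; rewrite g1 => /eqP; rewrite oner_eq0.
split=> [b c [Bb|->] [Bc|->]|b [Bb|->]].
- exact: Bort.
- rewrite gB//; case: eqP => // bg; move: (gB _ Bb); rewrite bg g1.
  by move=> /eqP; rewrite oner_eq0.
- rewrite inner_eq0_sym ?gB//; case: eqP => // gc; move: (gB _ Bc); rewrite -gc g1.
  by move=> /eqP; rewrite oner_eq0.
- by rewrite eqxx g1.
- exact: Bhom.
by exists n; rewrite QZ QQ.
Qed.

End GradedBasis.

(** * Weighted translations *)

Section AdjointInverse.
Context {R : realType} {H : preHilbertType R}.

(** [adjoint] is defined by choice: one candidate shows that the chosen operator has the defining
    property, and uniqueness identifies the two. *)
Lemma adjointE (T T0 : 'B(H)) :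
  (forall x y, inner (T x) y = inner x (T0 y)) -> forall y, adjoint T y = T0 y.
Proof.
move=> h y; have := @getPex _ [set T' : 'B(H) | forall x y, inner (T x) y = inner x (T' y)].
move=> /(_ (ex_intro _ T0 h)) /= h'.
apply/eqP; rewrite -subr_eq0; apply/eqP/inner_eq0 => x; apply: inner_eq0_sym.
by rewrite innerBr -h' h subrr.
Qed.

Lemma bop_invE (T B : 'B(H)) : cancel T B -> cancel B T ->
  forall x, bop_inv T x = B x.
Proof.
move=> TB BT x; have := @getPex _ [set S : 'B(H) | cancel T S /\ cancel S T].
by move=> /(_ (ex_intro _ B (conj TB BT))) /= [TS _]; rewrite -{1}(BT x) TS.
Qed.

End AdjointInverse.

Section ForwardShift.
Context {R : realType}.
Local Notation mu := (@lebesgue_measure R).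

(** The weights telescope under the square root. The symbol is left general since it will be [phi]
    for S_t and 1/phi for its Cauchy dual. *)
Lemma weighted_shift_iter (psi : R -> R) (t : R) (A : L2 R -> L2 R) n (f : L2 R) :
  0 <= t -> (forall x, 0 <= x -> 0 < psi x) ->
  (forall f, hl_eq (A f) (fun x =>
    if t <= x then (Num.sqrt (psi x / psi (x - t)))%:C * f (x - t) else 0)) ->
  hl_eq (iter n A f) (fun x => if n%:R * t <= x then
    (Num.sqrt (psi x / psi (x - n%:R * t)))%:C * f (x - n%:R * t) else 0).
Proof.
move=> t0 psi0 hA; have F := ae_filter_ringOfSetsType mu.
elim: n => [|n IH].
  apply: nearW => x x0; rewrite mul0r x0 subr0 divff ?sqrtr1 ?mul1r//.
  by rewrite gt_eqF// psi0.
have := ae_shift (- t) IH; apply: filterS2 (hA (iter n A f)) => x h1 h2 x0.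
rewrite iterS h1//.
have -> : n.+1%:R * t = n%:R * t + t by rewrite -natr1 mulrDl mul1r.
have nt0 : 0 <= n%:R * t by rewrite mulr_ge0.
rewrite -lerBrDr; have [tx|tx] := boolP (t <= x); last first.
  case: (boolP (n%:R * t <= x - t)) => // ntx; move: tx.
  by rewrite -subr_ge0 (le_trans nt0 ntx).
rewrite h2 ?subr_ge0//; case: ifPn => ntx; last by rewrite mulr0.
have -> : x - (n%:R * t + t) = x - t - n%:R * t by rewrite opprD addrA addrAC.
rewrite mulrA -rmorphM /= -sqrtrM; last first.
  by rewrite divr_ge0// ltW// psi0 ?subr_ge0.
by rewrite mulrA divfK// gt_eqF// psi0 ?subr_ge0.
Qed.

Lemma weighted_backshift_iter (psi : R -> R) (t : R) (A : L2 R -> L2 R) n (f : L2 R) :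
  0 <= t -> (forall x, 0 <= x -> 0 < psi x) ->
  (forall f, hl_eq (A f) (fun x => (Num.sqrt (psi x / psi (x + t)))%:C * f (x + t))) ->
  hl_eq (iter n A f) (fun x =>
    (Num.sqrt (psi x / psi (x + n%:R * t)))%:C * f (x + n%:R * t)).
Proof.
move=> t0 psi0 hA; have F := ae_filter_ringOfSetsType mu.
elim: n => [|n IH].
  apply: nearW => x x0; rewrite mul0r addr0 divff ?sqrtr1 ?mul1r//.
  by rewrite gt_eqF// psi0.
have := ae_shift t IH; apply: filterS2 (hA (iter n A f)) => x h1 h2 x0.
have xt0 : 0 <= x + t by rewrite addr_ge0.
rewrite iterS h1// h2//.
have -> : x + n.+1%:R * t = x + t + n%:R * t by rewrite -natr1 mulrDl mul1r addrA addrAC.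
rewrite mulrA -rmorphM /= -sqrtrM; last by rewrite divr_ge0// ltW// psi0.
by rewrite mulrA divfK// gt_eqF// psi0.
Qed.

End ForwardShift.

(** * Adjoint and Cauchy dual of a weighted translation *)

Section WeightedTranslationOperators.
Context {R : realType}.
Local Notation mu := (@lebesgue_measure R).
Local Notation halfline := ([set` `[0%R, +oo[%R] : set R).

Lemma complex_integral_hl_eq (f g : R -> R[i]) :
  cmeasurable halfline f -> cmeasurable halfline g -> hl_eq f g ->
  complex_integral f = complex_integral g.
Proof.
move=> [fr fi] [gr gi] fg; have F := ae_filter_ringOfSetsType mu.
rewrite /complex_integral; congr Complex; rewrite /Rintegral; congr fine;
  apply: ae_eq_integral => //; try exact/measurable_EFinP;
  by apply: filterS fg => x fg; rewrite /= in_itv /= andbT => x0; rewrite fg.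
Qed.

Lemma complex_integral_shift (s : R) (f : R -> R[i]) : 0 <= s ->
  cmeasurable [set` `[s, +oo[] f ->
  complex_integral (fun x => if s <= x then f x else 0) =
  complex_integral (fun x => f (x + s)).
Proof.
move=> s0 [fr fi].
have key (h : R -> R) : measurable_fun [set` `[s, +oo[] h ->
    \int[mu]_(x in halfline) (if s <= x then h x else 0) =
    \int[mu]_(x in halfline) h (x + s).
  move=> mh; rewrite /Rintegral; congr fine.
  rewrite -(@integral_shift _ s (EFin \o h)); last exact/measurable_EFinP.
  rewrite integral_mkcond [RHS]integral_mkcond; apply: eq_integral => x _.
  rewrite /patch !mem_setE !in_itv /= !andbT.
  case: ifPn => x0; case: ifPn => sx //.
  by move: x0; rewrite (le_trans s0 sx).
rewrite /complex_integral; congr Complex.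
  by rewrite -(key (fun x => complex.Re (f x)) fr); apply: eq_Rintegral => x _; case: ifP.
by rewrite -(key (fun x => complex.Im (f x)) fi); apply: eq_Rintegral => x _; case: ifP.
Qed.

Variables (phi : R -> R).
Hypothesis phi_gt0 : forall x : R, 0 <= x -> 0 < phi x.
Hypothesis phi_continuous : {within [set` `[0%R, +oo[%R], continuous phi}.
Hypothesis phi_bounded : forall t : R, 0 <= t ->
    (ess_sup (@lebesgue_measure R) (fun x : R => `|phi_ phi t x|%:E) < +oo)%E.
Variable S : R -> 'B(L2 R).
Hypothesis S_semigroup : weighted_translation_semigroup phi S.
Hypothesis phi_inf : forall t : R, 0 <= t ->
    0 < inf [set phi (x + t) / phi x | x in [set` `[0%R, +oo[%R]].
Variable t : R.
Hypothesis t_gt0 : 0 < t.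

Let t_ge0 : 0 <= t := ltW t_gt0.
Let T := S t.

Let phi_ge0 x : 0 <= x -> 0 <= phi x. Proof. by move=> /phi_gt0/ltW. Qed.
Let phi_neq0 x : 0 <= x -> phi x != 0. Proof. by move=> /phi_gt0 h; rewrite gt_eqF. Qed.

Lemma phi_measurable : measurable_fun halfline phi.
Proof. by apply: subspace_continuous_measurable_fun => //; exact: measurable_itv. Qed.

(** Quotients and square roots of the symbol are treated as the real powers -1 and 1/2. *)
Lemma measurable_powR_comp (D : set (measurableTypeR R)) (h : R -> R) p : measurable_fun D h ->
  measurable_fun D (fun x => h x `^ p).
Proof. by move=> mh; exact: (measurableT_comp (measurable_powR p) mh). Qed.

Lemma ratio_measurable (s : R) : 0 <= s ->
  measurable_fun halfline (fun x => phi x / phi (x + s)).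
Proof.
move=> s0.
have [m _] := @cmeasurable_shift _ s (fun x => (phi x)%:C) s0
  (cmeasurable_real (measurable_funS (measurable_itv _) (halflineS s0) phi_measurable)).
apply: (eq_measurable_fun (fun x => phi x * phi (x + s) `^ (-1))).
  move=> x; rewrite inE /= in_itv /= andbT => x0.
  by rewrite powR_inv1// phi_ge0// addr_ge0.
by apply: measurable_funM; [exact: phi_measurable|exact: measurable_powR_comp].
Qed.

Let w (x : R) : R := phi_ phi t x.

Lemma sqrt_ratio_measurable : measurable_fun [set` `[t, +oo[]
  (fun x => Num.sqrt (phi x / phi (x - t))).
Proof.
have [m _] := @cmeasurable_unshift _ t (fun x => (phi x)%:C)
  (cmeasurable_real phi_measurable).
apply: (eq_measurable_fun (fun x => (phi x * phi (x - t) `^ (-1)) `^ (2^-1))).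
  move=> x; rewrite inE /= in_itv /= andbT => tx.
  rewrite powR_inv1 ?phi_ge0 ?subr_ge0// powR12_sqrt//.
  by rewrite divr_ge0 ?phi_ge0 ?subr_ge0 ?(le_trans t_ge0).
apply: measurable_powR_comp; apply: measurable_funM; last exact: measurable_powR_comp.
exact: measurable_funS (measurable_itv _) (halflineS t_ge0) phi_measurable.
Qed.

Let w_measurable : measurable_fun halfline w.
Proof.
apply: measurable_fun_if.
- exact: measurable_itv.
- exact: measurable_fun_ler.
- apply: measurable_funS (measurable_itv _) _ sqrt_ratio_measurable.
  by move=> x [_ /= tx]; rewrite in_itv /= tx.
- exact: measurable_cst.
Qed.

Lemma dual_weight_bounded : exists2 M : R, 0 <= M &
  {ae mu, forall x, 0 <= x -> Normc.normc (w x)%:C <= M}.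
Proof.
have F := ae_filter_ringOfSetsType mu.
have := phi_bounded t_ge0; have := @ess_sup_ge _ _ _ mu (fun x : R => `|phi_ phi t x|%:E).
case: ess_sup => [M||] h; [move=> _|by rewrite ltxx|move=> _].
  exists (`|M|) => //; apply: filterS h => x; rewrite lee_fin normc_real => h _.
  exact: le_trans h (ler_norm _).
(* An essential supremum equal to -oo would bound a real number by -oo almost everywhere, so any
   constant will do. *)
by exists 0 => //; apply: filterS h => x; rewrite leeNy_eq.
Qed.

(** The reciprocal of the infimum bounds the multiplier that inverts S_t^* S_t, which is how left
    invertibility enters. *)
Lemma phi_ratio_lower : exists2 c : R, 0 < c & forall x, 0 <= x -> phi x / phi (x + t) <= c.
Proof.
exists (inf [set phi (x + t) / phi x | x in [set` `[0%R, +oo[%R]])^-1.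
  by rewrite invr_gt0 phi_inf.
move=> x x0. have xt0 : 0 <= x + t by rewrite addr_ge0.
rewrite -[leLHS]invrK lef_pV2 ?posrE ?invr_gt0 ?divr_gt0 ?phi_gt0 ?phi_inf//.
rewrite invf_div; apply: ge_inf; last by exists x => //=; rewrite in_itv /= x0.
exists 0 => _ /= [y + <-]; rewrite in_itv /= andbT => y0.
by rewrite divr_ge0 ?phi_ge0// addr_ge0.
Qed.

Lemma weighted_translationE f : hl_eq (T f : L2 R) (fun x =>
  if t <= x then (Num.sqrt (phi x / phi (x - t)))%:C * (f : L2 R) (x - t) else 0).
Proof. exact: S_semigroup. Qed.

(** The adjoint is multiplication by the weight followed by a backward shift, both bounded; the
    adjoint relation is a change of variable in the integral. *)
Lemma weighted_translation_adjoint : exists Ts : 'B(L2 R),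
  (forall f g, inner (T f) g = inner f (Ts g)) /\
  forall f : L2 R, hl_eq (Ts f : L2 R)
    (fun x => (Num.sqrt (phi (x + t) / phi x))%:C * f (x + t)).
Proof.
have F := ae_filter_ringOfSetsType mu.
have [M M0 wM] := dual_weight_bounded.
have [W hW] := multiplication_operator (cmeasurable_real w_measurable) M0 wM.
have [V hV] := backward_shift t_ge0.
have hVW f : hl_eq (bop_comp V W f : L2 R)
    (fun x => (Num.sqrt (phi (x + t) / phi x))%:C * (f : L2 R) (x + t)).
  apply: filterS2 (hV (W f)) (ae_shift t (hW f)) => x h1 h2 x0.
  rewrite h1// h2 ?addr_ge0// /w /phi_ lerDr x0 addrK//.
exists (bop_comp V W); split=> // f g; rewrite /inner /= /L2_inner.
have mt : cmeasurable [set` `[t, +oo[]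
    (fun x => (Num.sqrt (phi x / phi (x - t)))%:C * (f : L2 R) (x - t) * ((g : L2 R) x)^*).
  apply: cmeasurableM.
    apply: cmeasurableM; first exact: cmeasurable_real sqrt_ratio_measurable.
    by apply: cmeasurable_unshift; exact: L2_cmeasurable.
  apply: cmeasurable_conj; apply: cmeasurableS (halflineS t_ge0) (L2_cmeasurable _).
  exact: measurable_itv.
transitivity (complex_integral (fun x => if t <= x then
    (Num.sqrt (phi x / phi (x - t)))%:C * (f : L2 R) (x - t) * ((g : L2 R) x)^* else 0)).
  apply: complex_integral_hl_eq.
  - by apply: cmeasurableM; [|apply: cmeasurable_conj]; exact: L2_cmeasurable.
  - apply: (@cmeasurable_if _ halfline _ (fun=> 0)) => //.
    + exact: measurable_fun_ler.
    + apply: cmeasurableS mt; first exact: measurable_itv.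
      by move=> x [_ /= tx]; rewrite in_itv /= tx.
  - apply: filterS (weighted_translationE f) => x h x0; rewrite h//; case: ifP => // _.
    by rewrite mul0r.
rewrite complex_integral_shift//; apply: complex_integral_hl_eq.
- exact: (cmeasurable_shift t_ge0 mt).
- by apply: cmeasurableM; [|apply: cmeasurable_conj]; exact: L2_cmeasurable.
- apply: filterS (hVW g) => x h x0; rewrite h// addrK rmorphM /= conj_real.
  by rewrite [RHS]mulrCA mulrA.
Qed.

(** T^* T multiplies by phi(x+t)/phi(x), with inverse N multiplying by the reciprocal. So the Cauchy
    dual T N is the weighted translation with symbol 1/phi, and L = N T^* has the kernel of T^*
    because N is injective. *)
Lemma cauchy_dual_weighted_translation :
  let Ld := cauchy_dual T in let L := adjoint Ld in
  [/\ forall f : L2 R, hl_eq (Ld f : L2 R) (fun x =>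
        if t <= x then (Num.sqrt ((phi x)^-1 / (phi (x - t))^-1))%:C * f (x - t) else 0),
      forall f : L2 R, hl_eq (L f : L2 R) (fun x =>
        (Num.sqrt (phi x / phi (x + t)))%:C * f (x + t)),
      forall f g, inner (L f) g = inner f (Ld g),
      forall f g, inner (T f) g = inner f (adjoint T g) &
      forall f, L f = 0 <-> adjoint T f = 0].
Proof.
have F := ae_filter_ringOfSetsType mu.
have [Ts [TsE hTs]] := weighted_translation_adjoint; have TsA := adjointE TsE.
have [c c0 hc] := phi_ratio_lower.
have [N hN] : exists N : 'B(L2 R), forall f : L2 R,
    hl_eq (N f : L2 R) (fun x => (phi x / phi (x + t))%:C * f x).
  apply: (@multiplication_operator _ (fun x => (phi x / phi (x + t))%:C) c).
  - exact: cmeasurable_real (ratio_measurable t_ge0).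
  - exact: ltW.
  - apply: nearW => x x0; rewrite normc_real ger0_norm ?hc//.
    by rewrite divr_ge0 ?phi_ge0 ?addr_ge0.
have hTT f : hl_eq (bop_comp (adjoint T) T f : L2 R)
    (fun x => (phi (x + t) / phi x)%:C * (f : L2 R) x).
  apply: filterS2 (hTs (T f)) (ae_shift t (weighted_translationE f)) => x h1 h2 x0.
  rewrite /= TsA h1// h2 ?addr_ge0// lerDr x0 addrK mulrA -rmorphM /= -expr2 sqr_sqrtr//.
  by rewrite divr_ge0 ?phi_ge0 ?addr_ge0.
have TTN : cancel (bop_comp (adjoint T) T) N.
  move=> f; apply: L2_ext; apply: filterS2 (hN (bop_comp (adjoint T) T f)) (hTT f) => x h1 h2 x0.
  rewrite h1// h2// mulrA -rmorphM /= mulrA divfK ?divff ?mul1r ?phi_neq0//.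
  exact: addr_ge0.
have NTT : cancel N (bop_comp (adjoint T) T).
  move=> f; apply: L2_ext; apply: filterS2 (hN f) (hTT (N f)) => x h1 h2 x0.
  rewrite h2// h1// mulrA -rmorphM /= mulrA divfK ?divff ?mul1r ?phi_neq0//.
  exact: addr_ge0.
have dE f : cauchy_dual T f = T (N f) by rewrite /= (bop_invE TTN NTT).
have NA f g : inner (N f) g = inner f (N g).
  rewrite /inner /= /L2_inner; apply: complex_integral_hl_eq.
  - by apply: cmeasurableM; [|apply: cmeasurable_conj]; exact: L2_cmeasurable.
  - by apply: cmeasurableM; [|apply: cmeasurable_conj]; exact: L2_cmeasurable.
  apply: filterS2 (hN f) (hN g) => x h1 h2 x0.
  by rewrite h1// h2// [in RHS]rmorphM /= conj_real [RHS]mulrCA mulrA.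
have LdE f g : inner (cauchy_dual T f) g = inner f (bop_comp N Ts g).
  by rewrite dE TsE NA.
have LE := adjointE LdE.
split.
- move=> f; rewrite dE; apply: filterS2 (weighted_translationE (N f)) (ae_shift (- t) (hN f)) => x h1 h2 x0.
  rewrite h1//; case: ifPn => // tx; rewrite h2 ?subr_ge0// subrK mulrA -rmorphM /=.
  congr (_%:C * _); have xt0 : 0 <= x - t by rewrite subr_ge0.
  have [p0 q0] := (phi_gt0 x0, phi_gt0 xt0).
  rewrite invrK [_^-1 * _]mulrC.
  have -> : phi (x - t) / phi x = (phi x / phi (x - t))^-1 by rewrite invf_div.
  have r0 : 0 <= phi x / phi (x - t) by rewrite divr_ge0 ?ltW.
  rewrite sqrtrV// -{2}[phi x / phi (x - t)]sqr_sqrtr// expr2 invfM mulrA divff ?mul1r//.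
  by rewrite gt_eqF// sqrtr_gt0 divr_gt0.
- move=> f; rewrite LE; apply: filterS2 (hN (Ts f)) (hTs f) => x h1 h2 x0.
  rewrite /= h1// h2// mulrA -rmorphM /=; congr (_%:C * _).
  have [p0 q0] := (phi_gt0 x0, phi_gt0 (addr_ge0 x0 t_ge0)).
  have -> : phi (x + t) / phi x = (phi x / phi (x + t))^-1 by rewrite invf_div.
  have r0 : 0 <= phi x / phi (x + t) by rewrite divr_ge0 ?ltW.
  rewrite sqrtrV// -{1}[phi x / phi (x + t)]sqr_sqrtr// expr2 mulfK//.
  by rewrite gt_eqF// sqrtr_gt0 divr_gt0.
- by move=> f g; rewrite [LHS]inner_conj LE -LdE -inner_conj.
- by move=> f g; rewrite TsA.
- move=> f; rewrite LE TsA /=; split=> [Nf|->]; last exact: linear0.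
  by rewrite -(NTT (Ts f)) Nf linear0.
Qed.

End WeightedTranslationOperators.

Lemma iter_linearZ (R : realType) (H : preHilbertType R) (A : 'B(H)) n (a : R[i]) (x : H) :
  iter n A (a *: x) = a *: iter n A x.
Proof. by elim: n => [//|n IH]; rewrite !iterS IH linearZ. Qed.

Lemma iter_linearB (R : realType) (H : preHilbertType R) (A : 'B(H)) n (x y : H) :
  iter n A (x - y) = iter n A x - iter n A y.
Proof. by elim: n => [//|n IH]; rewrite !iterS IH linearB. Qed.

(** * Powers of the weighted shifts on the blocks [nt, (n+1)t[ *)

Section WeightedShift.
Context {R : realType}.
Local Notation mu := (@lebesgue_measure R).
Local Notation halfline := ([set` `[0%R, +oo[%R] : set R).
Variables (phi : R -> R) (t : R) (T L Ld : 'B(L2 R)).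
Hypothesis phi_gt0 : forall x : R, 0 <= x -> 0 < phi x.
Hypothesis ratio_m : forall s, 0 <= s ->
  measurable_fun halfline (fun x => phi x / phi (x + s)).
Hypothesis t_gt0 : 0 < t.
Hypothesis TE : forall f : L2 R, hl_eq (T f : L2 R) (fun x =>
  if t <= x then (Num.sqrt (phi x / phi (x - t)))%:C * f (x - t) else 0).
Hypothesis LdE : forall f : L2 R, hl_eq (Ld f : L2 R) (fun x =>
  if t <= x then (Num.sqrt ((phi x)^-1 / (phi (x - t))^-1))%:C * f (x - t) else 0).
Hypothesis LE : forall f : L2 R, hl_eq (L f : L2 R) (fun x =>
  (Num.sqrt (phi x / phi (x + t)))%:C * f (x + t)).
Hypothesis Ladj : forall f g, inner (L f) g = inner f (Ld g).

Implicit Types (f g e : L2 R).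

Let t_ge0 : 0 <= t := ltW t_gt0.
Let nt_ge0 n : 0 <= n%:R * t. Proof. by rewrite mulr_ge0. Qed.
Let phi_ge0 x : 0 <= x -> 0 <= phi x. Proof. by move=> /phi_gt0/ltW. Qed.
Let phi_neq0 x : 0 <= x -> phi x != 0. Proof. by move=> /phi_gt0 h; rewrite gt_eqF. Qed.

Let ratio n x := phi x / phi (x + n%:R * t).

Let ratio_gt0 n x : 0 <= x -> 0 < ratio n x.
Proof. by move=> x0; rewrite divr_gt0 ?phi_gt0// addr_ge0. Qed.

Let ratio_ge0 n x : 0 <= x -> 0 <= ratio n x.
Proof. by move=> /(ratio_gt0 n)/ltW. Qed.

Lemma iter_shiftE n f : hl_eq (iter n T f : L2 R) (fun x => if n%:R * t <= x then
  (Num.sqrt (phi x / phi (x - n%:R * t)))%:C * f (x - n%:R * t) else 0).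
Proof. exact: (weighted_shift_iter n f t_ge0 phi_gt0 TE). Qed.

Lemma iter_dualE n f : hl_eq (iter n Ld f : L2 R) (fun x => if n%:R * t <= x then
  (Num.sqrt ((phi x)^-1 / (phi (x - n%:R * t))^-1))%:C * f (x - n%:R * t) else 0).
Proof.
apply: (@weighted_shift_iter _ (fun x => (phi x)^-1) t Ld n f t_ge0 _ LdE).
by move=> x x0; rewrite invr_gt0 phi_gt0.
Qed.

Lemma iter_backshiftE n f : hl_eq (iter n L f : L2 R) (fun x =>
  (Num.sqrt (ratio n x))%:C * f (x + n%:R * t)).
Proof. exact: (weighted_backshift_iter n f t_ge0 phi_gt0 LE). Qed.

Lemma iter_shift_backshift n f :
  hl_eq (iter n T (iter n L f) : L2 R) (fun x => if n%:R * t <= x then f x else 0).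
Proof.
have F := ae_filter_ringOfSetsType mu.
apply: filterS2 (iter_shiftE n (iter n L f)) (ae_shift (- (n%:R * t)) (iter_backshiftE n f)) => x h1 h2 x0.
rewrite h1//; case: ifPn => // ntx; have xt0 : 0 <= x - n%:R * t by rewrite subr_ge0.
rewrite h2// /ratio subrK mulrA -rmorphM /= -sqrtrM ?divr_ge0 ?phi_ge0//.
by rewrite mulrA divfK ?phi_neq0// divff ?phi_neq0// sqrtr1 mul1r.
Qed.

Lemma iter_backshift_dual j n e : (j <= n)%N ->
  hl_eq (iter j L (iter n Ld e) : L2 R) (fun x => if n%:R * t <= x + j%:R * t then
   (Num.sqrt (ratio j x) *
    Num.sqrt ((phi (x + j%:R * t))^-1 / (phi (x + j%:R * t - n%:R * t))^-1))%:C
     * e (x + j%:R * t - n%:R * t) else 0).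
Proof.
move=> jn; have F := ae_filter_ringOfSetsType mu.
apply: filterS2 (iter_backshiftE j (iter n Ld e)) (ae_shift (j%:R * t) (iter_dualE n e)) => x h1 h2 x0.
by rewrite h1// h2 ?addr_ge0//; case: ifP => _; rewrite ?mulr0// rmorphM /= mulrA.
Qed.

Lemma iter_backshift_dual_diag n e :
  hl_eq (iter n L (iter n Ld e) : L2 R) (fun x => (ratio n x)%:C * e x).
Proof.
have F := ae_filter_ringOfSetsType mu.
apply: filterS (iter_backshift_dual e (leqnn n)) => x h x0; rewrite h// lerDr x0 addrK.
congr (_%:C * _); rewrite invrK -sqrtrM ?ratio_ge0//.
by rewrite [X in _ * X]mulrC -/(ratio n x) -expr2 sqrtr_sqr ger0_norm// ratio_ge0.
Qed.

Lemma weighted_shiftK : cancel T L.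
Proof.
move=> f; have F := ae_filter_ringOfSetsType mu.
apply: L2_ext; apply: filterS2 (LE (T f)) (ae_shift t (TE f)) => x h1 h2 x0.
rewrite h1// h2 ?addr_ge0// lerDr x0 addrK mulrA -rmorphM /= -sqrtrM ?divr_ge0 ?phi_ge0 ?addr_ge0//.
by rewrite mulrA divfK ?phi_neq0 ?addr_ge0// divff ?phi_neq0// sqrtr1 mul1r.
Qed.

Variable P : 'B(L2 R).
Hypothesis PE : forall f, P f = f - T (L f).

Lemma proj_indicator f : hl_eq (P f : L2 R) (fun x => if t <= x then 0 else f x).
Proof.
have F := ae_filter_ringOfSetsType mu; rewrite PE.
have := iter_shift_backshift 1 f; rewrite /= mul1r => h.
apply: filterS2 (L2_sub f (T (L f))) h => x h1 h2 x0.
by rewrite h1// h2//; case: ifP => _; rewrite ?subrr ?subr0.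
Qed.

Lemma proj_fixed e : L e = 0 -> P e = e.
Proof. by move=> e0; rewrite PE e0 linear0 subr0. Qed.

Lemma backshift_proj f : L (P f) = 0.
Proof. by rewrite PE linearB /= weighted_shiftK subrr. Qed.

Lemma fixed_support e : P e = e -> {ae mu, forall x, 0 <= x -> t <= x -> (e : L2 R) x = 0}.
Proof.
have F := ae_filter_ringOfSetsType mu.
by move=> eE; apply: filterS (proj_indicator e) => x; rewrite eE => h x0 tx; rewrite h// tx.
Qed.

(** L^j Ld^n e lives on [(n-j)t, oo[, which misses [0, t[ when j < n. *)
Lemma proj_backshift_dual j n e : (j < n)%N -> P (iter j L (iter n Ld e)) = 0.
Proof.
move=> jn; have F := ae_filter_ringOfSetsType mu; apply: L2_ext.
apply: filterS3 (proj_indicator (iter j L (iter n Ld e))) (iter_backshift_dual e (ltnW jn))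
  (@L2_zero R) => x h1 h2 h3 x0.
rewrite h1// h3//; case: ifPn => //; rewrite -ltNge => xt; rewrite h2//; case: ifPn => // ntx.
have : n%:R * t < t + j%:R * t by rewrite (le_lt_trans ntx)// ltrD2r.
rewrite -[X in _ < X + _]mul1r -mulrDl ltr_pM2r// -(natrD _ 1) ltr_nat add1n.
by rewrite ltnS leqNgt jn.
Qed.

Lemma proj_backshift_dual_diag n e : L e = 0 ->
  P (iter n L (iter n Ld e)) = iter n L (iter n Ld e).
Proof.
move=> e0; have F := ae_filter_ringOfSetsType mu; apply: L2_ext.
apply: filterS3 (proj_indicator (iter n L (iter n Ld e))) (iter_backshift_dual_diag n e)
  (fixed_support (proj_fixed e0)) => x h1 h2 h3 x0.
by rewrite h1//; case: ifPn => // tx; rewrite h2// h3// mulr0.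
Qed.

(** The squared norm is the integral of |f|^2 over [nt, oo[; dominated convergence applies, as each
    x leaves these half lines once n > x/t. *)
Lemma iter_shift_backshift_tail f : (fun n => rnorm (iter n T (iter n L f))) @ \oo --> (0 : R).
Proof.
have F := ae_filter_ringOfSetsType mu.
pose h n (x : R) : \bar R := if n%:R * t <= x then (Normc.normc (f x) ^+ 2)%:E else 0%E.
have mf : measurable_fun halfline (fun x => (Normc.normc (f x) ^+ 2)%:E).
  by apply: cmeasurable_normc2; exact: L2_cmeasurable.
have mh n : measurable_fun halfline (h n).
  apply: measurable_fun_if => //.
  - exact: measurable_fun_ler.
  - exact: measurable_funS mf.
have sqE n : (rnorm (iter n T (iter n L f)) ^+ 2)%:E = (\int[mu]_(x in halfline) h n x)%E.
  rewrite L2_sqnorm; apply: (@ae_eq_integral _ _ _ mu halfline (h n)) => //.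
    by apply: cmeasurable_normc2; exact: L2_cmeasurable.
    exact: mh.
  apply: filterS (iter_shift_backshift n f) => x hx; rewrite /= in_itv /= andbT => x0.
  by rewrite hx// /h; case: ifP => // _; rewrite Normc.normc0 expr0n.
have if2 : mu.-integrable halfline (fun x => (Normc.normc (f x) ^+ 2)%:E).
  apply/integrableP; split=> //.
  under eq_integral do rewrite gee0_abs ?lee_fin ?sqr_ge0//.
  exact: L2_sqnorm_fin.
have h0 x : halfline x -> (fun n => h n x) @ \oo --> 0%E.
  rewrite /= in_itv /= andbT => x0; apply: cvg_near_cst.
  exists (Num.truncn (x / t)).+1 => // n /= xn; rewrite /h; case: ifPn => //.
  rewrite -ler_pdivlMr// leNgt => /negP[].
  have /andP[_ h1] := truncn_itv (divr_ge0 x0 t_ge0).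
  by rewrite (lt_le_trans h1)// ler_nat.
have [||_ _] := @dominated_convergence _ _ _ mu halfline (measurable_itv _) h (cst 0%E)
  (fun x => (Normc.normc (f x) ^+ 2)%:E) mh (measurable_cst _) _ if2 _.
- by apply: nearW => x; exact: h0.
- apply: nearW => x n _; rewrite /h; case: ifP => _; last by rewrite abse0 lee_fin sqr_ge0.
  by rewrite gee0_abs// lee_fin sqr_ge0.
rewrite integral_cst// mul0e => /fine_cvg c2; apply/cvgr0Pnorm_lt => e e0.
have /cvgr0Pnorm_lt/(_ _ (exprn_gt0 2 e0)) := c2; apply: filterS => n /=.
rewrite -sqE /= ger0_norm ?sqr_ge0// [in X in _ -> X]ger0_norm ?rnorm_ge0//.
by rewrite ltr_pXn2r ?nnegrE ?rnorm_ge0 ?ltW.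
Qed.

(** A difference of two consecutive tails. It turns the projections onto the subspaces T^n E into
    indicator functions, so that their self-adjointness, idempotence, orthogonality and completeness
    become pointwise facts. *)
Lemma block_indicator n f : hl_eq (iter n T (P (iter n L f)) : L2 R)
  (fun x => if (n%:R * t <= x) && (x < n.+1%:R * t) then f x else 0).
Proof.
have F := ae_filter_ringOfSetsType mu.
rewrite PE iter_linearB -!iterS -iterSr.
apply: filterS3 (L2_sub (iter n T (iter n L f)) (iter n.+1 T (iter n.+1 L f)))
  (iter_shift_backshift n f) (iter_shift_backshift n.+1 f) => x h1 h2 h3 x0.
rewrite h1// h2// h3//; case: ltP => h; rewrite ?andbT ?andbF ?subr0//.
by rewrite (le_trans _ h) ?subrr// ler_pM2r// ler_nat.
Qed.

Lemma block_adjoint n f g :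
  inner (iter n T (P (iter n L f))) g = inner f (iter n T (P (iter n L g))).
Proof.
have F := ae_filter_ringOfSetsType mu.
rewrite /inner /= /L2_inner; apply: complex_integral_hl_eq.
- by apply: cmeasurableM; [|apply: cmeasurable_conj]; exact: L2_cmeasurable.
- by apply: cmeasurableM; [|apply: cmeasurable_conj]; exact: L2_cmeasurable.
apply: filterS2 (block_indicator n f) (block_indicator n g) => x h1 h2 x0.
by rewrite h1// h2//; case: ifP => _//; rewrite rmorph0 mul0r mulr0.
Qed.

Lemma block_separating f : (forall n, iter n T (P (iter n L f)) = 0) -> f = 0.
Proof.
have F := ae_filter_ringOfSetsType mu.
move=> h; apply: L2_ext.
apply: filterS2 (ae_foralln (fun n => block_indicator n f)) (@L2_zero R) => x h1 h2 x0.
have /andP[a b] := truncn_itv (divr_ge0 x0 t_ge0).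
have := h1 (Num.truncn (x / t)) x0; rewrite h h2//.
by rewrite -ler_pdivlMr// a -ltr_pdivrMr// b.
Qed.

Lemma block_orthogonal n m f : n != m ->
  iter n T (P (iter n L (iter m T (P (iter m L f))))) = 0.
Proof.
have F := ae_filter_ringOfSetsType mu.
move=> nm; apply: L2_ext.
apply: filterS3 (block_indicator n (iter m T (P (iter m L f)))) (block_indicator m f)
  (@L2_zero R) => x h1 h2 h3 x0.
rewrite h1// h3//; case: ifP => // /andP[a b]; rewrite h2//; case: ifP => // /andP[c d].
have := le_lt_trans a d; have := le_lt_trans c b.
by rewrite !ltr_pM2r// !ltr_nat !ltnS => mn nm'; move: nm; rewrite eqn_leq mn nm'.
Qed.

Lemma block_idempotent n f :
  iter n T (P (iter n L (iter n T (P (iter n L f))))) = iter n T (P (iter n L f)).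
Proof.
have F := ae_filter_ringOfSetsType mu; apply: L2_ext.
apply: filterS2 (block_indicator n (iter n T (P (iter n L f)))) (block_indicator n f)
  => x h1 h2 x0.
by rewrite h1// h2//; case: (_ && _).
Qed.

Lemma indicator_L2 (A : set (measurableTypeR R)) :
  measurable A -> A `<=` [set` `[0, t[] ->
  exists e : L2 R, hl_eq e (fun x => (\1_A x)%:C).
Proof.
move=> mA At; apply: L2_of_fun.
  exact: (cmeasurable_real (@measurable_indic _ (measurableTypeR R) R halfline A mA)).
apply: (@le_lt_trans _ _ (mu A)).
  rewrite /sqnorm (eq_integral (fun x => (\1_A x)%:E)); last first.
    move=> x _; rewrite normc_real ger0_norm// indicE.
    by case: (x \in A); rewrite ?expr1n ?expr0n.
  rewrite integral_indic//.
  by apply: le_measure; [rewrite inE; apply: measurableI => //; exact: measurable_itv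
    |rewrite inE|exact: subIsetl].
apply: (@le_lt_trans _ _ (mu [set` `[0, t[])).
  by apply: le_measure; rewrite ?inE//; exact: measurable_itv.
by rewrite lebesgue_measure_itv /= lte_fin t_gt0 -EFinB ltry.
Qed.

Lemma indicator_proj (A : set (measurableTypeR R)) e : A `<=` [set` `[0, t[] ->
  hl_eq e (fun x => (\1_A x)%:C) -> L e = 0.
Proof.
move=> At eA; have F := ae_filter_ringOfSetsType mu.
have <- : P e = e; last exact: backshift_proj.
apply: L2_ext; apply: filterS2 (proj_indicator e) eA => x h1 h2 x0.
rewrite h1//; case: ifPn => // tx; rewrite h2// indicE memNset// => /At /=.
by rewrite in_itv /= x0 ltNge tx.
Qed.

Lemma dual_bound z B : is_resolvent L z B -> z != 0 ->
  exists2 C : R, 0 < C & forall n e, L e = 0 ->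
    rnorm (iter n Ld e) <= C * (Normc.normc z)^-1 ^+ n * rnorm e /\
    rnorm (iter n L (iter n Ld e)) <= (C * (Normc.normc z)^-1 ^+ n) ^+ 2 * rnorm e.
Proof.
move=> hB z0; have [C C0 h] := @iter_dual_bound _ _ L P Ld Ladj z B hB z0.
exists C => // n e e0; apply: h.
- by move=> j; exact: proj_backshift_dual.
- exact: proj_backshift_dual_diag.
- by rewrite -(proj_backshift_dual_diag n e0) backshift_proj.
Qed.

Lemma ratio_bound_ae z B : is_resolvent L z B -> z != 0 ->
  exists2 C : R, 0 < C & {ae mu, forall x, 0 <= x -> x < t ->
    forall n, ratio n x <= C * ((Normc.normc z)^-1 ^+ 2) ^+ n}.
Proof.
move=> hB z0; have F := ae_filter_ringOfSetsType mu.
have [C C0 hC] := dual_bound hB z0.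
have q0 : 0 < (Normc.normc z)^-1.
  by rewrite invr_gt0 lt_def normc_ge0 andbT; apply: contra_neq z0; exact: Normc.eq0_normc.
(* The factor 2 leaves room for a contradiction: a test vector supported where the bound fails
   satisfies |e| <= |e|/2. *)
exists (2 * C ^+ 2); first by rewrite mulr_gt0// exprn_gt0.
suff : forall n, {ae mu, forall x, 0 <= x -> x < t ->
    ratio n x <= 2 * C ^+ 2 * ((Normc.normc z)^-1 ^+ 2) ^+ n}.
  by move=> /ae_foralln; apply: filterS => x h x0 xt n; exact: h.
move=> n; set K := (C * (Normc.normc z)^-1 ^+ n) ^+ 2.
have KE : 2 * C ^+ 2 * ((Normc.normc z)^-1 ^+ 2) ^+ n = 2 * K.
  by rewrite /K exprAC [in RHS]exprMn [RHS]mulrA.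
have K0 : 0 < K by rewrite exprn_gt0// mulr_gt0// exprn_gt0.
rewrite KE.
pose A : set (measurableTypeR R) := [set` `[0, t[] `&` [set x | 2 * K <= ratio n x].
have mA : measurable A.
  apply: measurable_fun_le => //.
  apply: (measurable_funS (measurable_itv `[0, +oo[)); last exact: (ratio_m (nt_ge0 n)).
  by move=> x /=; rewrite !in_itv /= andbT => /andP[].
have At : A `<=` [set` `[0, t[] by exact: subIsetl.
(* On [A] the function [L^n Ld^n e = ratio n * e] is at least [2 K e]. *)
have [e eA] := indicator_L2 mA At; have e0 := indicator_proj At eA.
have [_ he] := hC n e e0.
have e_le : rnorm e <= (2 * K)^-1 * rnorm (iter n L (iter n Ld e)).
  apply: (L2_rnorm_le _ eA); first by rewrite invr_ge0 mulr_ge0// ltW.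
  apply: filterS2 eA (iter_backshift_dual_diag n e) => x h1 h2 x0.
  rewrite h2// h1// Normc.normcM !normc_real indicE; case: (boolP (x \in A)) => xA.
    rewrite !normr1 mulr1 [leRHS]mulrC ler_pdivlMr; last exact: mulr_gt0.
    rewrite mul1r.
    by move: xA; rewrite inE => -[_ /= h]; rewrite ger0_norm// ratio_ge0.
  by rewrite !normr0 !mulr0.
have re0 : e = 0.
  apply: rnorm0_eq0; apply/eqP; rewrite eq_le rnorm_ge0 andbT.
  have : rnorm e <= 2^-1 * rnorm e.
    rewrite (le_trans e_le)// invfM -mulrA ler_wpM2l ?invr_ge0//.
    by rewrite mulrC ler_pdivrMr// mulrC.
  by have := rnorm_ge0 e; lra.
apply: filterS2 eA (@L2_zero R) => x h1 h2 x0 xt; rewrite leNgt; apply/negP => h.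
have : (e : L2 R) x = 1.
  by rewrite h1// indicE mem_set// /A /=; split; [rewrite in_itv /= x0|exact: ltW].
by rewrite re0 h2// => /eqP; rewrite eq_sym oner_eq0.
Qed.

(** For x in block m, ratio n x is phi(x)/phi(x - mt) times ratio (m + n) (x - mt), so the bound on
    [0, t[ propagates with a constant depending on x. On [0, t[ the constant stays uniform, which is
    what operator bounds require. *)
Lemma ratio_bound z B : is_resolvent L z B -> z != 0 ->
  exists2 C : R, 0 < C & {ae mu, forall x, 0 <= x ->
    exists c, [/\ 0 <= c, x < t -> c = C &
      forall n, ratio n x <= c * ((Normc.normc z)^-1 ^+ 2) ^+ n]}.
Proof.
move=> hB z0; have F := ae_filter_ringOfSetsType mu.
have [C C0 hC] := ratio_bound_ae hB z0; exists C => //.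
have := ae_foralln (fun m => ae_shift (- (m%:R * t)) hC); apply: filterS => x h x0.
have [xt|tx] := ltP x t.
  by exists C; split=> //; [exact: ltW|move=> n; have := h 0%N; rewrite mul0r subr0; apply].
set q := (Normc.normc z)^-1 ^+ 2; set m := Num.truncn (x / t).
have /andP[h1 h2] := truncn_itv (divr_ge0 x0 t_ge0).
have y0 : 0 <= x - m%:R * t by rewrite subr_ge0 -ler_pdivlMr.
have yt : x - m%:R * t < t.
  by rewrite ltrBlDr -[X in _ < X + _]mul1r -mulrDl -ltr_pdivrMr// -(natrD _ 1) add1n.
exists (phi x / phi (x - m%:R * t) * (C * q ^+ m)); split.
- by rewrite !mulr_ge0 ?exprn_ge0 ?invr_ge0 ?normc_ge0 ?phi_ge0// ltW.
- by [].
move=> n; have := h m y0 yt (m + n)%N; rewrite -/q exprD => hmn.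
have -> : ratio n x = phi x / phi (x - m%:R * t) * ratio (m + n) (x - m%:R * t).
  rewrite /ratio mulrA divfK ?phi_neq0//; congr (_ / phi _).
  by rewrite natrD mulrDl addrA subrK.
by rewrite -[leRHS]mulrA -[C * _ * _]mulrA ler_wpM2l// divr_ge0 ?phi_ge0.
Qed.

(* Otherwise the disc of radius [0^-1 = 0] of the theorem would be empty. *)
Lemma spectral_radius_gt0 : 0 < spectral_radius L.
Proof.
rewrite ltNge; apply/negP => r0; have F := ae_filter_ringOfSetsType mu.
have [M [M0 TM]] := bop_rbounded T.
(* If the radius were not positive, the resolvent at 1/s would give |Ld^n e| <= C s^n |e|. As |e|^2
   = <T^n e, Ld^n e> and |T^n e| <= M^n |e|, this [s] yields |e|^2 <= C 2^-n |e|^2, so the indicator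
   of [0, t[ would be null. *)
pose s : R := (2 * M)^-1.
have s0 : 0 < s by rewrite invr_gt0 mulr_gt0.
have sC0 : s%:C != 0 :> R[i] by apply/negP => /eqP/complexI s0'; rewrite s0' ltxx in s0.
have ns : Normc.normc (s%:C : R[i]) = s by rewrite normc_real gtr0_norm.
have [|B hB] := @resolvent_inv _ _ L s%:C _ sC0; first by rewrite ns (le_lt_trans r0).
have [C C0 hC] := dual_bound hB (invr_neq0 sC0).
rewrite Normc.normcV invrK ns in hC.
have [e eA] := indicator_L2 (measurable_itv `[0, t[) (@subset_refl _ _).
have e0 := indicator_proj (@subset_refl _ _) eA.
have itT n f : rnorm (iter n T f) <= M ^+ n * rnorm f.
  elim: n => [|n IH]; first by rewrite expr0 mul1r.
  by rewrite iterS (le_trans (TM _))// exprS -mulrA ler_wpM2l// ltW.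
have itLT n f : iter n L (iter n T f) = f.
  by elim: n => [//|n IH]; rewrite iterSr iterS weighted_shiftK.
have le n : rnorm e ^+ 2 <= C * rnorm e ^+ 2 * 2^-1 ^+ n.
  have e2 : rnorm e ^+ 2 = Normc.normc (inner (iter n T e) (iter n Ld e)).
    by rewrite -(inner_iter Ladj) itLT inner_rnorm normc_real ger0_norm ?sqr_ge0.
  rewrite [leLHS]e2 (le_trans (cauchy_schwarz _ _))//.
  have [h1 _] := hC n e e0.
  rewrite (le_trans (ler_pM (rnorm_ge0 _) (rnorm_ge0 _) (itT n e) h1))//.
  rewrite le_eqVlt; apply/orP; left; apply/eqP.
  have -> : (2^-1 : R) ^+ n = M ^+ n * s ^+ n.
    by rewrite -exprMn /s invfM mulrCA mulfV ?mulr1// gt_eqF.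
  by ring.
have q01 : 0 <= (2^-1 : R) < 1 by rewrite invr_ge0 ler0n /= invf_lt1// ltr1n.
have : rnorm e ^+ 2 <= 0 by exact: (le_cvg0 (cvg0_geometric _ q01) le).
move=> re; have {}re : e = 0.
  by apply: rnorm0_eq0; apply/eqP; rewrite -sqrf_eq0 eq_le re sqr_ge0.
have : mu [set` `[0, t[] = 0%E.
  apply/negligibleP; first exact: measurable_itv.
  rewrite /negligible; have := filterI eA (@L2_zero R).
  move=> [N [mN N0 hN]]; exists N; split=> // x; rewrite /= in_itv /= => /andP[x0 xt].
  apply: hN => /= -[/(_ x0) h1 /(_ x0) h2]; move: h1; rewrite re h2 indicE mem_set /=.
    by move=> /eqP; rewrite eq_sym oner_eq0.
  by rewrite in_itv /= x0.
rewrite lebesgue_measure_itv /= lte_fin t_gt0 -EFinB subr0 => -[] t0.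
by move: t_gt0; rewrite t0 ltxx.
Qed.

(** Multiplying by the indicator of the complement of a measurable null set makes the sequence
    converge at every point of the half line. *)
Lemma cmeasurable_ae_cvg (f_ : nat -> R -> R[i]) :
  (forall n, cmeasurable halfline (f_ n)) ->
  {ae mu, forall x, 0 <= x -> cvgn (f_^~ x)} ->
  exists2 g, cmeasurable halfline g &
    {ae mu, forall x, 0 <= x -> f_^~ x @ \oo --> g x}.
Proof.
move=> mf [N [mN N0 hN]].
pose g_ n x := (\1_(~` N) x)%:C * f_ n x.
have mg n : cmeasurable halfline (g_ n).
  apply: cmeasurableM => //; apply: cmeasurable_real.
  by apply: measurable_indic; exact: measurableC.
have gN x : ~ N x -> g_^~ x = f_^~ x.
  by move=> Nx; apply/funext => n; rewrite /g_ indicE mem_set// mul1r.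
have /choice[g hg] : forall x, exists l : R[i], 0 <= x -> g_^~ x @ \oo --> l.
  move=> x; have [Nx|Nx] := pselect (N x).
    exists 0 => _; rewrite (_ : g_^~ x = cst 0); first exact: cvg_cst.
    by apply/funext => n; rewrite /g_ indicE memNset ?mul0r//=; exact.
  have [x0|x0] := boolP (0 <= x); last by exists 0.
  have /cvg_ex[l hl] : cvgn (f_^~ x).
    by apply: contrapT => ncv; apply: Nx; apply: hN => /= /(_ x0).
  by exists l; rewrite gN.
exists g.
  by apply: cmeasurable_cvg mg _ => x /=; rewrite in_itv /= andbT; exact: hg.
exists N; split; [exact: mN|exact: N0|move=> x nh; apply: contrapT => Nx; apply: nh => x0].
by rewrite -gN//; exact: hg.
Qed.

(** A resolvent at a point [w] of larger modulus bounds the ratios by a multiple of |w|^(-2n), so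
    the diagonal series is dominated by a geometric one of ratio |z| |lambda| / |w|^2 < 1. The last
    clause expresses [K e] as a norm limit, the form in which it meets the kernel vector. *)
Lemma kernel_multiplier w B z lambda : is_resolvent L w B -> w != 0 ->
  Normc.normc z < Normc.normc w -> Normc.normc lambda < Normc.normc w ->
  let s x := series (fun n => (ratio n x)%:C * z ^+ n * lambda^* ^+ n) in
  exists K : 'B(L2 R),
  [/\ forall e : L2 R, L e = 0 -> {ae mu, forall x, 0 <= x ->
        cvgn (s x) /\ (K e : L2 R) x = limn (s x) * e x},
      forall e : L2 R, L e = 0 -> L (K e) = 0 &
      forall e : L2 R, L e = 0 ->
        (fun N => \sum_(n < N) (lambda^* ^+ n * z ^+ n) *: iter n L (iter n Ld e)) @ \oo
          --> K e].
Proof.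
move=> hB w0 zw lw s; have F := ae_filter_ringOfSetsType mu.
have [C C0 hC] := ratio_bound hB w0.
have nw0 : 0 < Normc.normc w by exact: le_lt_trans (normc_ge0 z) zw.
pose q := Normc.normc z * Normc.normc lambda * (Normc.normc w)^-1 ^+ 2.
have q01 : 0 <= q < 1.
  rewrite !mulr_ge0 ?normc_ge0 ?invr_ge0 ?normc_ge0//= /q exprVn ltr_pdivrMr ?exprn_gt0//.
  by rewrite mul1r expr2 ltr_pM ?normc_ge0.
have step x c : 0 <= x ->
    (forall n, ratio n x <= c * ((Normc.normc w)^-1 ^+ 2) ^+ n) ->
    forall n, rnorm (s x n.+1 - s x n) <= c * q ^+ n.
  move=> x0 hc n; rewrite /s /series /= big_nat_recr //= addrAC subrr add0r.
  rewrite rnorm_normc !Normc.normcM !normcX normc_conj normc_real ger0_norm ?ratio_ge0//.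
  rewrite -mulrA -exprMn /q [in leRHS]exprMn [leRHS]mulrCA [leRHS]mulrC.
  by rewrite ler_wpM2r ?exprn_ge0 ?mulr_ge0 ?normc_ge0.
have s_cvg : {ae mu, forall x, 0 <= x -> cvgn (s x)}.
  apply: filterS hC => x hx x0; have [c [_ _ hc]] := hx x0.
  by apply/cvg_ex; exact: (complex_geometric_complete q01 (step x c x0 hc)).
have ms n : cmeasurable halfline (fun x => s x n).
  rewrite /s /series /=; elim: n => [|n IH].
    by under [X in cmeasurable _ X]eq_fun do rewrite big_geq//; exact: cmeasurable_cst.
  under [X in cmeasurable _ X]eq_fun do rewrite big_nat_recr//=.
  apply: cmeasurableD => //; apply: cmeasurableM; last exact: cmeasurable_cst.
  apply: cmeasurableM; last exact: cmeasurable_cst.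
  exact: cmeasurable_real (ratio_m (nt_ge0 n)).
have [g mg hg] := cmeasurable_ae_cvg (f_ := fun n x => s x n) ms s_cvg.
(* The sum of the series is bounded uniformly only on [0, t[; truncating there does not change the
   action on E. *)
pose m x := if x < t then g x else 0.
have mm : cmeasurable halfline m.
  apply: (@cmeasurable_if _ halfline g (fun=> 0)) => //.
  - exact: measurable_fun_ltr.
  - by apply: cmeasurableS mg => //; exact: subIsetl.
(* The case N = 0 bounds the multiplier; general N gives the rate of convergence in norm. *)
have mbound N : {ae mu, forall x, 0 <= x -> x < t ->
    Normc.normc (g x - s x N) <= C * q ^+ N / (1 - q)}.
  apply: filterS2 hC hg => x hx hgx x0 xt; have [c [_ cC hc]] := hx x0.
  have := geometric_limit q01 (step x c x0 hc) (hgx x0) N.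
  by rewrite rnorm_normc cC.
have Cq0 N : 0 <= C * q ^+ N / (1 - q).
  case/andP: q01 => q0 q1.
  by rewrite divr_ge0 ?mulr_ge0 ?exprn_ge0 ?subr_ge0// ltW.
have [K hK] : exists K : 'B(L2 R), forall f : L2 R, hl_eq (K f : L2 R) (fun x => m x * f x).
  apply: (@multiplication_operator _ m _ mm (Cq0 0%N)).
  apply: filterS (mbound 0%N) => x hx x0; rewrite /m; case: ifPn => xt.
    by have := hx x0 xt; rewrite /s /series /= big_geq// subr0.
  by rewrite Normc.normc0.
exists K; split=> e e0; have eS := fixed_support (proj_fixed e0).
- apply: filterS3 (filterI (hK e) eS) s_cvg hg => x [h1 h2] h3 h4 x0; split; first exact: h3.
  rewrite h1// /m; case: ifPn => xt; last by rewrite h2 ?mulr0// leNgt.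
  by congr (_ * _); apply/esym; apply: cvg_lim => //; exact: h4.
- have <- : P (K e) = K e; last exact: backshift_proj.
  apply: L2_ext; apply: filterS2 (proj_indicator (K e)) (hK e) => x h1 h2 x0.
  by rewrite h1// h2// /m; case: ltP; rewrite ?mul0r.
pose u N := \sum_(n < N) (lambda^* ^+ n * z ^+ n) *: iter n L (iter n Ld e).
apply: (@rnorm_squeeze _ _ _ _ (fun N => (C / (1 - q) * rnorm e) * q ^+ N)); last exact: cvg0_geometric.
move=> N; rewrite -/(u N).
have -> : C / (1 - q) * rnorm e * q ^+ N = C * q ^+ N / (1 - q) * rnorm e by ring.
have uE : hl_eq (K e - u N : L2 R) (fun x => if x < t then (g x - s x N) * e x else 0).
  have h1 := L2_sub (K e) (u N).
  have h2 := L2_sum (fun n : 'I_N => (lambda^* ^+ n * z ^+ n) *: iter n L (iter n Ld e)).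
  have h3 := ae_foralln (fun n => L2_scl (lambda^* ^+ n * z ^+ n) (iter n L (iter n Ld e))).
  have h4 := ae_foralln (fun n => iter_backshift_dual_diag n e).
  apply: filterS3 (filterI h1 h2) (filterI h3 h4) (filterI (hK e) eS) => x [a1 a2] [a3 a4] [a5 a6] x0.
  rewrite a1// a5// /u a2//.
  rewrite (eq_bigr (fun n : 'I_N => (ratio n x)%:C * z ^+ n * lambda^* ^+ n * e x)); last first.
    by move=> n _; rewrite a3// a4//; ring.
  rewrite -mulr_suml /m /s /series /= big_mkord; case: ltP => xt; first by rewrite mulrBl.
  by rewrite mul0r a6// mulr0 subr0.
apply: (L2_rnorm_le _ uE) => //; apply: filterS (mbound N) => x hx x0.
case: ifPn => xt; last by rewrite Normc.normc0 mulr_ge0 ?normc_ge0.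
by rewrite Normc.normcM ler_wpM2r ?normc_ge0// hx.
Qed.

End WeightedShift.

(** * The model space *)

Section KernelSpace.
Context {R : realType} {H : hilbertType R} (A : 'B(H)).
Local Notation E := (ker_space A).

Lemma ker_inner (x y : E) : inner x y = inner (val x) (val y).
Proof. by []. Qed.

Lemma ker_rnorm (x : E) : rnorm x = rnorm (val x).
Proof.
apply/eqP; rewrite -(@eqrXn2 _ 2) ?rnorm_ge0//; apply/eqP/complexI.
by rewrite -!inner_rnorm.
Qed.

Lemma ker_cvg (u : nat -> E) (l : E) :
  (fun n => val (u n)) @ \oo --> val l -> u @ \oo --> l.
Proof.
move=> /cvg_rnormP h; apply/cvg_rnormP.
rewrite (_ : (fun n => _) = fun n => rnorm (val l - val (u n)))//.
by apply/funext => n; rewrite ker_rnorm linearB.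
Qed.

Lemma ker_val_linear (a : R[i]) (x y : E) : val (a *: x + y) = a *: val x + val y.
Proof. exact: linearP. Qed.

Lemma ker_valZ (a : R[i]) (e : E) : val (a *: e) = a *: val e.
Proof. exact: linearZ. Qed.

Lemma ker_valP (e : E) : A (val e) = 0.
Proof. by apply/eqP; exact: (valP e). Qed.

Lemma ker_lift (f : H) : A f = 0 -> exists e : E, val e = f.
Proof.
move=> f0; have fk : f \in ker_pred A by rewrite unfold_in f0.
by exists (KerSpace fk).
Qed.

End KernelSpace.

(** * The map f |-> P (1 - z L)^-1 f into E-valued functions *)

Section Model.
Context {R : realType} {H : hilbertType R}.
Variables (T L P A : 'B(H)).
Hypothesis PE : forall x, P x = x - T (L x).
Hypothesis TK : cancel T L.
Hypothesis kerE : forall f, L f = 0 <-> A f = 0.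
Variables (D : set R[i]) (B : D -> 'B(H)).
Hypothesis BE : forall z : D, is_resolvent L (val z) (B z).
Local Notation E := (ker_space A).

Lemma ker_backshift (e : E) : L (val e) = 0.
Proof. by apply/kerE; exact: ker_valP. Qed.

Lemma proj_ker (e : E) : P (val e) = val e.
Proof. by rewrite PE ker_backshift linear0 subr0. Qed.

Lemma model_exists : exists ev : {linear H -> (D -> E)},
  forall f z, val (ev f z) = P (B z f).
Proof.
have /choice[ev hev] : forall f : H, exists g : D -> E, forall z, val (g z) = P (B z f).
  move=> f; have /choice[g hg] : forall z : D, exists e : E, val e = P (B z f).
    by move=> z; apply: ker_lift; apply/kerE; rewrite PE linearB /= TK subrr.
  by exists g.
have evlin : forall a f g, ev (a *: f + g) = a *: ev f + ev g.
  move=> a f g; apply/funext => z; apply: val_inj.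
  by rewrite hev !linearP /= !hev.
pose m := GRing.isLinear.Build R[i] H (D -> E) _ ev evlin.
pose F : {linear H -> (D -> E)} := HB.pack ev m.
by exists F.
Qed.

Variable ev : {linear H -> (D -> E)}.
Hypothesis evE : forall f z, val (ev f z) = P (B z f).

Lemma model_bounded (z : D) : exists M : R, forall g : H, `|ev g z| <= M%:C * `|g|.
Proof.
have [p [p0 pP]] := bop_rbounded P; have [b [b0 bB]] := bop_rbounded (B z).
exists (p * b) => g; rewrite !rnormE -rmorphM lecR ker_rnorm evE.
by rewrite (le_trans (pP _))// -mulrA ler_wpM2l// ltW.
Qed.

Lemma model_analytic (f : H) : analytic (ev f).
Proof.
move=> z0; have [rho rho0 h] := resolvent_analytic P f (BE z0).
have /choice[a ha] : forall n, exists e : E,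
    val e = P (iter n (fun x => L (B z0 x)) (B z0 f)).
  by move=> n; apply: ker_lift; apply/kerE; rewrite PE linearB /= TK subrr.
exists rho, a; split=> // z zz0; apply: ker_cvg; rewrite evE.
set u := (X in X @ _ --> _).
have -> : u = series (fun n =>
    (val z - val z0) ^+ n *: P (iter n (fun x => L (B z0 x)) (B z0 f))).
  apply/funext => n; rewrite /u /series; apply: etrans (raddf_sum val _ _ _) _.
  apply: eq_bigr => k _; apply: etrans (ker_valZ _ _) _; congr (_ *: _); exact: ha.
by apply: (h _ _ (BE z)); rewrite -ltcR.
Qed.

Lemma model_shift (f : H) (z : D) : ev (T f) z = val z *: ev f z.
Proof.
by apply: val_inj; rewrite evE linearZ /= evE (proj_resolvent_shift PE TK f (BE z)).
Qed.

Lemma model_cst (e : E) : ev (val e) = cst e.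
Proof.
apply/funext => z; apply: val_inj; rewrite evE.
by rewrite (proj_resolvent _ _ (BE z)) ker_backshift !linear0 ?scaler0 addr0 proj_ker.
Qed.

Lemma model_iter_shift n (e : E) (z : D) : ev (iter n T (val e)) z = val z ^+ n *: e.
Proof.
elim: n => [|n IH]; first by rewrite expr0 scale1r /= model_cst.
by rewrite iterS model_shift IH scalerA exprS.
Qed.

Lemma model_polynomial (N : nat) (e : nat -> E) (z : D) :
  ev (\sum_(n < N) iter n T (val (e n))) z = \sum_(n < N) val z ^+ n *: e n.
Proof.
rewrite linear_sum; elim: N => [|N IH]; first by rewrite !big_ord0.
by rewrite !big_ord_recr /= -IH -model_iter_shift.
Qed.

Lemma shift_block_sum N (f : H) :
  \sum_(n < N) iter n T (P (iter n L f)) = f - iter N T (iter N L f).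
Proof.
elim: N => [|N IH]; first by rewrite big_ord0 subrr.
rewrite big_ord_recr /= IH PE iter_linearB -iterSr.
by rewrite addrA subrK.
Qed.

Lemma proj_lift (f : H) : exists e : E, val e = P f.
Proof. by apply: ker_lift; apply/kerE; rewrite PE linearB /= TK subrr. Qed.

Lemma block_polynomial n (f : H) : is_polynomial (ev (iter n T (P f))).
Proof.
have [e he] := proj_lift f.
exists n, (fun k => if k == n then e else 0) => z.
rewrite -he model_iter_shift big_ord_recr /= eqxx big1 ?add0r// => k _.
by rewrite ltn_eqF ?scaler0.
Qed.

Hypothesis tail : forall f, (fun n => rnorm (iter n T (iter n L f))) @ \oo --> (0 : R).

Lemma model_injective (delta : R) : 0 < delta ->
  (forall z, Normc.normc z < delta -> D z) -> injective ev.
Proof.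
move=> d0 hD f g fg; apply/eqP; rewrite -subr_eq0; apply/eqP.
apply: (resolvent_injective PE d0 _ (tail _)) => z /hD Dz.
have [z' zz'] : exists z' : D, val z' = z by exists (SigSub (mem_set Dz)).
by exists (B z'); rewrite -?zz'// -evE linearB fg subrr linear0.
Qed.

Lemma model_polynomials_dense : dense [set g : H | is_polynomial (ev g)].
Proof.
move=> Q [f Qf] oQ.
have cv : (fun N => f - iter N T (iter N L f)) @ \oo --> f.
  apply/cvg_rnormP; rewrite (_ : (fun n => _) = fun n => rnorm (iter n T (iter n L f))) //.
  by apply/funext => n; rewrite opprB addrC subrK.
have [N _ hN] := cv Q (open_nbhs_nbhs (conj oQ Qf)).
(* [is_polynomial] with parameter [N] has N+1 coefficients, hence the shift of the index. *)
exists (f - iter N.+1 T (iter N.+1 L f)); split; first exact: (hN N.+1 (leqnSn N)).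
have /choice[e he] := fun n => proj_lift (iter n L f).
exists N, e => z; rewrite -model_polynomial -shift_block_sum; congr (ev _ z).
by apply: eq_bigr => n _; rewrite he.
Qed.

End Model.

(** * Kernel, polynomials and basis on the realized space *)

Theorem theorem3p7 (R : realType) (phi : R -> R)
  (phi_gt0 : forall x : R, 0 <= x -> 0 < phi x)
  (phi_continuous : {within [set` `[0%R, +oo[%R], continuous phi})
  (phi_bounded : forall t : R, 0 <= t ->
    (ess_sup (@lebesgue_measure R) (fun x : R => `|phi_ phi t x|%:E) < +oo)%E)
  (S : R -> 'B(L2 R))
  (S_semigroup : weighted_translation_semigroup phi S)
  (phi_inf : forall t : R, 0 <= t ->
    0 < inf [set phi (x + t) / phi x | x in [set` `[0%R, +oo[%R]])
  (t : R) (t_gt0 : 0 < t) :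
  let L : 'B(L2 R) := adjoint (cauchy_dual (S t)) in
  let E : preHilbertType R := ker_space (adjoint (S t)) in
  let D : set R[i] := [set z | `|z| < ((spectral_radius L)^-1)%:C] in
  exists (H : rkhs E D) (U : {linear L2 R -> H}) (M_z : 'B(H))
         (k : D -> D -> 'B(E)),
    [/\ forall g : H, analytic (rk_eval H g),
        unitary U,
        multiplication_by_z M_z,
        forall f : L2 R, M_z (U f) = U (S t f) &
        reproducing_kernel H k] /\
    [/\ U @` range (@ker_val R (L2 R) (L2 R) (adjoint (S t))) =
          [set g : H | exists e : E, rk_eval H g = cst e] &
        forall e : ker_space (adjoint (S t)), rk_eval H (U (ker_val e)) = cst e] /\
    [/\ (* (i) *)
        forall (lambda : D) (e : E), exists h : H,
          rk_eval H h = (fun z => k z lambda e) /\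
          forall f : L2 R, inner (rk_eval H (U f) lambda) e = inner (U f) h,
        (* (ii) *)
        forall (z lambda : D) (e : ker_space (adjoint (S t))),
          {ae @lebesgue_measure R, forall x : R, 0 <= x ->
            let s := series (fun n =>
              (phi x / phi (x + n%:R * t))%:C * val z ^+ n * (val lambda)^* ^+ n) in
            cvgn s /\
            (ker_val (k z lambda e) : L2 R) x =
              limn s * (ker_val e : L2 R) x},
        (* (iii) *)
        (forall p : D -> E, is_polynomial p -> exists g : H, rk_eval H g = p) /\
        dense [set g : H | is_polynomial (rk_eval H g)] &
        (* (iv) *)
        exists B : set H, orthonormal_basis B /\
          forall b, B b -> is_polynomial (rk_eval H b)].
Proof.
move=> L E D; pose T := S t; pose Ld : 'B(L2 R) := cauchy_dual T.
have [hLd hL Ladj Tadj kerE] :=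
  cauchy_dual_weighted_translation phi_gt0 phi_continuous phi_bounded S_semigroup phi_inf t_gt0.
have hT := weighted_translationE S_semigroup t_gt0.
have ratio_m := ratio_measurable phi_gt0 phi_continuous.
have TK := weighted_shiftK phi_gt0 t_gt0 hT hL.
have tail := iter_shift_backshift_tail phi_gt0 t_gt0 hT hL.
have [P PE] : exists P : 'B(L2 R), forall f, P f = f - T (L f).
  have [a [a0 Ta]] := bop_rbounded T; have [b [b0 Lb]] := bop_rbounded L.
  apply: (@bop_of_fun _ _ _ _ (1 + a * b)) => [c x y|x].
    have -> : T (L (c *: x + y)) = c *: T (L x) + T (L y) by rewrite !linearP.
    by rewrite opprD addrACA scalerBr.
  rewrite (le_trans (ler_rnormD _ _))// rnormN mulrDl mul1r lerD2l.
  by rewrite (le_trans (Ta _))// -mulrA ler_wpM2l// ltW.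
have r0 : 0 < (spectral_radius L)^-1.
  by rewrite invr_gt0; exact: (spectral_radius_gt0 phi_gt0 t_gt0 hT hLd hL Ladj PE).
have DP z : D z <-> Normc.normc z < (spectral_radius L)^-1 by rewrite /D /= -ltcR.
have /choice[B BE] : forall z : D, exists B, is_resolvent L (val z) B.
  by move=> z; apply: resolvent_exists; apply/DP; exact: set_valP.
have [ev evE] := model_exists PE TK kerE B.
have ev_inj : injective ev.
  by apply: (model_injective PE BE evE tail r0) => z /DP.
pose H : rkhs E D := @RKHS R E D (L2 R : hilbertType R) ev ev_inj
  (model_bounded evE).
have ev_cst := model_cst PE kerE BE evE.
have kernel (z lambda : D) : exists k : 'B(E), exists2 K : 'B(L2 R),
    (forall e : E, val (k e) = K (val e)) &
    (forall e : E, {ae @lebesgue_measure R, forall x : R, 0 <= x ->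
       let s := series (fun n =>
         (phi x / phi (x + n%:R * t))%:C * val z ^+ n * (val lambda)^* ^+ n) in
       cvgn s /\ (ker_val (k e) : L2 R) x = limn s * (ker_val e : L2 R) x}) /\
    forall e : E, exists2 h : L2 R, forall f, inner (ev f lambda) e = inner f h &
      P (B z h) = K (val e).
  pose a := Num.max (Normc.normc (val z)) (Normc.normc (val lambda)).
  have ar : a < (spectral_radius L)^-1.
    by rewrite gt_max; apply/andP; split; apply/DP; exact: set_valP.
  (* A point of the disc strictly beyond both [z] and [lambda]: its resolvent supplies the growth
     rate 1/s for Ld^n e. *)
  pose s : R := (a + (spectral_radius L)^-1) / 2.
  have as_ : a < s by rewrite /s; lra.
  have sr : s < (spectral_radius L)^-1 by rewrite /s; lra.
  have a0 : 0 <= a by rewrite le_max normc_ge0.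
  have s0 : 0 < s by exact: le_lt_trans as_.
  have ns : Normc.normc (s%:C : R[i]) = s by rewrite normc_real gtr0_norm.
  have sC0 : s%:C != 0 :> R[i].
    by apply/negP => /eqP/complexI s0'; rewrite s0' ltxx in s0.
  have [W hW] : exists W, is_resolvent L s%:C W by apply: resolvent_exists; rewrite ns.
  have zs : Normc.normc (val z) < Normc.normc (s%:C : R[i]).
    by rewrite ns (le_lt_trans _ as_)// le_max lexx.
  have ls : Normc.normc (val lambda) < Normc.normc (s%:C : R[i]).
    by rewrite ns (le_lt_trans _ as_)// le_max lexx orbT.
  have [K [K1 K2 K3]] :=
    kernel_multiplier phi_gt0 ratio_m t_gt0 hT hLd hL Ladj PE hW sC0 zs ls.
  have eLe (e : E) : L (val e) = 0 := ker_backshift kerE e.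
  have /choice[k0 hk0] : forall e : E, exists e' : E, val e' = K (val e).
    by move=> e; apply: ker_lift; apply/kerE; exact: (K2 _ (eLe e)).
  have [b [b0 Kb]] := bop_rbounded K.
  have [c x y|x|k hk] := @bop_of_fun _ E E k0 b.
  - by apply: val_inj; rewrite hk0 !ker_val_linear linearP !hk0.
  - by rewrite !ker_rnorm hk0.
  exists k, K; first by move=> e; rewrite hk hk0.
  split=> e.
    by have := K1 _ (eLe e); rewrite -hk0 -hk.
  have [C C0 hC] := dual_bound phi_gt0 t_gt0 hT hLd hL Ladj PE hW sC0.
  have [|||h [uh hh]] := @kernel_vector _ _ L Ld Ladj (val lambda) (C * rnorm (val e)) s^-1 (val e).
  - by rewrite invr_ge0 ltW.
  - by rewrite ltr_pdivrMr// mul1r -ns.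
  - by move=> n; have [h _] := hC n _ (eLe e); rewrite ns in h; rewrite mulrAC.
  exists h => [f|].
    (* Pairing with an element of E annihilates the part T L B f of P B f, since the adjoint of T
       vanishes on E. *)
    rewrite ker_inner evE PE innerBl (hh _ f (BE lambda)) Tadj ker_valP inner0r subr0//.
  (* The same sequence has two limits: P B_z h by continuity, and K e because P B_z Ld^n e = z^n L^n
     Ld^n e term by term. *)
  have c1 := @bop_cvg _ _ _ P _ _ (@bop_cvg _ _ _ (B z) _ _ uh).
  apply: (cvg_unique (@norm_hausdorff _ _) c1).
  have -> : (fun n => P (B z (\sum_(k < n) (val lambda)^* ^+ k *: iter k Ld (val e)))) =
      fun N => \sum_(n < N) ((val lambda)^* ^+ n * val z ^+ n) *: iter n L (iter n Ld (val e)).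
    apply/funext => N; rewrite !linear_sum; apply: eq_bigr => n _.
    rewrite !linearZ /= -scalerA; congr (_ *: _).
    rewrite (proj_resolvent_iter (BE z) (n := n)); last first.
      by move=> j jn; exact: (proj_backshift_dual phi_gt0 t_gt0 hT hLd hL PE).
    have dn := proj_backshift_dual_diag phi_gt0 t_gt0 hT hLd hL PE n (eLe e).
    rewrite (proj_resolvent _ _ (BE z)) -{2}dn.
    by rewrite (backshift_proj phi_gt0 t_gt0 hT hL PE) !linear0 ?scaler0 addr0 dn.
  exact: (K3 _ (eLe e)).
have /choice[k hk] : forall z : D, exists k : D -> 'B(E), forall lambda, exists2 K : 'B(L2 R),
    (forall e : E, val (k lambda e) = K (val e)) &
    (forall e : E, {ae @lebesgue_measure R, forall x : R, 0 <= x ->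
       let s := series (fun n =>
         (phi x / phi (x + n%:R * t))%:C * val z ^+ n * (val lambda)^* ^+ n) in
       cvgn s /\ (ker_val (k lambda e) : L2 R) x = limn s * (ker_val e : L2 R) x}) /\
    forall e : E, exists2 h : L2 R, forall f, inner (ev f lambda) e = inner f h &
      P (B z h) = K (val e).
  by move=> z; have /choice[k hk] := kernel z; exists k.
(* The vector obtained above may depend on [z]. All of them represent the same functional f |-> <ev
   f lambda, e>, so they coincide and a single one describes the kernel at every point. *)
have kernel_vec (z lambda : D) (e : E) : exists2 h : L2 R,
    ev h = (fun z' => k z' lambda e) & forall f, inner (ev f lambda) e = inner f h.
  have [K _ [_ hK]] := hk z lambda; have [h hh _] := hK e.
  exists h => //; apply/funext => z'; apply: val_inj; rewrite evE.
  have [K' kK' [_ hK']] := hk z' lambda; have [h' hh' PB] := hK' e.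
  rewrite kK' -PB; congr (P (B z' _)); apply/eqP; rewrite -subr_eq0; apply/eqP/inner_eq0 => f.
  by apply: inner_eq0_sym; rewrite innerBr -hh -hh' subrr.
have poly n (f : L2 R) := block_polynomial PE TK kerE BE evE n f.
exists H, (idfun : {linear L2 R -> L2 R}), T, (fun z lambda => k z lambda).
split; [split|split; [split|split]].
- by move=> g; exact: (model_analytic PE TK kerE BE evE g).
- by split=> // y; exists y.
- by move=> g z; exact: (model_shift PE TK BE evE g z).
- by [].
- by move=> lambda e; have [h h1 h2] := kernel_vec lambda lambda e; exists h.
- apply/seteqP; split=> [_ [_ [e _ <-] <-]|g [e ge]].
    by exists e; exact: ev_cst.
  exists (val e); first by exists e.
  exact: (@ev_inj (val e) g (etrans (ev_cst e) (esym ge))).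
- exact: ev_cst.
- by move=> lambda e; have [h h1 h2] := kernel_vec lambda lambda e; exists h.
- by move=> z lambda e; have [K _ [h _]] := hk z lambda; exact: h.
- split; last exact: (model_polynomials_dense PE TK kerE BE evE tail).
  move=> p [N [e pe]]; exists (\sum_(n < N.+1) iter n T (val (e n))).
  apply/funext => z; rewrite pe; exact: (model_polynomial PE TK kerE BE evE).
have [|||||C [CB hC]] := @graded_orthonormal_basis R (L2 R : hilbertType R)
  (fun n f => iter n T (P (iter n L f))).
- by move=> n a x; rewrite iter_linearZ linearZ iter_linearZ.
- exact: (block_adjoint phi_gt0 t_gt0 hT hL PE).
- exact: (block_idempotent phi_gt0 t_gt0 hT hL PE).
- by move=> n m x; exact: (block_orthogonal phi_gt0 t_gt0 hT hL PE).
- by move=> x; exact: (block_separating phi_gt0 t_gt0 hT hL PE).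
exists C; split=> // b Cb; have [n <-] := hC b Cb.
exact: poly.
Qed.
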